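(* For every positive integer $m$ and every polyhedral subset $S\subseteq\mathbb R_{>0}^m$ defined by linear equalities and inequalities with integer coefficients, there exists a linear Newton subdivision $N$ of some dilated simplex $\Delta_n$ whose realization space $\mathcal R(N)$ is linearly isomorphic to $S$.
   Context: For a positive integer $n$ let $\Delta_n=\{(x,y):x\ge0,\ y\ge0,\ x+y\le n\}$. Let $T=\mathrm{conv}\{(0,0),(1,0),(0,1)\}$ and let $\bar e_1=(-1,1)$, $\bar e_2=(0,-1)$, $\bar e_3=(1,0)$. For nonnegative integers $c,w_1,w_2,w_3$ let $P_{c,w_1,w_2,w_3}$ be the Minkowski sum of $c$ copies of $T$, $w_1$ copies of the segment $[0,\bar e_1]$, $w_2$ copies of $[0,\bar e_2]$ and $w_3$ copies of $[0,\bar e_3]$. A linear Newton subdivision of $\Delta_n$ is a polyhedral subdivision of $\Delta_n$ each of whose cells is a lattice translate of some $P_{c,w_1,w_2,w_3}$. For such a subdivision $N$, let $E_N$ be the set of edges (1-dimensional cells) of $N$ not contained in the boundary of $\Delta_n$, and $V_N$ the set of vertices of $N$ not on the boundary of $\Delta_n$. For $v\in V_N$ and an edge $e$ containing $v$, let $u_{e,v}$ be the primitive lattice vector parallel to $e$ pointing from $v$ along $e$. An exact metric on $N$ is a map $d:E_N\to\mathbb R_{>0}$ such that for every $v\in V_N$, $\sum_{e\ni v} d(e)\,u_{e,v}=0$. The realization space $\mathcal R(N)\subseteq\mathbb R_{>0}^{E_N}$ is the set of exact metrics on $N$. Two sets are linearly isomorphic if there is a linear map restricting to a bijection between them (with linear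 inverse).
   Formalization: The linear equalities and inequalities defining S are taken homogeneous and the inequalities strict; with weak ones (e.g. x ≥ y in the positive quadrant) or inhomogeneous ones (e.g. x > 1) the claim fails, since R(N) is a relatively open cone. *)

(* Defs.v *)
(* MathComp with MathComp-Analysis; plane polytopes are sets of row vectors over a
   realType R. *)
From HB Require Import structures.
From mathcomp Require Import all_boot all_order all_algebra.
From mathcomp Require Import all_classical all_reals all_analysis.

Set Implicit Arguments.
Unset Strict Implicit.
Unset Printing Implicit Defensive.

Import Order.TTheory GRing.Theory Num.Theory.
Import numFieldNormedType.Exports.

Local Open Scope classical_set_scope.
Local Open Scope ring_scope.

Section Plane.
Variable R : realType.
Local Notation plane := 'rV[R]_2.
Implicit Types (A B F C : set plane) (N : set (set plane)).

Definition pt (a b : R) : plane := \row_(j < 2) (if j == 0 then a else b).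

Definition lattice_pt (z : 'rV[int]_2) : plane := map_mx intr z.

Definition conv_hull A : set plane := smallest (@convex_set R plane) A.

Definition minkowski_sum A B : set plane := [set a + b | a in A & b in B].

(* The sum of zero copies is {0}. *)
Definition minkowski_copies (k : nat) A : set plane :=
  iter k (minkowski_sum A) [set 0].

Definition Delta (n : nat) : set plane :=
  [set p | [/\ 0 <= p 0 0, 0 <= p 0 1 & p 0 0 + p 0 1 <= n%:R]].

Definition boundary A : set plane := closure A `\` interior A.

Definition Tri : set plane := conv_hull [set pt 0 0; pt 1 0; pt 0 1].

Definition e1 : plane := pt (-1) 1.
Definition e2 : plane := pt 0 (-1).
Definition e3 : plane := pt 1 0.

Definition Pcell (c w1 w2 w3 : nat) : set plane :=
  minkowski_sum (minkowski_copies c Tri)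
    (minkowski_sum (minkowski_copies w1 (conv_hull [set 0; e1]))
      (minkowski_sum (minkowski_copies w2 (conv_hull [set 0; e2]))
        (minkowski_copies w3 (conv_hull [set 0; e3])))).

Definition Pcell_translate C : Prop :=
  exists (z : 'rV[int]_2) (c w1 w2 w3 : nat),
    C = [set lattice_pt z + x | x in Pcell c w1 w2 w3].

(* Nonempty faces; the zero functional exhibits A as a face of itself. *)
Definition face A F : Prop :=
  F !=set0 /\
  exists l : {linear plane -> R^o},
    F = [set x | A x /\ forall y, A y -> l y <= l x].

(* N is the set of all cells, of all dimensions.  Cells are polytopes because
   every Pcell_translate is one. *)
Record linear_newton_subdivision (n : nat) N : Prop := {
  lns_finite : finite_set N ;
  lns_cell   : forall C, N C -> Pcell_translate C ;
  lns_face   : forall C F, N C -> face C F -> N F ;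
  lns_inter  : forall C C', N C -> N C' ->
                 C `&` C' = set0 \/ (face C (C `&` C') /\ face C' (C `&` C')) ;
  lns_cover  : \bigcup_(C in N) C = Delta n
}.

(* Dimension of the affine hull: V is the least linear subspace such that A is
   contained in p + V. *)
Definition has_dim A (k : nat) : Prop :=
  exists (p : plane) (V : {vspace plane}),
    [/\ A p, \dim V = k, (forall x, A x -> x - p \in V)
      & forall W : {vspace plane}, (forall x, A x -> x - p \in W) -> (V <= W)%VS].

Definition inner_edges (n : nat) N : set (set plane) :=
  [set e | [/\ N e, has_dim e 1 & ~ (e `<=` boundary (Delta n))]].

Definition inner_vertices (n : nat) N : set plane :=
  [set v | N [set v] /\ ~ boundary (Delta n) v].

Definition primitive_direction (e : set plane) (v : plane) (u : 'rV[int]_2) : Prop :=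
  coprimez (u 0 0) (u 0 1) /\
  forall x, e x -> exists2 t : R, 0 <= t & x = v + t *: lattice_pt u.

(* When e is an edge of a subdivision and v one of its vertices, exactly one u
   satisfies primitive_direction e v u; the default 0 is then irrelevant. *)
Definition direction (e : set plane) (v : plane) : plane :=
  lattice_pt (xget 0 [set u | primitive_direction e v u]).

Definition exact_metric (n : nat) N (d : inner_edges n N -> R^o) : Prop :=
  (forall e : inner_edges n N, 0 < d e) /\
  forall v, inner_vertices n N v ->
    \sum_(e \in [set e : inner_edges n N | val e v])
       ((d e : R) *: direction (val e) v) = 0.

Definition realization_space (n : nat) N : set (inner_edges n N -> R^o) :=
  [set d | exact_metric d].

(* The inequalities are linear (homogeneous) and strict.  Strictness loses
   nothing: a linear isomorphism preserves relative openness, which every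
   realization space has, and a relatively open set given by linear equalities
   and weak inequalities is also given by equalities and strict ones, since
   each weak inequality is on it either an equality or everywhere strict. *)
Definition integral_polyhedral (m : nat) (S : set 'rV[R]_m) : Prop :=
  exists (p q : nat) (A : 'M[int]_(p, m)) (B : 'M[int]_(q, m)),
    S = [set x | [/\ forall j, 0 < x 0 j,
                     forall i, \sum_j (A i j)%:~R * x 0 j = 0
                   & forall i, 0 < \sum_j (B i j)%:~R * x 0 j]].

End Plane.

Definition linearly_isomorphic (R : realType) (U V : lmodType R)
    (A : set U) (B : set V) : Prop :=
  exists (f : {linear U -> V}) (g : {linear V -> U}),
    set_bij A B f /\ {in A, cancel f g}.

(* Main.v *)
(* The values of an exact metric are the bends, across the edges, of a function on
   the lattice points of [Delta n] that is affine on every cell.  If the cells are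
   the subdifferentials of a sum of tropical lines, the slopes of such a function
   place every line anew, with the incidences between rays and centres preserved,
   so that exact metrics correspond to the arrangements of the same type.

   Vertical lines at abscissae [s_0 < ... < s_L] carry the positive
   variables [s_(t+1) - s_t].  Between two horizontal rays, two parallel diagonals
   transport a distance [s_b - s_a] to [s_d - s_c], and such gadgets can be stacked
   without interaction.  A word listing each variable once, and then the sides of
   all equations as copies of variables, therefore encodes any system of integer
   linear equations in positive unknowns; strict inequalities become equations
   with positive slack variables.  This settles nonempty [S].  A nonregular
   subdivision of [Delta 6] has no exact metric and settles the empty [S]. *)

Require Import Defs.
From HB Require Import structures.
From mathcomp Require Import all_boot all_order all_algebra.
From mathcomp Require Import all_classical all_reals all_analysis.
From mathcomp Require Import finmap ring lra zify.

Set Implicit Arguments.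
Unset Strict Implicit.
Unset Printing Implicit Defensive.

Import Order.TTheory GRing.Theory Num.Theory.
Import numFieldNormedType.Exports.

Local Open Scope classical_set_scope.
Local Open Scope ring_scope.

(** * Polygons with edges parallel to the sides of the simplex *)

(** Metrics live on edges, arrangements in the dual plane; the Legendre conjugate of the sum of
    tropical lines translates between them. Conjugates of arrangements of one type bend across the
    same edges, which produces metrics. Conversely, a potential that bends only across edges has a
    well-defined slope along each ray, and lines that shared a ray keep equal slopes, which bounds
    the space of metrics from above. The obstacle is to make the two bounds meet. Every valid choice
    of abscissae has to give the same type, so no ray may pass a centre on a side that depends on
    the distances; hence each gadget has a strip of its own, high enough for its diagonals to leave
    it at or beyond the last vertical line. And no freedom may remain beside the abscissae, so the
    height of each strip is tied to them by one more incidence, on that last line. The edges dual to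
    the segments of the top horizontal line then serve as coordinates on the metrics. All cells are
    boxes in barycentric coordinates, which reduces the geometry to linear arithmetic. *)

Definition k0 : 'I_3 := @Ordinal 3 0 isT.
Definition k1 : 'I_3 := @Ordinal 3 1 isT.
Definition k2 : 'I_3 := @Ordinal 3 2 isT.

Lemma I3P (P : 'I_3 -> Prop) : P k0 -> P k1 -> P k2 -> forall k, P k.
Proof.
move=> P0 P1 P2 [[|[|[|//]]] i].
- by rewrite (_ : Ordinal i = k0) //; apply: val_inj.
- by rewrite (_ : Ordinal i = k1) //; apply: val_inj.
- by rewrite (_ : Ordinal i = k2) //; apply: val_inj.
Qed.

Lemma I3_all (P : pred 'I_3) : [forall k, P k] = [&& P k0, P k1 & P k2].
Proof.
apply/forallP/and3P => [h|[h0 h1 h2]]; first by split.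
exact: I3P.
Qed.

Lemma I3_three (k l m j : 'I_3) : k != l -> k != m -> l != m -> [\/ j = k, j = l | j = m].
Proof.
elim/I3P: j; elim/I3P: k; elim/I3P: l => //= _; elim/I3P: m => //= _ _; by constructor.
Qed.

Lemma sum_I3 (V : comNzRingType) (g : 'I_3 -> V) (a b c : 'I_3) :
  a != b -> a != c -> b != c -> g k0 + g k1 + g k2 = g a + g b + g c.
Proof.
by elim/I3P: a; elim/I3P: b => //; elim/I3P: c => // _ _ _; ring.
Qed.

Lemma sum3 (V : nmodType) (F : 'I_3 -> V) : \sum_k F k = F k0 + F k1 + F k2.
Proof.
rewrite !big_ord_recl big_ord0 addr0 addrA.
by congr (F _ + F _ + F _); apply: val_inj.
Qed.

Section PlaneCoordinates.
Variable R : realType.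
Local Notation plane := 'rV[R]_2.
Implicit Types (A B F C : set plane) (P Q : plane) (l : 'I_3 -> R).

Lemma pt0 (a b : R) : pt a b 0 0 = a. Proof. by rewrite mxE. Qed.
Lemma pt1 (a b : R) : pt a b 0 1 = b. Proof. by rewrite mxE. Qed.

Lemma plane_eq P Q : P 0 0 = Q 0 0 -> P 0 1 = Q 0 1 -> P = Q.
Proof.
move=> h0 h1; apply/rowP => -[[|[|//]] i].
- by rewrite (_ : Ordinal i = 0) //; apply: val_inj.
- by rewrite (_ : Ordinal i = 1) //; apply: val_inj.
Qed.

Definition corner (k : 'I_3) : plane := pt (k == k1)%:R (k == k2)%:R.

Lemma corner0 k : corner k 0 0 = (k == k1)%:R. Proof. exact: pt0. Qed.
Lemma corner1 k : corner k 0 1 = (k == k2)%:R. Proof. exact: pt1. Qed.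

(* Barycentric coordinates with respect to the corners of [Delta n], scaled so
   that they add up to [n]. *)
Definition bar (n : nat) P (k : 'I_3) : R :=
  if k == k0 then n%:R - P 0 0 - P 0 1 else if k == k1 then P 0 0 else P 0 1.

Lemma bar_sum n P : bar n P k0 + bar n P k1 + bar n P k2 = n%:R.
Proof. by rewrite /bar /=; ring. Qed.

Lemma bar_inj n P Q : bar n P =1 bar n Q -> P = Q.
Proof. by move=> h; apply: plane_eq; [exact: (h k1)|exact: (h k2)]. Qed.

Lemma bar_move n P t (k m j : 'I_3) :
  bar n (P + t *: (corner k - corner m)) j = bar n P j + t * ((j == k)%:R - (j == m)%:R).
Proof.
by elim/I3P: j; rewrite /bar !mxE /=; elim/I3P: k; elim/I3P: m => /=; ring.
Qed.

Lemma bar_conv n P Q t j :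
  bar n (t *: P + (1 - t) *: Q) j = t * bar n P j + (1 - t) * bar n Q j.
Proof. by elim/I3P: j; rewrite /bar !mxE /=; ring. Qed.

Lemma bar_surj n (y : 'I_3 -> R) : y k0 + y k1 + y k2 = n%:R ->
  exists P, bar n P =1 y.
Proof.
move=> h; exists (pt (y k1) (y k2)); elim/I3P; rewrite /bar /= ?pt0 ?pt1 //.
by rewrite -h; ring.
Qed.

Definition dot (n : nat) P l : R :=
  bar n P k0 * l k0 + bar n P k1 * l k1 + bar n P k2 * l k2.

Lemma dot_conv n P Q t l :
  dot n (t *: P + (1 - t) *: Q) l = t * dot n P l + (1 - t) * dot n Q l.
Proof. by rewrite /dot !bar_conv; ring. Qed.

Definition plane_form (a b : R) P : R^o := a * P 0 0 + b * P 0 1.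

Fact plane_form_is_linear a b : linear (plane_form a b).
Proof. by move=> t P Q; rewrite /plane_form !mxE /GRing.scale /=; ring. Qed.
HB.instance Definition _ a b :=
  GRing.isLinear.Build R plane R^o _ (plane_form a b) (plane_form_is_linear a b).

Lemma linear_dot n (f : {linear plane -> R^o}) P :
  f P = dot n P (fun k => f (corner k)).
Proof.
have -> : P = P 0 0 *: corner k1 + P 0 1 *: corner k2.
  by apply: plane_eq; rewrite mxE [X in _ = X + _]mxE [X in _ = _ + X]mxE
    ?corner0 ?corner1 /=; ring.
have c0 : corner k0 = 0 by apply: plane_eq; rewrite !mxE /=.
by rewrite linearD !linearZ /dot /bar /= !mxE /= c0 linear0 /GRing.scale /=; ring.
Qed.

Lemma dot_plane_form n P l :
  dot n P l = n%:R * l k0 + plane_form (l k1 - l k0) (l k2 - l k0) P.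
Proof. by rewrite /dot /plane_form /bar /=; ring. Qed.

(** The barycentric coordinates have a constant sum, so a constant added to [l] shifts [dot n P l]
    equally at all points: arbitrary functions on the three corners exhibit the same faces as linear
    forms. *)
Lemma faceP n A F : face A F <->
  F !=set0 /\ exists l, F = [set P | A P /\ forall Q, A Q -> dot n Q l <= dot n P l].
Proof.
split => -[F0 [f Ff]]; split => //; move: Ff => ->.
- exists (fun k => f (corner k)); apply/seteqP; split => x /= [Ax h];
    by split => // y Ay; move: (h _ Ay); rewrite !(linear_dot n).
- exists (plane_form (f k1 - f k0) (f k2 - f k0)).
  by apply/seteqP; split => x /= [Ax h]; split => // y Ay; move: (h _ Ay);
    rewrite !dot_plane_form lerD2l.
Qed.

(** The common shape of all cells, with edges and vertices as degenerate cases; membership,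
    convexity and intersection become inequalities between coordinates. *)
Definition hexagon (n : nat) (L U : 'I_3 -> int) : set plane :=
  [set P | forall k, (L k)%:~R <= bar n P k <= (U k)%:~R].

Lemma convex_setP A :
  (forall P Q t, 0 <= t -> t <= 1 -> A P -> A Q -> A (t *: P + (1 - t) *: Q)) ->
  @convex_set R plane A.
Proof.
move=> h P Q t; rewrite !in_setE => AP AQ; apply: h => //.
Qed.

Lemma conv_hullP A P Q t : 0 <= t -> t <= 1 ->
  conv_hull A P -> conv_hull A Q -> conv_hull A (t *: P + (1 - t) *: Q).
Proof.
move=> t0 t1 hP hQ B [cB AB].
have tP : Itv.spec (@Itv.num_sem R) (Itv.Real `[0%Z, 1%Z]) t.
  by rewrite /= /Itv.num_sem /= num_real /= in_itv /= t0.
have := cB P Q (Itv.mk tP).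
by rewrite !in_setE; apply; [exact: hP|exact: hQ].
Qed.

Lemma conv_hull_sub A B : A `<=` B ->
  (forall P Q t, 0 <= t -> t <= 1 -> B P -> B Q -> B (t *: P + (1 - t) *: Q)) ->
  conv_hull A `<=` B.
Proof. by move=> AB cB; apply: smallest_sub => //; exact: convex_setP. Qed.

Lemma conv_hull_gen A P : A P -> conv_hull A P.
Proof. exact: sub_gen_smallest. Qed.

End PlaneCoordinates.

(** * Minkowski sums as boxes in barycentric coordinates *)

Section Cells.
Variable R : realType.
Local Notation plane := 'rV[R]_2.
Implicit Types (A B F C : set plane) (P Q : plane) (l : 'I_3 -> R).

Lemma TriE : @Tri R = [set P | [/\ 0 <= P 0 0, 0 <= P 0 1 & P 0 0 + P 0 1 <= 1]].
Proof.
apply/seteqP; split.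
  apply: conv_hull_sub.
    by move=> x [[->|->]|->]; rewrite /= !pt0 !pt1; split; lra.
  move=> P Q t t0 t1 /= [p0 p1 p2] [q0 q1 q2]; rewrite !mxE; split; nra.
move=> P /= [p0 p1 p2].
have g0 : Tri (pt 0 0 : plane) by apply: conv_hull_gen; left; left.
have g1 : Tri (pt 1 0 : plane) by apply: conv_hull_gen; left; right.
have g2 : Tri (pt 0 1 : plane) by apply: conv_hull_gen; right.
have [s0|s0] := eqVneq (P 0 0 + P 0 1) 0.
  rewrite (_ : P = pt 0 0) //.
  by apply: plane_eq; rewrite ?pt0 ?pt1; lra.
have sp : 0 < P 0 0 + P 0 1 by rewrite lt_neqAle eq_sym s0 addr_ge0.
(* Radial projection from the origin: the inner combination lies on the opposite side. *)
have -> : P = (P 0 0 + P 0 1) *: ((P 0 0 / (P 0 0 + P 0 1)) *: pt 1 0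
    + (1 - P 0 0 / (P 0 0 + P 0 1)) *: pt 0 1)
    + (1 - (P 0 0 + P 0 1)) *: pt 0 0.
  by apply: plane_eq; rewrite !mxE /=; field.
apply: conv_hullP => //; first exact: ltW.
apply: conv_hullP => //; first by rewrite divr_ge0 // ltW.
by rewrite ler_pdivrMr // mul1r lerDl.
Qed.

Lemma segE (e : plane) :
  conv_hull [set 0; e] = [set P | exists2 t, 0 <= t <= 1 & P = t *: e].
Proof.
apply/seteqP; split.
  apply: conv_hull_sub.
    move=> x [->|->]; first by exists 0; rewrite ?scale0r // lexx ler01.
    by exists 1; rewrite ?scale1r // lexx ler01.
  move=> P Q t t0 t1 /= [s /andP[s0 s1] ->] [r /andP[r0 r1] ->].
  exists (t * s + (1 - t) * r); first by apply/andP; split; nra.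
  by rewrite !scalerA -scalerDl.
move=> P /= [t /andP[t0 t1] ->].
have -> : t *: e = t *: e + (1 - t) *: 0 by rewrite scaler0 addr0.
by apply: conv_hullP => //; apply: conv_hull_gen; [right|left].
Qed.

Lemma copies_Tri c : minkowski_copies c (@Tri R) =
  [set P | [/\ 0 <= P 0 0, 0 <= P 0 1 & P 0 0 + P 0 1 <= c%:R]].
Proof.
rewrite TriE; elim: c => [|c ih].
  apply/seteqP; split => P /=.
    by move=> ->; rewrite !mxE; split; lra.
  by move=> [p0 p1 p2]; apply: plane_eq; rewrite !mxE; lra.
rewrite /minkowski_copies iterS -/(minkowski_copies _ _) ih.
apply/seteqP; split => P /=.
  move=> [A [a0 a1 a2] [B [b0 b1 b2] <-]]; rewrite !mxE -natr1; split; lra.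
move=> [p0 p1 p2].
have [p3|p3] := leP (P 0 0 + P 0 1) 1.
  exists P => //; exists 0; rewrite ?addr0 // !mxE; split => //.
  by rewrite addr0 ler0n.
have s0 : P 0 0 + P 0 1 != 0 by apply: lt0r_neq0; lra.
(* Scaling by [t] puts the first summand on the side [x + y = 1], and the remainder fits into [c]
   triangles. *)
pose t := (P 0 0 + P 0 1)^-1.
have t0 : 0 <= t by rewrite invr_ge0; lra.
have t1 : t <= 1 by rewrite invf_le1; lra.
have ts : t * P 0 0 + t * P 0 1 = 1 by rewrite -mulrDr mulVf.
exists (t *: P); first by rewrite !mxE; split; nra.
exists ((1 - t) *: P); last by rewrite -scalerDl addrC subrK scale1r.
by move: p2; rewrite !mxE -natr1; split; nra.
Qed.

Lemma copies_seg w (e : plane) : minkowski_copies w (conv_hull [set 0; e]) =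
  [set P | exists2 t, 0 <= t <= w%:R & P = t *: e].
Proof.
rewrite segE; elim: w => [|w ih].
  apply/seteqP; split => P /=.
    by move=> ->; exists 0; rewrite ?scale0r // lexx.
  by move=> [t /le_anti <- ->]; rewrite scale0r.
rewrite /minkowski_copies iterS -/(minkowski_copies _ _) ih.
apply/seteqP; split => P /=.
  move=> [A [a /andP[a0 a1] ->] [B [b /andP[b0 b1] ->] <-]].
  exists (a + b); last by rewrite scalerDl.
  by rewrite -natr1; apply/andP; split; lra.
move=> [t /andP[t0 t1] ->]; have := ler0n R w.
have [t2|t2] := leP t 1 => w0.
  exists (t *: e); first by exists t => //; rewrite t0.
  exists 0; rewrite ?addr0 //; exists 0; rewrite ?scale0r //; apply/andP; split; lra.
exists (1 *: e); first by exists 1 => //; rewrite ler01 lexx.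
exists ((t - 1) *: e); last by rewrite -scalerDl addrC subrK.
by exists (t - 1) => //; move: t1; rewrite -natr1; lra.
Qed.

(** Fourier-Motzkin elimination: the coefficients [t3], [t2], [t1] of the segments are chosen in
    turn, each as the largest of its lower bounds, and the six inequalities are what keeps it under
    its upper bounds. *)
Lemma PcellE c w1 w2 w3 : @Pcell R c w1 w2 w3 =
  [set P | [/\ - w1%:R <= P 0 0 <= c%:R + w3%:R, - w2%:R <= P 0 1 <= c%:R + w1%:R
    & - w2%:R <= P 0 0 + P 0 1 <= c%:R + w3%:R]].
Proof.
rewrite /Pcell copies_Tri !copies_seg; apply/seteqP; split => P /=.
  move=> [A [a0 a1 a2] [B [C [t1 /andP[t10 t11] ->]]]].
  move=> [D [E [t2 /andP[t20 t21] ->]] [G [t3 /andP[t30 t31] ->] <-] <-] <-.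
  by rewrite !mxE /=; split; apply/andP; split; lra.
set c' := c%:R; set v1 := w1%:R; set v2 := w2%:R; set v3 := w3%:R.
have c0 : 0 <= c' :> R by exact: ler0n.
have v10 : 0 <= v1 :> R by exact: ler0n.
have v20 : 0 <= v2 :> R by exact: ler0n.
have v30 : 0 <= v3 :> R by exact: ler0n.
move=> [/andP[a0 a1] /andP[b0 b1] /andP[s0 s1]].
have [t3 [/andP[t30 t33] ta ts ta' ts']] : exists t : R, [/\ 0 <= t <= v3,
    P 0 0 - c' <= t, P 0 0 + P 0 1 - c' <= t, t <= P 0 0 + v1
    & t <= P 0 0 + P 0 1 + v2].
  exists (Num.max 0 (Num.max (P 0 0 - c') (P 0 0 + P 0 1 - c'))).
  by rewrite !le_max !ge_max !lexx !orbT /=; split=> //;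
    try (apply/and3P; split); try (apply/andP; split; first exact: lexx); lra.
pose a := P 0 0 - t3; pose b := P 0 1.
have [t2 [/andP[t20 t22] ua us ua' us']] : exists t : R, [/\ 0 <= t <= v2,
    - b <= t, - (a + b) <= t, t <= c' + v1 - b & t <= c' - (a + b)].
  exists (Num.max 0 (Num.max (- b) (- (a + b)))).
  by rewrite !le_max !ge_max !lexx !orbT /=; split=> //;
    try (apply/and3P; split); try (apply/andP; split; first exact: lexx);
    rewrite /a /b; lra.
have [t1 [/andP[t10 t11] wa ws wa' ws']] : exists t : R, [/\ 0 <= t <= v1,
    - a <= t, b + t2 - c' <= t, t <= b + t2 & t <= c' - a].
  exists (Num.max 0 (Num.max (- a) (b + t2 - c'))).
  by rewrite !le_max !ge_max !lexx !orbT /=; split=> //;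
    try (apply/and3P; split); try (apply/andP; split; first exact: lexx);
    move: ua us ua' us'; rewrite /a /b; lra.
exists (pt (a + t1) (b - t1 + t2)).
  by rewrite !pt0 !pt1; split; lra.
exists (t1 *: e1 R + (t2 *: e2 R + t3 *: e3 R)).
  exists (t1 *: e1 R); first by exists t1; rewrite ?t10.
  exists (t2 *: e2 R + t3 *: e3 R) => //.
  exists (t2 *: e2 R); first by exists t2; rewrite ?t20.
  by exists (t3 *: e3 R) => //; exists t3; rewrite ?t30.
by apply: plane_eq; rewrite !mxE /= /a /b; ring.
Qed.

(* In the paper's notation [beta] is the vector of lower bounds of the
   barycentric coordinates and [w k] counts the segments parallel to the side
   opposite to the corner [k]: [w k0 = w1], [w k1 = w2], [w k2 = w3]. *)
Lemma Pcell_translateP n C : Pcell_translate C <->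
  exists (beta : 'I_3 -> int) (c : nat) (w : 'I_3 -> nat),
    (beta k0 + beta k1 + beta k2 + (c + w k0 + w k1 + w k2)%:Z = n%:Z) /\
    C = @hexagon R n beta
      (fun k => beta k + c%:Z + (w k0)%:Z + (w k1)%:Z + (w k2)%:Z - (w k)%:Z).
Proof.
have trE (z : 'rV[int]_2) A P :
    [set lattice_pt R z + x | x in A] P <-> A (P - lattice_pt R z).
  split=> [[Q AQ <-]|AP]; first by rewrite addrC addKr.
  by exists (P - lattice_pt R z) => //; rewrite addrC subrK.
split => [[z [c [w1 [w2 [w3 ->]]]]]|[b [c [w [hn ->]]]]].
  exists (fun k => if k == k0 then n%:Z - z 0 0 - z 0 1 - (c + w3)%:Z
     else if k == k1 then z 0 0 - w1%:Z else z 0 1 - w2%:Z), c.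
  exists (fun k => if k == k0 then w1 else if k == k1 then w2 else w3) => /=.
  split; first by lia.
  apply/seteqP; split => P.
    move=> /trE; rewrite PcellE /= !mxE => -[/andP[a0 a1] /andP[b0 b1] /andP[s0 s1]].
    by elim/I3P; rewrite /bar /= ?PoszD !(intrD, intrN) -!pmulrn; apply/andP; split; lra.
  move=> h; apply/trE; rewrite PcellE /= !mxE.
  move: (h k0) (h k1) (h k2) => /andP[] + + /andP[] + + /andP[].
  rewrite /bar /= ?PoszD !(intrD, intrN) -!pmulrn => p0 p0' p1 p1' p2 p2'.
  by split; apply/andP; split; lra.
exists (\row_j (if j == 0 then b k1 + (w k0)%:Z else b k2 + (w k1)%:Z)), c.
exists (w k0), (w k1), (w k2).
have hR : (b k0)%:~R + (b k1)%:~R + (b k2)%:~R + c%:R + (w k0)%:R + (w k1)%:R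
    + (w k2)%:R = n%:R :> R.
  by move: (congr1 (fun z => z%:~R : R) hn); rewrite /= !PoszD !intrD -!pmulrn => <-; ring.
apply/seteqP; split => P.
  move=> h; apply/trE; rewrite PcellE /= !mxE /=.
  move: (h k0) (h k1) (h k2) => /andP[] + + /andP[] + + /andP[].
  rewrite /bar /= !(intrD, intrN) -!pmulrn => p0 p0' p1 p1' p2 p2'.
  by split; apply/andP; split; lra.
move=> /trE; rewrite PcellE /= !mxE /= !intrD -!pmulrn.
move=> [/andP[a0 a1] /andP[b0 b1] /andP[s0 s1]].
by elim/I3P; rewrite /bar /= !(intrD, intrN) -!pmulrn; apply/andP; split; lra.
Qed.

End Cells.

(** * The boundary of the simplex and sets of dimension one *)

Section Boundary.
Variable R : realType.
Local Notation plane := 'rV[R]_2.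
Implicit Types (A B F C : set plane) (P Q : plane).

Lemma DeltaE n : @Delta R n = [set P | forall k, 0 <= bar n P k].
Proof.
apply/seteqP; split => P /=.
  by move=> [p0 p1 p2]; elim/I3P; rewrite /bar /=; lra.
by move=> h; move: (h k0) (h k1) (h k2); rewrite /bar /=; split; lra.
Qed.

Lemma boundary_Delta n P : Delta n P ->
  boundary (Delta n) P <-> exists k, bar n P k = 0.
Proof.
move=> DP; split; last first.
  move=> [k Pk]; split; first exact: subset_closure.
  rewrite /interior => /nbhs_ballP[e /= e0 he].
  have [m mk] : exists m, m != k by elim/I3P: k Pk => _; [exists k1|exists k0|exists k0].
  have /he : ball P e (P + (e / 2) *: (corner R m - corner R k)).
    split=> // i j; rewrite (ord1 i) /ball /= !mxE opprD addNKr normrN normrM.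
    rewrite gtr0_norm ?divr_gt0 //.
    have : `|(if j == 0 then (m == k1)%:R else (m == k2)%:R) -
             (if j == 0 then (k == k1)%:R else (k == k2)%:R)| <= 1 :> R.
      by case: ifP => _; do 2 case: eqP => _; rewrite ?subrr ?subr0 ?sub0r ?normrN ?normr1 ?normr0.
    by move: `|_| => x; nra.
  rewrite DeltaE => /(_ k); rewrite bar_move Pk eqxx eq_sym (negPf mk).
  by rewrite sub0r add0r mulrN1 oppr_ge0 leNgt divr_gt0.
move=> [_ nI]; apply: contrapT => h; apply: nI.
have bp k : 0 < bar n P k.
  by rewrite lt_neqAle; move: DP; rewrite DeltaE => /(_ k) ->; rewrite andbT eq_sym;
     apply/eqP => h'; apply: h; exists k.
(* The coordinate [k0] changes with both Cartesian coordinates, hence the half. *)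
pose e := Num.min (bar n P k0 / 2) (Num.min (bar n P k1) (bar n P k2)).
apply/nbhs_ballP; exists e; first by rewrite /= !lt_min !bp divr_gt0.
move=> Q [_ PQ]; have := PQ 0 0; have := PQ 0 1; rewrite /ball /= !ltr_distl.
have : e <= bar n P k0 / 2 /\ e <= bar n P k1 /\ e <= bar n P k2.
  by rewrite /e !ge_min !lexx !orbT.
rewrite DeltaE /bar /= => -[e0 [e1 e2]] /andP[q0 q1] /andP[q2 q3].
by elim/I3P => /=; lra.
Qed.

Lemma has_dim1_line A P Q S : has_dim A 1 -> A P -> A Q -> A S -> P != Q ->
  exists t, S = P + t *: (Q - P).
Proof.
move=> [p [V [Ap dV AV _]]] AP AQ AS PQ.
have hV x y : A x -> A y -> x - y \in V.
  by move=> /AV hx /AV hy; rewrite -(subrKA p) memvD // -opprB memvN.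
have : <[Q - P]>%VS == V.
  by rewrite eqEdim dV -memvE hV // dim_vline subr_eq0 eq_sym PQ.
move=> /eqP VE; have := hV _ _ AS AP; rewrite -VE => /vlineP[t tE].
by exists t; rewrite -tE addrC subrK.
Qed.

Lemma has_dim1_two A : has_dim A 1 -> exists P Q, [/\ A P, A Q & P != Q].
Proof.
move=> [p [V [Ap dV AV minV]]]; apply: contrapT => h.
suff : (V <= 0)%VS by rewrite subv0 => /eqP V0; move: dV; rewrite V0 dimv0.
apply: minV => x Ax; rewrite memv0 subr_eq0.
by apply: contrapT => /negP xp; apply: h; exists x, p.
Qed.

Lemma has_dim1I A P Q : A P -> A Q -> P != Q ->
  (forall S, A S -> exists t, S = P + t *: (Q - P)) -> has_dim A 1.
Proof.
move=> AP AQ PQ h; exists P, <[Q - P]>%VS; split => //.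
- by rewrite dim_vline subr_eq0 eq_sym PQ.
- move=> S /h[t ->]; rewrite addrC addKr; exact/memvZ/memv_line.
- by move=> W hW; rewrite -memvE; exact: hW.
Qed.

End Boundary.

(** * Lattice points in barycentric coordinates, and lattice segments *)

Definition lat := {ffun 'I_3 -> nat}.
Definition dl (k : 'I_3) : lat := [ffun j => (j == k : nat)].
Definition deg (y : lat) : nat := (y k0 + y k1 + y k2)%N.

Lemma dlE k j : dl k j = (j == k) :> nat. Proof. by rewrite ffunE. Qed.

Lemma latDE (y y' : lat) j : (y + y') j = (y j + y' j)%N.
Proof. by rewrite ffunE. Qed.

Lemma degD (y y' : lat) : deg (y + y') = (deg y + deg y')%N.
Proof. by rewrite /deg !latDE; lia. Qed.

Lemma deg_dl k : deg (dl k) = 1%N.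
Proof. by elim/I3P: k; rewrite /deg !dlE. Qed.

Section Edges.
Variable R : realType.
Local Notation plane := 'rV[R]_2.
Local Notation corner := (corner R).
Implicit Types (A B F C e : set plane) (P Q : plane) (f : 'I_3 -> R) (y : lat).

Definition vec y : plane := pt (y k1)%:R (y k2)%:R.

Lemma vecD y y' : vec (y + y') = vec y + vec y'.
Proof. by apply: plane_eq; rewrite !mxE /= !latDE natrD. Qed.

Lemma vec_dl k : vec (dl k) = corner k.
Proof. by elim/I3P: k; rewrite /vec !dlE. Qed.

Lemma bar_vec n y k : deg y = n -> bar n (vec y) k = (y k)%:R.
Proof.
move=> <-; elim/I3P: k; rewrite /bar /= ?pt0 ?pt1 //.
by rewrite /deg !natrD; ring.
Qed.

Lemma vec_inj y y' : deg y = deg y' -> vec y = vec y' -> y = y'.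
Proof.
move=> dy e; apply/ffunP => k; apply/eqP; rewrite -(eqr_nat R).
by rewrite -(bar_vec k dy) e bar_vec.
Qed.

(** Among the six vectors [corner a - corner b] with [a != b], only equal or opposite ones are
    parallel. *)
Lemma has_dim1_dir A P (a b a' b' : 'I_3) : has_dim A 1 -> A P ->
  A (P + (corner a - corner b)) -> A (P + (corner a' - corner b')) ->
  a != b -> a' != b' -> (a = a' /\ b = b') \/ (a = b' /\ b = a').
Proof.
move=> dA AP; rewrite -![P + (corner _ - corner _)](congr1 _ (scale1r _)).
set Q := P + _; set S := P + _ => AQ AS ab ab'.
have PQ : P != Q.
  apply/eqP => /(congr1 (fun X => bar 0 X a)).
  by rewrite bar_move eqxx (negPf ab) /=; lra.
have [t St] := has_dim1_line dA AP AQ AS PQ.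
have := congr1 (fun X => bar 0 X k1) St; have := congr1 (fun X => bar 0 X k2) St.
rewrite /S /Q [P + 1 *: (corner a - corner b) - P]addrC addKr scalerA mulr1 !bar_move.
clear -ab ab'; elim/I3P: a ab; elim/I3P: b => //= _; elim/I3P: a' ab'; elim/I3P: b' => //= _;
  rewrite ?(eqxx, mulr1, mulr0) => *; try (by left); try (by right); exfalso; lra.
Qed.

Definition ipt (z : 'I_3 -> int) : plane := pt (z k1)%:~R (z k2)%:~R.

Lemma bar_ipt n z k : z k0 + z k1 + z k2 = n%:Z -> bar n (ipt z) k = (z k)%:~R.
Proof.
move=> h; have hn : n%:R = (z k0 + z k1 + z k2)%:~R :> R by rewrite h -pmulrn.
by elim/I3P: k; rewrite /bar /= ?pt0 ?pt1 // hn !intrD; ring.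
Qed.

Lemma hexagon_ipt n L U z : z k0 + z k1 + z k2 = n%:Z ->
  @hexagon R n L U (ipt z) <-> forall k, L k <= z k <= U k.
Proof.
by move=> hz; split=> h k; move: (h k); rewrite bar_ipt // !ler_int.
Qed.

Definition seg y (k l : 'I_3) (len : nat) : set plane :=
  [set P | exists2 t, 0 <= t <= len%:R & P = vec y + t *: (corner k - corner l)].

Lemma ipt_move z (a b : 'I_3) :
  ipt z + (corner a - corner b) = ipt (fun j => z j + (j == a)%:Z - (j == b)%:Z).
Proof.
apply: plane_eq; rewrite !mxE /= !(intrD, intrN) -!pmulrn.
  by rewrite [k1 == a]eq_sym [k1 == b]eq_sym addrA.
by rewrite [k2 == a]eq_sym [k2 == b]eq_sym addrA.
Qed.

Lemma hexagon_dim1 n L U z (a b a' b' : 'I_3) :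
  has_dim (@hexagon R n L U) 1 -> z k0 + z k1 + z k2 = n%:Z ->
  (forall k, L k <= z k <= U k) ->
  (forall k, L k <= z k + (k == a)%:Z - (k == b)%:Z <= U k) ->
  (forall k, L k <= z k + (k == a')%:Z - (k == b')%:Z <= U k) ->
  a != b -> a' != b' -> (a = a' /\ b = b') \/ (a = b' /\ b = a').
Proof.
move=> d hz h1 h2 h3; apply: (has_dim1_dir (P := ipt z) d).
- exact/hexagon_ipt.
- rewrite ipt_move; apply/hexagon_ipt => //.
  by elim/I3P: a {h2}; elim/I3P: b => /=; lia.
- rewrite ipt_move; apply/hexagon_ipt => //.
  by elim/I3P: a' {h3}; elim/I3P: b' => /=; lia.
Qed.

Lemma bar_inj2 n P Q (k m : 'I_3) : k != m ->
  bar n P k = bar n Q k -> bar n P m = bar n Q m -> P = Q.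
Proof.
move=> km hk hm; apply: (@bar_inj _ n); have := bar_sum n P; rewrite -(bar_sum n Q).
by elim/I3P: k km hk; elim/I3P: m hm => //= hm _ hk h; elim/I3P; lra.
Qed.

Lemma hexagon_seg n b U (k l m : 'I_3) (len : nat) :
  k != l -> k != m -> l != m -> (0 < len)%N ->
  b k0 + b k1 + b k2 + len%:Z = n%:Z ->
  (forall j, U j = b j + (if j == m then 0 else len%:Z)) ->
  @hexagon R n b U `<=` Delta n ->
  exists y, [/\ (len <= y l)%N, deg y = n & @hexagon R n b U = seg y k l len].
Proof.
move=> kl km lm len0 hs UE HD.
pose z (j : 'I_3) := b j + (if j == l then len%:Z else 0).
pose z' (j : 'I_3) := b j + (if j == k then len%:Z else 0).
have sz : z k0 + z k1 + z k2 = n%:Z.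
  by rewrite -hs /z; elim/I3P: l {z z' kl lm} => /=; lia.
have sz' : z' k0 + z' k1 + z' k2 = n%:Z.
  by rewrite -hs /z'; elim/I3P: k {z z' kl km sz} => /=; lia.
(* [z] and [z'] are the ends of the segment; each coordinate is at its lower bound in one of them,
   and both lie in the simplex. *)
have bpos j : 0 <= b j.
  have hz : @hexagon R n b U (ipt z).
    apply/hexagon_ipt => // i; rewrite UE /z.
    by case: (eqVneq i l) => [->|_]; rewrite ?(negPf lm) /=; [|case: (eqVneq i m) => _]; lia.
  have hz' : @hexagon R n b U (ipt z').
    apply/hexagon_ipt => // i; rewrite UE /z'.
    by case: (eqVneq i k) => [->|_]; rewrite ?(negPf km) /=; [|case: (eqVneq i m) => _]; lia.
  move: (HD _ hz) (HD _ hz'); rewrite DeltaE => /(_ j) + /(_ j).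
  rewrite !bar_ipt // !ler0z /z /z'; case: eqP => [->|_]; last by rewrite addr0.
  by rewrite eq_sym (negPf kl) addr0.
pose y : lat := [ffun j => `|z j|%N].
have yz j : (y j)%:Z = z j.
  by rewrite /y ffunE gez0_abs // /z; have := bpos j; case: eqP; lia.
have dy : deg y = n by rewrite /deg; have := yz k0; have := yz k1; have := yz k2; lia.
have yzR j : (y j)%:R = (z j)%:~R :> R by rewrite -yz pmulrn.
exists y; split => //.
  by have := yz l; rewrite /z eqxx; have := bpos l; lia.
apply/seteqP; split => P.
  move=> hP; exists (bar n P k - (b k)%:~R).
    by have := hP k; rewrite UE (negPf km) intrD -pmulrn => /andP[h1 h2]; apply/andP; split; lra.
  apply: (bar_inj2 (n := n) km); rewrite bar_move bar_vec // yzR /z.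
    by rewrite eqxx (negPf kl) /= addr0; ring.
  have := hP m; rewrite UE eqxx addr0 => /le_anti <-.
  by rewrite ![m == _]eq_sym (negPf km) (negPf lm) /= addr0; ring.
move=> [t /andP[t0 t1] ->] j; rewrite bar_move bar_vec // yzR /z UE.
have [->|jk] := eqVneq j k.
  by rewrite (negPf kl) (negPf km) /= !intrD -pmulrn; apply/andP; split; lra.
have [->|jl] := eqVneq j l.
  by rewrite (negPf lm) /= !intrD -pmulrn; apply/andP; split; lra.
rewrite /= !intrD; have : 0 <= (if j == m then 0 else len%:Z)%:~R :> R.
  by rewrite ler0z; case: eqP; lia.
by move=> h; apply/andP; split; lra.
Qed.

(** A triangle, or segments of two kinds, among the summands would give a lattice point [z] of the
    cell with neighbours in two non-parallel directions. So there is no triangle and exactly one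
    kind of segment. *)
Lemma Pcell_dim1 n C : Pcell_translate C -> has_dim C 1 -> C `<=` Delta n ->
  exists y k l len, [/\ k != l, (0 < len)%N, (len <= y l)%N, deg y = n
    & C = seg y k l len].
Proof.
move=> /(Pcell_translateP n)[b [c [w [hn CE]]]] dC CD.
pose U := fun k => b k + c%:Z + (w k0)%:Z + (w k1)%:Z + (w k2)%:Z - (w k)%:Z.
move: (dC); rewrite CE -/U => dH.
have c0 : c = 0%N.
  apply/eqP; rewrite -leqn0 leqNgt; apply/negP => c0.
  pose z (k : 'I_3) : int := b k + (if k == k0 then (c + w k2)%:Z
    else if k == k1 then (w k0)%:Z else (w k1)%:Z).
  have : (k1 = k2 /\ k0 = k0) \/ (k1 = k0 /\ k0 = k2); last by case=> -[].
  by apply: (hexagon_dim1 (z := z) dH) => //; [rewrite /z /=; lia|..];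
    elim/I3P; rewrite /z /U /=; lia.
have w01 : (w k0 == 0)%N || (w k1 == 0)%N.
  apply: contraT; rewrite negb_or -!lt0n => /andP[w0 w1].
  pose z (k : 'I_3) : int := b k + (if k == k0 then (w k1 + w k2)%:Z
    else if k == k1 then (w k0)%:Z else 0).
  have : (k2 = k2 /\ k0 = k1) \/ (k2 = k1 /\ k0 = k2); last by case=> -[].
  by apply: (hexagon_dim1 (z := z) dH) => //; [rewrite /z /=; lia|..];
    elim/I3P; rewrite /z /U /=; lia.
have w02 : (w k0 == 0)%N || (w k2 == 0)%N.
  apply: contraT; rewrite negb_or -!lt0n => /andP[w0 w1].
  pose z (k : 'I_3) : int := b k + (if k == k0 then (w k1 + w k2)%:Z
    else if k == k2 then (w k0)%:Z else 0).
  have : (k1 = k1 /\ k0 = k2) \/ (k1 = k2 /\ k0 = k1); last by case=> -[].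
  by apply: (hexagon_dim1 (z := z) dH) => //; [rewrite /z /=; lia|..];
    elim/I3P; rewrite /z /U /=; lia.
have w12 : (w k1 == 0)%N || (w k2 == 0)%N.
  apply: contraT; rewrite negb_or -!lt0n => /andP[w0 w1].
  pose z (k : 'I_3) : int := b k + (if k == k1 then (w k0 + w k2)%:Z
    else if k == k2 then (w k1)%:Z else 0).
  have : (k0 = k0 /\ k1 = k2) \/ (k0 = k2 /\ k1 = k0); last by case=> -[].
  by apply: (hexagon_dim1 (z := z) dH) => //; [rewrite /z /=; lia|..];
    elim/I3P; rewrite /z /U /=; lia.
have wpos : (0 < w k0 + w k1 + w k2)%N.
  rewrite lt0n; apply/eqP => w0.
  have [P [Q [CP CQ /eqP]]] := has_dim1_two dC; apply.
  apply: (@bar_inj _ n) => k; move: CP CQ; rewrite CE => /(_ k) + /(_ k).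
  rewrite (_ : b k + _ + _ + _ + _ - _ = b k); last by elim/I3P: k; lia.
  by move=> /le_anti <- /le_anti <-.
have [m [wm wE]] : exists m,
    (forall k, k != m -> w k = 0%N) /\ (w k0 + w k1 + w k2 = w m)%N.
  have [w0|w0] := posnP (w k0); last by exists k0; split; [elim/I3P => //= _|]; lia.
  have [w1|w1] := posnP (w k1); last by exists k1; split; [elim/I3P => //= _|]; lia.
  by exists k2; split; [elim/I3P|lia].
have UE k : U k = b k + (w m)%:Z - (w k)%:Z by rewrite /U c0; lia.
have wm0 : (0 < w m)%N by rewrite -wE.
have [k [l [kl km lm]]] : exists k l : 'I_3, [/\ k != l, k != m & l != m].
  by clear; elim/I3P: m; [exists k1, k2|exists k0, k2|exists k0, k1].
have hs : b k0 + b k1 + b k2 + (w m)%:Z = n%:Z.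
  by rewrite -hn c0; lia.
have UE' j : U j = b j + (if j == m then 0 else (w m)%:Z).
  by rewrite UE; case: (eqVneq j m) => [->|/wm ->]; lia.
have [y [yl dy ys]] := hexagon_seg kl km lm wm0 hs UE' (eq_ind _ (fun X => X `<=` _) CD _ CE).
by exists y, k, l, (w m); split.
Qed.

End Edges.

(** * Edges, their ends and their primitive directions *)

Section EdgesOfSubdivision.
Variable R : realType.
Local Notation plane := 'rV[R]_2.
Local Notation corner := (corner R).
Local Notation vec := (vec R).
Implicit Types (A B F C e : set plane) (P Q v : plane) (f : 'I_3 -> R) (y z : lat).

Definition mid P Q : plane := 2^-1 *: P + (1 - 2^-1) *: Q.

Lemma face_mid A F P Q : face A F -> A P -> A Q -> F (mid P Q) -> F P /\ F Q.
Proof.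
move=> /(faceP 0)[_ [f ->]] AP AQ /= [Am h].
have := h _ AP; have := h _ AQ; rewrite /mid dot_conv => hQ hP.
by split; split=> // X /h; rewrite dot_conv; lra.
Qed.

(** The same segments as [seg], written symmetrically: [z] is what both ends have in common, so that
    [k] and [l] can be exchanged. *)
Definition sg z (k l : 'I_3) (len : nat) : set plane :=
  [set P | exists2 s, 0 <= s <= len%:R &
     P = vec z + s *: corner k + (len%:R - s) *: corner l].

Lemma sgC z k l len : sg z k l len = sg z l k len.
Proof.
by apply/seteqP; split => P [s /andP[s0 s1] ->]; exists (len%:R - s);
  rewrite ?subKr 1?addrAC //; apply/andP; split; lra.
Qed.

Lemma bar_sg n z k l len s j : (deg z + len)%N = n ->
  bar n (vec z + s *: corner k + (len%:R - s) *: corner l) j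
  = (z j)%:R + s * (j == k)%:R + (len%:R - s) * (j == l)%:R.
Proof.
move=> <-; rewrite /bar !mxE /= /deg !natrD.
by elim/I3P: j; elim/I3P: k; elim/I3P: l => /=; ring.
Qed.

Lemma dot_sg n z k l len s f : (deg z + len)%N = n ->
  dot n (vec z + s *: corner k + (len%:R - s) *: corner l) f
  = (z k0)%:R * f k0 + (z k1)%:R * f k1 + (z k2)%:R * f k2
    + s * f k + (len%:R - s) * f l.
Proof.
by move=> h; rewrite /dot !bar_sg //; elim/I3P: k; elim/I3P: l => /=; ring.
Qed.

Lemma sg_face z k l len : k != l -> face (sg z k l len) [set vec z + len%:R *: corner l].
Proof.
move=> kl; pose n := (deg z + len)%N; apply/(faceP n).
split; first by exists (vec z + len%:R *: corner l).
have e0 : vec z + len%:R *: corner l = vec z + 0 *: corner k + (len%:R - 0) *: corner l.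
  by rewrite scale0r addr0 subr0.
exists (fun j => (j == l)%:R); apply/seteqP; split => P.
  move=> ->; split.
    by exists 0 => //; rewrite lexx ler0n.
  move=> Q [s /andP[s0 s1] ->]; rewrite e0 !dot_sg // eqxx (negPf kl) /=; lra.
move=> [[s /andP[s0 s1] ->]] /(_ (vec z + 0 *: corner k + (len%:R - 0) *: corner l)).
have h : sg z k l len (vec z + 0 *: corner k + (len%:R - 0) *: corner l).
  by exists 0 => //; rewrite lexx ler0n.
move=> /(_ h); rewrite !dot_sg // eqxx (negPf kl) /= => h'.
have -> : s = 0 by lra.
by rewrite -e0.
Qed.

Variables (n : nat) (N : set (set plane)) (HN : linear_newton_subdivision n N).

Lemma cell_Delta C : N C -> C `<=` Delta n.
Proof. by move=> NC; rewrite -(lns_cover HN) => P CP; exists C. Qed.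

(** The intersection with [e] is a face of [C], and a functional maximal at a midpoint is maximal at
    both ends. Most later uses of the face-to-face condition go through this property. *)
Lemma flat C e P Q : N C -> N e -> C P -> C Q -> e (mid P Q) -> e P /\ e Q.
Proof.
move=> NC Ne CP CQ em.
have Cm : C (mid P Q).
  have /(Pcell_translateP n)[b [c [w [_ CE]]]] := lns_cell HN NC.
  move: CP CQ; rewrite CE => hP hQ k; have := hP k; have := hQ k.
  by rewrite /mid bar_conv => /andP[q0 q1] /andP[p0 p1]; apply/andP; split; lra.
have [C0|[fC _]] := lns_inter HN NC Ne.
  by have : (C `&` e) (mid P Q) by []; rewrite C0.
by have [[_ eP] [_ eQ]] := face_mid fC CP CQ (conj Cm em).
Qed.

Lemma edge_sg e : N e -> has_dim e 1 -> exists z k l len,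
  [/\ k != l, (0 < len)%N, (deg z + len)%N = n & e = sg z k l len].
Proof.
move=> Ne de; have [y [k [l [len [kl len0 leny dy ->]]]]] :=
  Pcell_dim1 (lns_cell HN Ne) de (cell_Delta Ne).
pose z : lat := [ffun j => if j == l then y l - len else y j]%N.
have dz : (deg z + len)%N = n.
  by rewrite -dy /deg /z !ffunE; elim/I3P: l leny {kl z} => /=; lia.
exists z, k, l, len; split => //; apply/seteqP; split => P [s hs ->];
exists s => //; apply: (@bar_inj _ n) => j; rewrite bar_move bar_vec // bar_sg //;
rewrite ffunE; case: (eqVneq j l) => [->|jl];
  rewrite ?natrB //= 1?[l == k]eq_sym ?(negPf kl) ?(negPf jl) /=; ring.
Qed.

Lemma sg_third z k l len P (a b : 'I_3) : k != l -> a != b ->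
  sg z k l len P -> sg z k l len (P + (corner a - corner b)) ->
  (a = k /\ b = l) \/ (a = l /\ b = k).
Proof.
move=> kl ab [s _ ->] [t _] /(congr1 (bar (deg z + len))) /[dup].
move=> /(congr1 (fun g => g k0)) + /(congr1 (fun g => g k1)).
rewrite -[corner a - _]scale1r !bar_move !bar_sg //.
by elim/I3P: k kl; elim/I3P: l => //= _; elim/I3P: a ab; elim/I3P: b => //= _;
  move=> *; try (by left); try (by right); exfalso; lra.
Qed.

(** A point inside the edge is the midpoint of two other points of it, and [flat] would put both
    into the cell [[set v]]. The orientation is chosen so that [v] is the end near the corner
    [l]. *)
Lemma vertex_sg e v : N e -> has_dim e 1 -> N [set v] -> e v -> exists z k l len,
  [/\ k != l, (0 < len)%N, (deg z + len)%N = n, e = sg z k l len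
    & v = vec z + len%:R *: corner l].
Proof.
move=> Ne de Nv ev; have [z [k [l [len [kl len0 dz eE]]]]] := edge_sg Ne de.
move: ev; rewrite eE => -[s /andP[s0 s1] vE].
have [s0'|sn0] := eqVneq s 0.
  by exists z, k, l, len; split => //; rewrite vE s0' scale0r addr0 subr0.
have [sl|snl] := eqVneq s len%:R.
  exists z, l, k, len; split => //; [by rewrite eq_sym|by rewrite sgC|].
  by rewrite vE sl subrr scale0r addr0.
have sp : 0 < s by rewrite lt_neqAle eq_sym sn0.
have sl : s < len%:R by rewrite lt_neqAle snl.
pose r := Num.min s (len%:R - s).
have rp : 0 < r by rewrite lt_min sp subr_gt0.
have [r1 r2] : r <= s /\ r <= len%:R - s by split; rewrite ge_min lexx ?orbT.
pose Q t : plane := vec z + t *: corner k + (len%:R - t) *: corner l.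
have Qm : v = mid (Q (s - r)) (Q (s + r)).
  by apply: (@bar_inj _ n) => j; rewrite vE /mid bar_conv !bar_sg //; field.
have [eq1 _] : [set v] (Q (s - r)) /\ [set v] (Q (s + r)).
  apply: (@flat e) => //; rewrite ?eE.
  - by exists (s - r) => //; apply/andP; split; lra.
  - by exists (s + r) => //; apply/andP; split; lra.
have := congr1 (fun X => bar n X k) eq1.
by rewrite vE !bar_sg // eqxx (negPf kl) /=; lra.
Qed.

(** A competing primitive vector [u'] is a positive multiple of [corner k - corner l], so its two
    coordinates and their sum have the same signs. One of these three numbers vanishes, and
    coprimality then leaves only entries of absolute value at most one. *)
Lemma direction_sg z k l len : k != l -> (0 < len)%N ->
  direction (sg z k l len) (vec z + len%:R *: corner l) = corner k - corner l.
Proof.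
move=> kl len0.
pose u : 'rV[int]_2 := \row_j (if j == 0 then (k == k1)%:Z - (l == k1)%:Z
                               else (k == k2)%:Z - (l == k2)%:Z).
have uE : lattice_pt R u = corner k - corner l.
  by apply: plane_eq; rewrite !mxE /= intrD intrN -!pmulrn.
rewrite /direction -uE; congr lattice_pt; apply: xget_unique.
  split; first by rewrite !mxE /=; elim/I3P: k kl {u uE}; elim/I3P: l.
  move=> P [s /andP[s0 s1] ->]; exists s => //; rewrite uE.
  by apply: plane_eq; rewrite !mxE /=; ring.
move=> u' [cu' hu'].
have [t t0 ht] := hu' (vec z + len%:R *: corner k + (len%:R - len%:R) *: corner l)
  (ex_intro2 _ _ len%:R (introT andP (conj (ler0n _ _) (lexx _))) erefl).
have lenR : 0 < len%:R :> R by rewrite ltr0n.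
have E0 : t * (u' 0 0)%:~R = len%:R * ((k == k1)%:R - (l == k1)%:R).
  by have := congr1 (fun X : plane => X 0 0) ht; rewrite !mxE /=; lra.
have E1 : t * (u' 0 1)%:~R = len%:R * ((k == k2)%:R - (l == k2)%:R).
  by have := congr1 (fun X : plane => X 0 1) ht; rewrite !mxE /=; lra.
have tp : 0 < t.
  rewrite lt_neqAle t0 andbT; apply/eqP => t00; move: E0 E1; rewrite -t00 !mul0r.
  by move: kl; clear -lenR; elim/I3P: k; elim/I3P: l => //= _; lra.
have sgn (z' d : int) : t * z'%:~R = len%:R * d%:~R ->
    [/\ d = 0 -> z' = 0, d = 1 -> 0 < z' & d = -1 -> z' < 0].
  move=> hz; split=> dE; move: hz; rewrite dE.
  - by rewrite mulr0 => /eqP; rewrite mulf_eq0 (gt_eqF tp) intr_eq0 => /eqP.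
  - by rewrite mulr1 => hz; rewrite -(ltr0z R) -(pmulr_rgt0 _ tp) hz.
  - by rewrite mulrN1z mulrN1 => hz; rewrite -(ltrz0 R) -(pmulr_rlt0 _ tp) hz oppr_lt0.
have [/sgn[] s00 s01 s02 /sgn[] s10 s11 s12 /sgn[] s20 _ _] :
    [/\ t * (u' 0 0)%:~R = len%:R * (u 0 0)%:~R,
    t * (u' 0 1)%:~R = len%:R * (u 0 1)%:~R &
    t * (u' 0 0 + u' 0 1)%:~R = len%:R * (u 0 0 + u 0 1)%:~R].
  by rewrite !mxE /= !(intrD, intrN) -!pmulrn; split=> //; rewrite mulrDr E0 E1; ring.
move: cu' s00 s01 s02 s10 s11 s12 s20; rewrite coprimezE !mxE /=.
set a := u' 0 0; set b := u' 0 1 => cab s00 s01 s02 s10 s11 s12 s20.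
have gab : (a = 0 \/ b = 0 \/ a + b = 0) -> (absz a <= 1 /\ absz b <= 1)%N.
  case=> [a0|[b0|ab0]].
  - by move: cab; rewrite a0 /coprime gcd0n => /eqP ->.
  - by move: cab; rewrite b0 /coprime gcdn0 => /eqP ->.
  - have ab : absz a = absz b by lia.
    by move: cab; rewrite ab /coprime gcdnn => /eqP ->.
suff [aE bE] : a = u 0 0 /\ b = u 0 1.
  apply/rowP => -[[|[|//]] i].
  - by rewrite (_ : Ordinal i = 0) //; apply: val_inj.
  - by rewrite (_ : Ordinal i = 1) //; apply: val_inj.
rewrite !mxE /=; move: kl s00 s01 s02 s10 s11 s12 s20 gab; clear.
elim/I3P: k; elim/I3P: l => //= _; lia.
Qed.

End EdgesOfSubdivision.

(** * Exact metrics and discrete potentials *)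

Section ClosedMetrics.
Variable R : realType.
Local Notation plane := 'rV[R]_2.
Local Notation corner := (corner R).
Local Notation vec := (vec R).
Implicit Types (P Q v : plane) (y z : lat).
Variables (n : nat) (N : set (set plane)) (HN : linear_newton_subdivision n N).
Local Notation edge := (inner_edges n N).
Implicit Types (e : edge) (d : edge -> R^o).

Lemma edge_N e : N (val e). Proof. by have [] := set_mem (valP e). Qed.
Lemma edge_dim e : has_dim (val e) 1. Proof. by have [] := set_mem (valP e). Qed.

Lemma finite_edges : finite_set [set: edge].
Proof.
apply: sub_finite_set (finite_preimage (B := N) (f := val) _ (lns_finite HN)).
  by move=> e _; exact: edge_N.
by move=> x y _ _; exact: val_inj.
Qed.

Lemma fsumE (V : nmodType) (A : set edge) (F : edge -> V) :
  \sum_(e \in A) F e = \sum_(e <- fset_set [set: edge]) (if e \in A then F e else 0).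
Proof.
rewrite fsbig_mkcond fsbig_finite; last exact: finite_edges.
by apply: eq_bigr => e _; rewrite /patch; case: ifP.
Qed.

(** For adjacent lattice points at most one edge contributes; writing a sum yields zero when there
    is none, without choosing the edge. *)
Definition weight d P Q : R := \sum_(e \in [set e : edge | val e P /\ val e Q]) (d e : R).

Lemma weightC d P Q : weight d P Q = weight d Q P.
Proof. by apply: eq_fsbigl; apply/seteqP; split => e [? ?]; split. Qed.

Definition vertex_sum d v : plane :=
  \sum_(e \in [set e : edge | val e v]) ((d e : R) *: direction (val e) v).

(** An edge ending at [v] is at least one lattice step long, so it contains exactly one of the six
    neighbours of [v], the one in its own direction; the sum is regrouped by that neighbour. *)
Lemma vertex_sumE d v : N [set v] -> vertex_sum d v =
  \sum_a \sum_(b | b != a) weight d v (v + (corner a - corner b)) *: (corner a - corner b).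
Proof.
move=> Nv; rewrite /vertex_sum fsumE.
under [RHS]eq_bigr => a _ do under eq_bigr => b _ do rewrite /weight fsumE scaler_suml.
under [RHS]eq_bigr => a _ do rewrite exchange_big.
rewrite [RHS]exchange_big /=; apply: eq_bigr => e _.
case: ifPn => [/set_mem /= ev|]; last first.
  move=> /negP ev; rewrite big1 // => a _; rewrite big1 // => b _.
  by case: ifPn => [/set_mem[ev1 _]|]; rewrite ?scale0r //; case: ev; exact: mem_set.
have [z [k [l [len [kl len0 dz eE vE]]]]] := vertex_sg HN (edge_N e) (edge_dim e) Nv ev.
have mem a b : b != a ->
    (e \in [set e : edge | val e v /\ val e (v + (corner a - corner b))]) = (a == k) && (b == l).
  move=> ba; apply/idP/idP => [/set_mem /=|].
    move=> [_]; rewrite eE => h; have := ev; rewrite eE => hv.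
    have ab : a != b by rewrite eq_sym.
    case: (sg_third kl ab hv h) => -[ak bl]; first by rewrite ak bl !eqxx.
    move: h; rewrite vE ak bl => -[s /andP[s0 _]] /(congr1 (fun X => bar n X k)).
    rewrite -[corner l - _]scale1r bar_move !bar_sg // ?eqxx (negPf kl) /=.
    have -> : vec z + len%:R *: corner l = vec z + 0 *: corner k + (len%:R - 0) *: corner l.
      by rewrite scale0r addr0 subr0.
    by rewrite bar_sg // eqxx (negPf kl) /=; lra.
  move=> /andP[/eqP -> /eqP ->]; apply: mem_set; split=> //; rewrite eE; exists 1.
    by rewrite ler01 ler1n.
  by rewrite vE; apply: plane_eq; rewrite !mxE; ring.
rewrite (bigD1 k) //= (bigD1 l) 1?eq_sym //= mem 1?eq_sym // !eqxx /=.
rewrite big1 ?addr0; last first.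
  by move=> b /andP[bk bl]; rewrite mem // (negPf bl) andbF scale0r.
rewrite big1 ?addr0; last first.
  by move=> a ak; rewrite big1 // => b ba; rewrite mem // (negPf ak) scale0r.
by rewrite {1}eE vE direction_sg.
Qed.

End ClosedMetrics.

(** * Integrating bends to a function on lattice points *)

Section DiscretePotential.
Variable R : realType.

(** Summing the mixed difference [A0] twice leaves free a function of each variable; [f] and [g] are
    these, fixed by the second differences on the two axes. The two hypotheses carry the equations
    for [A1] and [A2] from the axes inwards by induction. *)
Lemma grid_potential (n : nat) (A0 A1 A2 : nat -> nat -> R) :
  (forall i j, (i + j + 3 <= n)%N ->
     A0 i.+1 j + A2 i.+1 j = A2 i j + A0 i j.+1) ->
  (forall i j, (i + j + 3 <= n)%N ->
     A0 i j.+1 + A1 i j.+1 = A1 i j + A0 i.+1 j) ->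
  exists psi : nat -> nat -> R, forall i j, (i + j + 2 <= n)%N ->
    [/\ psi i j + psi i.+1 j.+1 - psi i.+1 j - psi i j.+1 = A0 i j,
        psi i.+2 j + psi i j.+1 - psi i.+1 j - psi i.+1 j.+1 = A1 i j
      & psi i j.+2 + psi i.+1 j - psi i j.+1 - psi i.+1 j.+1 = A2 i j].
Proof.
move=> E1 E2.
pose B i j := \sum_(s < i) \sum_(t < j) A0 s t.
pose f i := \sum_(s < i) \sum_(t < s) (A0 t 0%N + A1 t 0%N).
pose g j := \sum_(s < j) \sum_(t < s) (A0 0%N t + A2 0%N t).
pose psi i j := B i j + f i + g j.
have B0 i j : B i j + B i.+1 j.+1 - B i.+1 j - B i j.+1 = A0 i j.
  by rewrite /B !big_ord_recr /=; ring.
have Bi0 i : B i 0%N = 0 by rewrite /B big1 // => s _; rewrite big_ord0.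
have B0j j : B 0%N j = 0 by rewrite /B big_ord0.
have f2 i : f i.+2 - f i.+1 - (f i.+1 - f i) = A0 i 0%N + A1 i 0%N.
  by rewrite /f !big_ord_recr /=; ring.
have g2 j : g j.+2 - g j.+1 - (g j.+1 - g j) = A0 0%N j + A2 0%N j.
  by rewrite /g !big_ord_recr /=; ring.
have P0 i j : psi i j + psi i.+1 j.+1 - psi i.+1 j - psi i j.+1 = A0 i j.
  by rewrite -B0 /psi; ring.
exists psi => i j ij; split => //.
- elim: j ij => [|j ih] ij.
    by have := f2 i; have := B0 i 0%N; rewrite /psi !Bi0; lra.
  have := ih (ltac:(lia)); have := P0 i j.+1; have := P0 i.+1 j.
  by have := E2 i j (ltac:(lia)); lra.
- elim: i ij => [|i ih] ij.
    by have := g2 j; have := B0 0%N j; rewrite /psi !B0j; lra.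
  have := ih (ltac:(lia)); have := P0 i j.+1; have := P0 i.+1 j.
  by have := E1 i j (ltac:(lia)); lra.
Qed.

(* The bend, across the unit edge from [y + dl k + dl l] to [y + dl k + dl m], of
   the piecewise linear function with values [psi]. *)
Definition rhombus (psi : lat -> R) (y : lat) (k l m : 'I_3) : R :=
  psi (y + dl k + dl k) + psi (y + dl l + dl m)
    - psi (y + dl k + dl l) - psi (y + dl k + dl m).

Lemma rhombusC psi y k l m : rhombus psi y k l m = rhombus psi y k m l.
Proof. by rewrite /rhombus (addrAC y (dl l)); ring. Qed.

Definition tri_pt (x y z : nat) : lat :=
  [ffun j => if j == k0 then x else if j == k1 then y else z].

Lemma tri_ptE (y : lat) : y = tri_pt (y k0) (y k1) (y k2).
Proof. by apply/ffunP => j; rewrite ffunE; elim/I3P: j. Qed.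

(** The hypothesis is the balancing condition at the interior lattice point
    [y + dl k0 + dl k1 + dl k2], in its two Cartesian coordinates. *)
Lemma lattice_potential (n : nat) (a : lat -> 'I_3 -> R) :
  (forall y, (deg y + 3)%N = n ->
    a (y + dl k1) k0 + a (y + dl k1) k2 = a (y + dl k0) k2 + a (y + dl k2) k0 /\
    a (y + dl k2) k0 + a (y + dl k2) k1 = a (y + dl k0) k1 + a (y + dl k1) k0) ->
  exists psi, forall y k l m, k != l -> k != m -> l != m -> (deg y + 2)%N = n ->
    rhombus psi y k l m = a y k.
Proof.
move=> h.
pose A k i j := a (tri_pt (n - 2 - i - j) i j) k.
have hA i j : (i + j + 3 <= n)%N -> 
  A k0 i.+1 j + A k2 i.+1 j = A k2 i j + A k0 i j.+1 /\
  A k0 i j.+1 + A k1 i j.+1 = A k1 i j + A k0 i.+1 j.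
  move=> ij; have := h (tri_pt (n - 3 - i - j) i j); rewrite {1}/deg !ffunE /=.
  move=> /(_ (ltac:(lia))); rewrite /A.
  have -> : tri_pt (n - 3 - i - j) i j + dl k0 = tri_pt (n - 2 - i - j) i j.
    by apply/ffunP => s; rewrite !ffunE; elim/I3P: s => /=; lia.
  have -> : tri_pt (n - 3 - i - j) i j + dl k1 = tri_pt (n - 2 - i.+1 - j) i.+1 j.
    by apply/ffunP => s; rewrite !ffunE; elim/I3P: s => /=; lia.
  have -> : tri_pt (n - 3 - i - j) i j + dl k2 = tri_pt (n - 2 - i - j.+1) i j.+1.
    by apply/ffunP => s; rewrite !ffunE; elim/I3P: s => /=; lia.
  by [].
have [psi hpsi] := grid_potential (fun i j ij => (hA i j ij).1) (fun i j ij => (hA i j ij).2).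
exists (fun y => psi (y k1) (y k2)) => y k l m kl km lm dy.
have /hpsi[] : (y k1 + y k2 + 2 <= n)%N by rewrite -dy /deg; lia.
rewrite /A; have -> : tri_pt (n - 2 - y k1 - y k2) (y k1) (y k2) = y.
  by rewrite [RHS]tri_ptE -dy /deg; congr tri_pt; lia.
rewrite /rhombus !latDE !dlE.
elim/I3P: k kl km; elim/I3P: l lm => //=; elim/I3P: m => //= _ _ _;
rewrite /= ?(addn0, addn1, add0n) => p0 p1 p2; lra.
Qed.

End DiscretePotential.

Section Potential.
Variable R : realType.
Local Notation plane := 'rV[R]_2.
Local Notation corner := (corner R).
Local Notation vec := (vec R).
Implicit Types (P Q v : plane) (y z : lat).
Variables (n : nat) (N : set (set plane)) (HN : linear_newton_subdivision n N).
Local Notation edge := (inner_edges n N).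
Implicit Types (e : edge) (d : edge -> R^o).

Definition edge_weight d y (k l m : 'I_3) : R :=
  weight d (vec (y + dl k + dl l)) (vec (y + dl k + dl m)).

Lemma edge_weightC d y k l m : edge_weight d y k l m = edge_weight d y k m l.
Proof. exact: weightC. Qed.

Definition closed_metric d := forall v, inner_vertices n N v -> vertex_sum d v = 0.

Lemma inner_lattice y : deg y = n -> (forall k, 0 < y k)%N -> ~ boundary (Delta n) (vec y).
Proof.
move=> dy y0 /boundary_Delta[]; first by rewrite DeltaE => k; rewrite bar_vec.
by move=> k /eqP; rewrite bar_vec // pnatr_eq0 -leqn0 leqNgt y0.
Qed.

Lemma six_sum (F : 'I_3 -> 'I_3 -> R) :
  \sum_a \sum_(b | b != a) F a b *: (corner a - corner b) =
  pt (F k1 k0 - F k0 k1 + F k1 k2 - F k2 k1) (F k2 k0 - F k0 k2 + F k2 k1 - F k1 k2).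
Proof.
rewrite sum3 (big_mkcond (fun b => b != k0)) (big_mkcond (fun b => b != k1)).
rewrite (big_mkcond (fun b => b != k2)) !sum3 /=.
by apply: plane_eq; rewrite !mxE /=; ring.
Qed.

(** If the edge ended at [vec y], this end would be a face of it and hence a vertex of [N]. The ends
    are lattice points, so the edge goes on for a full step. *)
Lemma opposite_edge e y (a b : 'I_3) : deg y = n -> a != b -> ~ N [set vec y] ->
  val e (vec y) -> val e (vec y + (corner a - corner b)) ->
  val e (vec y + (corner b - corner a)).
Proof.
move=> dy ab nN ey eab.
have [z [k [l [len [kl len0 dz eE]]]]] := edge_sg HN (edge_N e) (edge_dim e).
have [k' [l' [kl' eE' ak bl]]] : exists k' l',
    [/\ k' != l', val e = sg z k' l' len, a = k' & b = l'].
  move: ey eab; rewrite eE => ey eab.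
  have [[-> ->]|[-> ->]] := sg_third kl ab ey eab; first by exists k, l.
  by exists l, k; split => //; [rewrite eq_sym|rewrite sgC].
move: kl' eE' ab {eab}; rewrite -ak -bl => _ eE' ab.
move: (ey); rewrite eE' => -[s /andP[s0 s1] yE].
have sE : s = (y a)%:R - (z a)%:R.
  have := congr1 (fun X => bar n X a) yE.
  by rewrite bar_vec // bar_sg // eqxx (negPf ab) /=; lra.
have sn0 : s != 0.
  apply/eqP => s00; apply: nN; apply: (lns_face HN (edge_N e)).
  by rewrite yE s00 scale0r addr0 subr0 eE'; exact: sg_face.
have s1' : 1 <= s.
  rewrite sE -natrB ?ler1n; last first.
    by rewrite -(ler_nat R) -subr_ge0 -sE.
  by rewrite subn_gt0 -(ltr_nat R) -subr_gt0 -sE lt_neqAle eq_sym sn0.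
rewrite yE; exists (s - 1); first by apply/andP; split; lra.
by apply: plane_eq; rewrite !mxE; ring.
Qed.

(** At a vertex this is the hypothesis; elsewhere opposite directions carry equal weights and
    cancel. *)
Lemma closed_lattice d y : closed_metric d -> deg y = n -> (forall k, 0 < y k)%N ->
  \sum_a \sum_(b | b != a) weight d (vec y) (vec y + (corner a - corner b))
    *: (corner a - corner b) = 0.
Proof.
move=> cd dy y0; have [Ny|nN] := pselect (N [set vec y]).
  by rewrite -(vertex_sumE HN d Ny); apply: cd; split => //; exact: inner_lattice.
have W a b : a != b -> weight d (vec y) (vec y + (corner a - corner b)) =
                      weight d (vec y) (vec y + (corner b - corner a)).
  move=> ab; apply: eq_fsbigl; apply/seteqP; split => e [ey eab]; split => //;
    by apply: opposite_edge => //; rewrite eq_sym.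
rewrite six_sum (W k1 k0) // (W k2 k0) // (W k2 k1) //.
by apply: plane_eq; rewrite !mxE /=; ring.
Qed.

Lemma weight_unit d y (a b c : 'I_3) : a != b -> a != c -> b != c ->
  weight d (vec (y + dl k0 + dl k1 + dl k2))
     (vec (y + dl k0 + dl k1 + dl k2) + (corner a - corner b))
  = edge_weight d (y + dl a) c b a.
Proof.
move=> ab ac bc; rewrite /edge_weight.
have e0 : y + dl a + dl c + dl b = y + dl k0 + dl k1 + dl k2.
  apply/ffunP => j; rewrite !latDE !dlE.
  by elim/I3P: j; elim/I3P: a ab ac; elim/I3P: b bc => //=; elim/I3P: c => //= _ _ _; lia.
rewrite e0; congr weight; rewrite -e0 -!vec_dl !vecD.
by rewrite addrACA addrN addr0.
Qed.

(** Balancing at every interior lattice point, vertex or not, is the integrability condition of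
    [lattice_potential]. *)
Lemma closed_potential d : closed_metric d -> exists psi : lat -> R,
  forall y k l m, k != l -> k != m -> l != m -> (deg y + 2)%N = n ->
    rhombus psi y k l m = edge_weight d y k l m.
Proof.
move=> cd.
pose a y k := if k == k0 then edge_weight d y k0 k1 k2
  else if k == k1 then edge_weight d y k1 k2 k0 else edge_weight d y k2 k0 k1.
have [|psi hpsi] := @lattice_potential R n a.
  move=> y dy.
  pose F a b := weight d (vec (y + dl k0 + dl k1 + dl k2))
     (vec (y + dl k0 + dl k1 + dl k2) + (corner a - corner b)).
  have h : \sum_a \sum_(b | b != a) F a b *: (corner a - corner b) = 0.
    apply: closed_lattice => //; first by rewrite !degD !deg_dl; lia.
    by elim/I3P; rewrite !latDE !dlE /=; lia.
  have FE i j m : i != j -> i != m -> j != m -> F i j = edge_weight d (y + dl i) m j i.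
    exact: weight_unit.
  clearbody F; move: h; rewrite six_sum.
  rewrite (FE k0 k1 k2 isT isT isT) (FE k0 k2 k1 isT isT isT) (FE k1 k0 k2 isT isT isT).
  rewrite (FE k1 k2 k0 isT isT isT) (FE k2 k0 k1 isT isT isT) (FE k2 k1 k0 isT isT isT).
  move=> /[dup] /(congr1 (fun X : plane => X 0 0)) + /(congr1 (fun X : plane => X 0 1)).
  rewrite !mxE /= /a /= => h0 h1.
  have c0 := edge_weightC d (y + dl k0) k2 k1 k0.
  have c1 := edge_weightC d (y + dl k1) k0 k2 k1.
  have c2 := edge_weightC d (y + dl k2) k1 k0 k2.
  move: h0 h1; rewrite c0 c1 c2; clear.
  by do 6! [move: (edge_weight d _ _ _ _) => ?]; split; lra.
exists psi => y k l m kl km lm dy; rewrite hpsi // /a.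
by elim/I3P: k kl km; elim/I3P: l lm => //=; elim/I3P: m => //= _ _ _; rewrite edge_weightC.
Qed.

End Potential.

(** * From a function that bends only across edges back to a closed metric *)

Section PotentialToMetric.
Variable R : realType.
Local Notation plane := 'rV[R]_2.
Local Notation corner := (corner R).
Local Notation vec := (vec R).
Implicit Types (A C F : set plane) (P Q v : plane) (y z u : lat).
Variables (n : nat) (N : set (set plane)) (HN : linear_newton_subdivision n N).
Local Notation edge := (inner_edges n N).
Implicit Types (e : edge) (d : edge -> R^o).

Lemma face_dim1 A F P Q : has_dim A 1 -> face A F -> F P -> F Q -> P != Q -> F = A.
Proof.
move=> dA /(faceP 0)[_ [f ->]] [AP hP] [AQ hQ] PQ; apply/seteqP; split=> [S []//|S AS].
have [t St] := has_dim1_line dA AP AQ AS PQ.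
have pq : dot 0 P f = dot 0 Q f by apply/le_anti; rewrite hP // hQ.
split=> // X /hP /le_trans; apply.
have -> : S = t *: Q + (1 - t) *: P.
  by rewrite St; apply: plane_eq; rewrite !mxE; ring.
by rewrite dot_conv pq; lra.
Qed.

Lemma vec_neq y (l m : 'I_3) : l != m -> vec (y + dl l) != vec (y + dl m).
Proof.
move=> lm; apply/eqP => /vec_inj; rewrite !degD !deg_dl => /(_ erefl).
by move=> /ffunP/(_ l); rewrite !latDE !dlE eqxx (negPf lm); lia.
Qed.

Lemma vec_step y (l m : 'I_3) : vec (y + dl l) + (corner m - corner l) = vec (y + dl m).
Proof. by rewrite !vecD !vec_dl -addrA [_ + (_ - _)]addrCA subrr addr0. Qed.

Definition unit_in e y (k l m : 'I_3) : Prop :=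
  val e (vec (y + dl k + dl l)) /\ val e (vec (y + dl k + dl m)).

Lemma unit_inC e y k l m : unit_in e y k l m -> unit_in e y k m l.
Proof. by case. Qed.

(** Two edges meet in a common face, and a face of a segment with two points is the whole
    segment. *)
Lemma edge_unique e e' y k l m : l != m ->
  unit_in e y k l m -> unit_in e' y k l m -> e = e'.
Proof.
move=> lm [e1 e2] [e1' e2']; apply: val_inj.
have [e0|[f f']] := lns_inter HN (edge_N e) (edge_N e').
  have : (val e `&` val e') (vec (y + dl k + dl l)) by [].
  by rewrite e0.
have PQ := vec_neq (y + dl k) lm.
rewrite -[LHS](face_dim1 (edge_dim e) f (conj e1 e1') (conj e2 e2') PQ).
exact: face_dim1 (edge_dim e') f' (conj e1 e1') (conj e2 e2') PQ.
Qed.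

Lemma edge_weight_in d e y k l m : l != m -> unit_in e y k l m ->
  edge_weight d y k l m = d e.
Proof.
move=> lm he; rewrite /edge_weight /weight (_ : [set _ | _] = [set e]).
  by rewrite fsbig_set1.
apply/seteqP; split=> [e' he'|e' ->]; last exact: he.
exact: edge_unique lm he' he.
Qed.

Lemma edge_weight_out d y k l m : (forall e, ~ unit_in e y k l m) ->
  edge_weight d y k l m = 0.
Proof.
move=> h; rewrite /edge_weight /weight (_ : [set _ | _] = set0) ?fsbig_set0 //.
by apply/seteqP; split=> // e /h.
Qed.

Lemma mid_move P (a b : 'I_3) :
  mid (P + (corner a - corner b)) (P + (corner b - corner a)) = P.
Proof. by apply: plane_eq; rewrite !mxE; field. Qed.

Lemma flat_dir C e P (a b a' b' : 'I_3) : N C -> a != b -> a' != b' ->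
  C (P + (corner a - corner b)) -> C (P + (corner b - corner a)) ->
  val e P -> val e (P + (corner a' - corner b')) ->
  (a = a' /\ b = b') \/ (a = b' /\ b = a').
Proof.
move=> NC ab ab' C1 C2 e1 e2.
have [e3 _] : val e (P + (corner a - corner b)) /\ val e (P + (corner b - corner a)).
  by apply: (flat HN NC (edge_N e) C1 C2); rewrite mid_move.
exact: has_dim1_dir (edge_dim e) e1 e3 e2 ab ab'.
Qed.

(** The diagonals of a unit rhombus share their midpoint; by [flat], an edge along one of them would
    also contain an end of the other. *)
Lemma flat_rhombus C e y (k l m : 'I_3) : k != l -> k != m -> l != m -> N C ->
  C (vec (y + dl k + dl k)) -> C (vec (y + dl l + dl m)) -> ~ unit_in e y k l m.
Proof.
move=> kl km lm NC C1 C2 [e1 e2].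
have em : val e (mid (vec (y + dl k + dl l)) (vec (y + dl k + dl m))).
  have [z [a [b [len [_ _ dz eE]]]]] := edge_sg HN (edge_N e) (edge_dim e).
  move: e1 e2; rewrite eE => -[s /andP[s0 s1] ->] [t /andP[t0 t1] ->].
  exists (2^-1 * s + 2^-1 * t); first by apply/andP; split; lra.
  by apply: plane_eq; rewrite !mxE; field.
have midE : mid (vec (y + dl k + dl l)) (vec (y + dl k + dl m)) =
    mid (vec (y + dl k + dl k)) (vec (y + dl l + dl m)).
  by rewrite !vecD !vec_dl; apply: plane_eq; rewrite !mxE; field.
rewrite midE in em; have [e3 _] := flat HN NC (edge_N e) C1 C2 em.
have e2' : val e (vec (y + dl k + dl l) + (corner m - corner l)).
  by rewrite vec_step.
have e3' : val e (vec (y + dl k + dl l) + (corner k - corner l)).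
  by rewrite vec_step.
have ml : m != l by rewrite eq_sym.
have [[km' _]|[kl' _]] := has_dim1_dir (edge_dim e) e1 e3' e2' kl ml.
  by rewrite km' eqxx in km.
by rewrite kl' eqxx in kl.
Qed.

(** The midpoint of the two points of [C] is an end of the unit edge, so [flat] would give the edge
    two non-parallel directions. *)
Lemma flat_line C e y (k l m : 'I_3) : k != l -> k != m -> l != m -> N C ->
  C (vec (y + dl k + dl k)) -> C (vec (y + dl l + dl l)) -> ~ unit_in e y k l m.
Proof.
move=> kl km lm NC C1 C2 [e1 e2].
have e2' : val e (vec (y + dl k + dl l) + (corner m - corner l)).
  by rewrite vec_step.
have ml : m != l by rewrite eq_sym.
have [||[km' _]|[kl' _]] := flat_dir NC kl ml _ _ e1 e2'.
- by rewrite vec_step.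
- by rewrite addrAC vec_step addrAC.
- by rewrite km' eqxx in km.
- by rewrite kl' eqxx in kl.
Qed.

Section Potential.
Variable psi : lat -> R.
Hypothesis psi_flat : forall y k l m, k != l -> k != m -> l != m ->
  (deg y + 2)%N = n -> (forall e, ~ unit_in e y k l m) -> rhombus psi y k l m = 0.

(** In other words, the slope of [psi] from [l] to [k] is the same at [y + dl a] and [y + dl b]. If
    [a] and [b] are [k] and [l], the difference of the slopes is a sum of two bends around three
    collinear points; otherwise it is one bend up to sign, and no edge runs there. *)
Lemma flat4 C y (a b k l : 'I_3) : N C -> (deg y + 2)%N = n ->
  C (vec (y + dl b + dl k)) -> C (vec (y + dl b + dl l)) ->
  C (vec (y + dl a + dl k)) -> C (vec (y + dl a + dl l)) ->
  psi (y + dl b + dl k) + psi (y + dl a + dl l) =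
  psi (y + dl a + dl k) + psi (y + dl b + dl l).
Proof.
move=> NC dy.
have rh i j m : i != j -> i != m -> j != m ->
    C (vec (y + dl i + dl i)) -> C (vec (y + dl j + dl m)) -> rhombus psi y i j m = 0.
  move=> ij im jm C1 C2; apply: psi_flat => // e.
  exact: (flat_rhombus ij im jm NC C1 C2).
have ln i j m : i != j -> i != m -> j != m ->
    C (vec (y + dl i + dl i)) -> C (vec (y + dl j + dl j)) -> rhombus psi y i j m = 0.
  move=> ij im jm C1 C2; apply: psi_flat => // e.
  exact: (flat_line ij im jm NC C1 C2).
rewrite /rhombus in rh ln.
have cc (i j : 'I_3) : y + dl i + dl j = y + dl j + dl i by rewrite addrAC.
have [->|ab] := eqVneq a b; first by move=> *; rewrite addrC.
have [->|kl] := eqVneq k l; first by move=> *; rewrite addrC.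
have [m [mk ml]] : exists m, m != k /\ m != l.
  by clear; elim/I3P: k; elim/I3P: l; (try by exists k0); (try by exists k1); exists k2.
have km : k != m by rewrite eq_sym.
have lm : l != m by rewrite eq_sym.
have lk : l != k by rewrite eq_sym.
have [ak|al|am] := I3_three a kl km lm; have [bk|bl|bm] := I3_three b kl km lm; subst a b; rewrite ?eqxx // in ab *;
  move=> C1 C2 C3 C4.
- have := ln k l m kl km lm C3 C2; have := ln l k m lk lm km C2 C3.
  by rewrite (cc l k) (cc l m); lra.
- by have := rh k m l km kl ml C3 C2; rewrite (cc m k); lra.
- have := ln k l m kl km lm C1 C4; have := ln l k m lk lm km C4 C1.
  by rewrite (cc l k) (cc l m); lra.
- by have := rh l m k lm lk mk C4 C1; rewrite (cc m l); lra.
- by have := rh k m l km kl ml C1 C4; rewrite (cc m k); lra.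
- by have := rh l m k lm lk mk C2 C3; rewrite (cc m l); lra.
Qed.

End Potential.

End PotentialToMetric.

Section ClosedOfPotential.
Variable R : realType.
Local Notation plane := 'rV[R]_2.
Local Notation corner := (corner R).
Local Notation vec := (vec R).
Implicit Types (A C F : set plane) (P Q v : plane) (y z u : lat).
Variables (n : nat) (N : set (set plane)) (HN : linear_newton_subdivision n N).
Local Notation edge := (inner_edges n N).
Implicit Types (e : edge) (d : edge -> R^o).

Lemma vertex_lattice v : N [set v] -> exists2 y, deg y = n & v = vec y.
Proof.
move=> Nv; have /(Pcell_translateP n)[b [c [w [hn vE]]]] := lns_cell HN Nv.
pose x (k : 'I_3) : int := b k + (if k == k0 then (c + w k1 + w k2)%:Z
    else if k == k1 then (w k0)%:Z else 0).
have sx : x k0 + x k1 + x k2 = n%:Z by rewrite /x /= -hn; lia.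
have xv : ipt R x = v.
  have : [set v] (ipt R x).
    by rewrite vE; apply/hexagon_ipt => //; elim/I3P; rewrite /x /=; lia.
  by [].
have x0 k : 0 <= x k.
  have := cell_Delta HN Nv (erefl v); rewrite DeltaE => /(_ k).
  by rewrite -xv bar_ipt // ler0z.
exists [ffun k => absz (x k)].
  by rewrite /deg !ffunE; have := x0 k0; have := x0 k1; have := x0 k2; lia.
rewrite -xv; apply: plane_eq; rewrite !mxE /= ffunE natr_absz ger0_norm //.
Qed.

Lemma inner_vertex_lattice v : inner_vertices n N v ->
  exists u, (deg u + 3)%N = n /\ v = vec (u + dl k0 + dl k1 + dl k2).
Proof.
move=> [Nv nb]; have [y dy vE] := vertex_lattice Nv.
have y0 k : (0 < y k)%N.
  rewrite lt0n; apply/eqP => yk; apply: nb; apply/boundary_Delta.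
    exact: (cell_Delta HN Nv erefl).
  by exists k; rewrite vE bar_vec // yk.
exists [ffun k => (y k).-1]; split.
  by rewrite -dy /deg !ffunE; have := y0 k0; have := y0 k1; have := y0 k2; lia.
rewrite vE; congr vec; apply/ffunP => j; rewrite !latDE !dlE ffunE; have := y0 j.
by elim/I3P: j => /=; lia.
Qed.

Lemma vec_muln y (k : 'I_3) i : vec (y + dl k *+ i) = vec y + i%:R *: corner k.
Proof.
rewrite vecD; congr (_ + _); elim: i => [|i ih].
  by rewrite !mulr0n scale0r; apply: plane_eq; rewrite !mxE /= ffunE.
by rewrite mulrS vecD ih vec_dl -natr1 scalerDl scale1r addrC.
Qed.

Lemma mulE (k : 'I_3) i j : (dl k *+ i) j = (i * (j == k))%N.
Proof. by elim: i => [|i ih]; rewrite ?mulr0n ?ffunE // mulrS latDE ih dlE. Qed.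

(** Cuts an inner edge into unit edges. The coordinate [c], constant along the edge, is positive
    because the edge is not in the boundary, so [dl c] can be split off. The [len] produced here is
    one less than the number of unit edges. *)
Lemma edge_lattice e : exists u (a b c : 'I_3) len,
  [/\ [/\ a != b, a != c & b != c], (deg u + len + 2)%N = n,
      forall i j, (i + j = len)%N -> unit_in e (u + dl a *+ i + dl b *+ j) c a b
    & forall y k l m, k != l -> k != m -> l != m -> (deg y + 2)%N = n -> unit_in e y k l m ->
        k = c /\ exists i j, (i + j = len)%N /\ y = u + dl a *+ i + dl b *+ j].
Proof.
have [z [a [b [len [ab len0 dz eE]]]]] := edge_sg HN (edge_N e) (edge_dim e).
have [c ac bc] : exists2 c, a != c & b != c.
  by clear -ab; elim/I3P: a ab; elim/I3P: b => //= _;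
    (try by exists k0); (try by exists k1); exists k2.
have zc : (0 < z c)%N.
  rewrite lt0n; apply/eqP => zc0; have [_ _ nb] := set_mem (valP e); apply: nb => P eP.
  apply/boundary_Delta; first exact: (cell_Delta HN (edge_N e) eP).
  exists c; move: eP; rewrite eE => -[s _ ->]; rewrite bar_sg // zc0.
  by rewrite ![c == _]eq_sym (negPf ac) (negPf bc) /=; ring.
pose u : lat := [ffun k => z k - (k == c)]%N.
have zE : z = u + dl c.
  by apply/ffunP => j; rewrite latDE dlE /u ffunE; case: (eqVneq j c) => [->|_] /=; lia.
have degM k i : deg (dl k *+ i) = i.
  by elim: i => [|i ih]; [rewrite mulr0n /deg !ffunE|rewrite mulrS degD ih deg_dl].
have du : (deg u + (len.-1) + 2)%N = n.
  by rewrite -dz zE degD deg_dl; lia.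
exists u, a, b, c, len.-1; split => //.
  move=> i j ij; split; rewrite eE.
    exists i.+1%:R; first by rewrite ler0n ler_nat; lia.
    rewrite (_ : len%:R - i.+1%:R = j%:R :> R); last by rewrite -natrB; [congr _%:R|]; lia.
    rewrite zE -!vec_muln; congr vec.
    by apply/ffunP => s; rewrite !latDE !mulE !dlE; lia.
  exists i%:R; first by rewrite ler0n ler_nat; lia.
  rewrite (_ : len%:R - i%:R = j.+1%:R :> R); last by rewrite -natrB; [congr _%:R|]; lia.
  rewrite zE -!vec_muln; congr vec.
  by apply/ffunP => s; rewrite !latDE !mulE !dlE; lia.
move=> y k l m kl km lm dy he.
wlog lm' : l m kl km lm he / (m = a /\ l = b) => [hw|].
  have [h1 h2] := he; have h2' := h2; rewrite -(@vec_step R _ l m) in h2'.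
  rewrite eE in h1 h2'; have ml : m != l by rewrite eq_sym.
  case: (sg_third ab ml h1 h2') => -[ma lb]; first by apply: (hw l m).
  by apply: (hw m l) => //; exact: unit_inC.
have {lm'} [ma lb] := lm'; subst m l.
have kc : k = c.
  by clear -kl km ab ac bc; elim/I3P: k kl km; elim/I3P: a ab ac => //;
     elim/I3P: b bc => //; elim/I3P: c.
subst k; split => //.
have [] := he; rewrite eE => -[s /andP[s0 s1] hy] _.
have bj j := congr1 (fun X => bar n X j) hy.
have dy' : deg (y + dl c + dl b) = n by rewrite !degD !deg_dl; lia.
have {}bj (j : 'I_3) : (((y + dl c + dl b)%R : lat) j)%:R = (z j)%:R + s * (j == a)%:R
    + (len%:R - s) * (j == b)%:R :> R.
  by have := bj j; rewrite bar_vec // bar_sg.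
have ba := bj a; rewrite !latDE !dlE eqxx (negPf ab) (negPf ac) /= !addn0 in ba.
have ya : (z a <= y a)%N by rewrite -(ler_nat R) ba; lra.
have sE : s = (y a - z a)%:R by rewrite natrB // ba; ring.
have yl : (y a - z a < len)%N.
  have [_] := he; rewrite eE => -[s' /andP[_ s1'] /(congr1 (fun X => bar n X a))].
  rewrite bar_sg // bar_vec ?degD ?deg_dl; last by lia.
  rewrite !latDE !dlE eqxx (negPf ab) (negPf ac) /= addn0 natrD => ha.
  by rewrite -(ltr_nat R) -sE; lra.
move: (y a - z a)%N yl sE => i il sE.
exists i, (len.-1 - i)%N; split; first by lia.
apply/ffunP => j; rewrite !latDE !mulE ffunE.
have {bj} : (y j + (j == c) + (j == b) = z j + i * (j == a) + (len - i) * (j == b))%N.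
  apply/eqP; rewrite -(eqr_nat R) -!dlE -!latDE bj sE !natrD !natrM natrB; last by lia.
  by rewrite !dlE.
have := zc; move: ab ac bc il; clear => ab ac bc il.
have [->|jc] := eqVneq j c.
  by rewrite [c == a]eq_sym [c == b]eq_sym (negPf ac) (negPf bc) ?eqxx /= ?muln0; lia.
by have [->|ja] := eqVneq j a; [rewrite (negPf ab)|have [->|jb] := eqVneq j b]; rewrite /= ?muln0 ?muln1; lia.
Qed.

Section Potential.
Variable psi : lat -> R.
Hypothesis psi_flat : forall y k l m, k != l -> k != m -> l != m ->
  (deg y + 2)%N = n -> (forall e, ~ unit_in e y k l m) -> rhombus psi y k l m = 0.

(** One coordinate of the balancing condition at [u + dl a + dl b + dl c]; the bends of any function
    satisfy it identically. *)
Lemma rhombus_step u (a b c : 'I_3) :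
  rhombus psi (u + dl b) c a b + rhombus psi (u + dl b) a b c =
  rhombus psi (u + dl c) a b c + rhombus psi (u + dl a) c a b.
Proof.
rewrite /rhombus.
have -> : u + dl b + dl a + dl c = u + dl b + dl c + dl a by apply/ffunP => s; rewrite !latDE; lia.
have -> : u + dl b + dl b + dl c = u + dl b + dl c + dl b by apply/ffunP => s; rewrite !latDE; lia.
have -> : u + dl c + dl b + dl c = u + dl b + dl c + dl c by apply/ffunP => s; rewrite !latDE; lia.
have -> : u + dl c + dl a + dl b = u + dl b + dl c + dl a by apply/ffunP => s; rewrite !latDE; lia.
have -> : u + dl c + dl a + dl c = u + dl a + dl c + dl c by apply/ffunP => s; rewrite !latDE; lia.
have -> : u + dl a + dl c + dl a = u + dl c + dl a + dl a by apply/ffunP => s; rewrite !latDE; lia.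
have -> : u + dl a + dl a + dl b = u + dl b + dl a + dl a by apply/ffunP => s; rewrite !latDE; lia.
have -> : u + dl a + dl c + dl b = u + dl b + dl c + dl a by apply/ffunP => s; rewrite !latDE; lia.
by ring.
Qed.

(** At a lattice point inside an edge no edge leaves in another direction, so two of the four bends
    in [rhombus_step] vanish and the bends across consecutive unit edges agree. *)
Lemma rhombus_edge_const e u (a b c : 'I_3) i j : a != b -> a != c -> b != c ->
  (deg u + (i + j.+1) + 2)%N = n ->
  unit_in e (u + dl a *+ i.+1 + dl b *+ j) c a b ->
  unit_in e (u + dl a *+ i + dl b *+ j.+1) c a b ->
  rhombus psi (u + dl a *+ i.+1 + dl b *+ j) c a b =
  rhombus psi (u + dl a *+ i + dl b *+ j.+1) c a b.
Proof.
move=> ab ac bc du.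
pose w := u + dl a *+ i + dl b *+ j.
have -> : u + dl a *+ i.+1 + dl b *+ j = w + dl a.
  by apply/ffunP => s; rewrite !latDE !mulE !dlE; lia.
have -> : u + dl a *+ i + dl b *+ j.+1 = w + dl b.
  by apply/ffunP => s; rewrite !latDE !mulE !dlE; lia.
have dw : (deg w + 3)%N = n.
  have degM k s : deg (dl k *+ s) = s.
    by elim: s => [|s ih]; [rewrite mulr0n /deg !ffunE|rewrite mulrS degD ih deg_dl].
  by rewrite /w !degD !degM -du; lia.
move=> [e1 e2] [e3 e4].
have ca : c != a by rewrite eq_sym.
have cb : c != b by rewrite eq_sym.
have ba : b != a by rewrite eq_sym.
pose Y := vec (w + dl a + dl b + dl c).
have f1 : val e (Y + (corner a - corner b)).
  rewrite (_ : Y = vec (w + dl a + dl c + dl b)) ?vec_step //; by rewrite /Y addrAC.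
have f2 : val e (Y + (corner b - corner a)).
  rewrite (_ : Y = vec (w + dl b + dl c + dl a)) ?vec_step //.
  by rewrite /Y; congr vec; apply/ffunP => s; rewrite !latDE; lia.
have r1 : rhombus psi (w + dl b) a b c = 0.
  apply: psi_flat => //; first by rewrite degD deg_dl; lia.
  move=> e' [g1 g2].
  have gY : val e' Y.
    rewrite (_ : Y = vec (w + dl b + dl a + dl c)) //.
    by rewrite /Y; congr vec; apply/ffunP => s; rewrite !latDE; lia.
  have g3 : val e' (Y + (corner b - corner c)).
    by rewrite (_ : Y = vec (w + dl b + dl a + dl c)) ?vec_step //;
     rewrite /Y; congr vec; apply/ffunP => s; rewrite !latDE; lia.
  have := flat_dir HN (edge_N e) ab bc f1 f2 gY g3.
  by case=> -[h1 h2]; move: ab ac; rewrite h1 ?h2 eqxx.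
have r2 : rhombus psi (w + dl c) a b c = 0.
  apply: psi_flat => //; first by rewrite degD deg_dl; lia.
  move=> e' [g1 g2].
  have gY : val e' Y.
    rewrite (_ : Y = vec (w + dl c + dl a + dl b)) //.
    by rewrite /Y; congr vec; apply/ffunP => s; rewrite !latDE; lia.
  have g3 : val e' (Y + (corner c - corner b)).
    by rewrite (_ : Y = vec (w + dl c + dl a + dl b)) ?vec_step //;
     rewrite /Y; congr vec; apply/ffunP => s; rewrite !latDE; lia.
  have := flat_dir HN (edge_N e) ab cb f1 f2 gY g3.
  by case=> -[h1 h2]; move: ab ac ba; rewrite ?h1 ?h2 eqxx.
by have := rhombus_step w a b c; rewrite r1 r2; lra.
Qed.

(** Converse of [closed_potential]: the bend is constant along an edge and defines [d], and
    balancing is [rhombus_step]. *)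
Lemma potential_closed : exists d : edge -> R^o, closed_metric d /\
  forall e y k l m, k != l -> k != m -> l != m -> (deg y + 2)%N = n ->
    unit_in e y k l m -> d e = rhombus psi y k l m.
Proof.
have ex e : exists r : R, forall y k l m, k != l -> k != m -> l != m ->
    (deg y + 2)%N = n -> unit_in e y k l m -> r = rhombus psi y k l m.
  have [u [a [b [c [len [[ab ac bc] du h1 h2]]]]]] := edge_lattice e.
  exists (rhombus psi (u + dl a *+ 0 + dl b *+ len) c a b) => y k l m kl km lm dy he.
  have [kc [i [j [ij yE]]]] := h2 y k l m kl km lm dy he; subst k.
  have -> : rhombus psi y c l m = rhombus psi y c a b.
    have : (l = a /\ m = b) \/ (l = b /\ m = a).
      move: kl km lm ab ac bc; clear; elim/I3P: c; elim/I3P: l => // _; elim/I3P: m => // _ _;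
      elim/I3P: a => //; elim/I3P: b => // _ _ _; by [left|right].
    by case=> -[-> ->] //; exact: rhombusC.
  rewrite yE; move: ij; clear yE he; elim: i j => [|i ih] j ij.
    by rewrite -ij add0n.
  rewrite (@rhombus_edge_const e) //; first by apply: ih; lia.
  - by lia.
  - by apply: h1; lia.
  - by apply: h1; lia.
have [d hd] := choice ex.
exists d; split => // v hv.
have [u [du vE]] := inner_vertex_lattice hv.
rewrite (vertex_sumE HN d hv.1) vE.
have ewE y k l m : k != l -> k != m -> l != m -> (deg y + 2)%N = n ->
    edge_weight d y k l m = rhombus psi y k l m.
  move=> kl km lm dy; have [[e he]|ne] := pselect (exists e, unit_in e y k l m).
    by rewrite (edge_weight_in HN d lm he); exact: hd.
  rewrite edge_weight_out ?psi_flat //; by [move=> e he; apply: ne; exists e].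
pose F a b := weight d (vec (u + dl k0 + dl k1 + dl k2))
   (vec (u + dl k0 + dl k1 + dl k2) + (corner a - corner b)).
have FE i j m : i != j -> i != m -> j != m -> F i j = rhombus psi (u + dl i) m j i.
  move=> ij im jm; rewrite /F (weight_unit d u ij im jm); apply: ewE.
  - by rewrite eq_sym.
  - by rewrite eq_sym.
  - by rewrite eq_sym.
  - by rewrite degD deg_dl -du; lia.
transitivity (\sum_a \sum_(b | b != a) F a b *: (corner a - corner b)) => //.
clearbody F; rewrite six_sum.
rewrite (FE k0 k1 k2 isT isT isT) (FE k0 k2 k1 isT isT isT) (FE k1 k0 k2 isT isT isT).
rewrite (FE k1 k2 k0 isT isT isT) (FE k2 k0 k1 isT isT isT) (FE k2 k1 k0 isT isT isT).
have c0 := rhombusC psi (u + dl k0) k2 k1 k0.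
have c1 := rhombusC psi (u + dl k1) k0 k2 k1.
have c2 := rhombusC psi (u + dl k2) k1 k0 k2.
have s1 := rhombus_step u k0 k1 k2.
have s2 := rhombus_step u k0 k2 k1.
have d0 y k l m := rhombusC psi y k l m.
apply: plane_eq; rewrite !mxE /=.
  move: (d0 (u + dl k0) k2 k0 k1) (d0 (u + dl k0) k1 k0 k2) (d0 (u + dl k1) k2 k0 k1)
    (d0 (u + dl k1) k0 k1 k2) (d0 (u + dl k2) k1 k0 k2) (d0 (u + dl k2) k0 k1 k2).
  lra.
move: (d0 (u + dl k0) k2 k0 k1) (d0 (u + dl k0) k1 k0 k2) (d0 (u + dl k1) k2 k0 k1)
    (d0 (u + dl k1) k0 k1 k2) (d0 (u + dl k2) k1 k0 k2) (d0 (u + dl k2) k0 k1 k2).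
lra.
Qed.

End Potential.

End ClosedOfPotential.

(** * Tropical line arrangements *)

Lemma sort3 (R : realDomainType) (g : 'I_3 -> R) : exists a b c : 'I_3,
  [/\ [/\ a != b, a != c & b != c], g b <= g a & g c <= g b].
Proof.
have [h01|h01] := leP (g k0) (g k1); have [h02|h02] := leP (g k0) (g k2);
have [h12|h12] := leP (g k1) (g k2).
- by exists k2, k1, k0; split.
- by exists k1, k2, k0; split=> //; exact: ltW.
- by exists k2, k1, k0; split => //; lra.
- by exists k1, k0, k2; split=> //; exact: ltW.
- by exists k2, k0, k1; split=> //; exact: ltW.
- by exists k1, k2, k0; split => //; lra.
- by exists k0, k2, k1; split=> //; exact: ltW.
- by exists k0, k1, k2; split=> //; exact: ltW.
Qed.

Lemma fin_pos_min (R : realDomainType) (T : finType) (P : pred T) (g : T -> R) :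
  (forall t, P t -> 0 < g t) -> exists2 e, 0 < e & forall t, P t -> e <= g t.
Proof.
move=> h; exists (\big[Order.min/1]_(t | P t) g t).
  by apply: lt_bigmin.
by move=> t Pt; exact: bigmin_le_cond.
Qed.

Section Arrangement.
Variable R : realType.
Local Notation plane := 'rV[R]_2.
Local Notation corner := (corner R).
Local Notation vec := (vec R).
Variables (I : finType) (p : I -> 'I_3 -> R).
Implicit Types (P Q : plane) (w : 'I_3 -> R) (i : I) (k : 'I_3).
Let n := #|I|.

(* [p i] are homogeneous coordinates of the centre of the [i]-th tropical line;
   [amax i w] is the set of coordinates where [w - p i] is maximal, i.e. the face
   of the unit triangle dual to the position of [w] relative to that line. *)
Definition amax i w k : bool := [forall l, w l - p i l <= w k - p i k].
(** The face of the unit triangle is the vertex [k], respectively the whole triangle or the side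
    opposite to [k]. *)
Definition aonly i w k : bool := amax i w k && [forall l, (l != k) ==> ~~ amax i w l].
Definition afull i w : bool := [forall k, amax i w k].
Definition aco i w k : bool := ~~ amax i w k && [forall l, (l != k) ==> amax i w l].

Definition trop i w : R :=
  Num.max (w k0 - p i k0) (Num.max (w k1 - p i k1) (w k2 - p i k2)).
Definition tropsum w : R := \sum_i trop i w.

Lemma trop_ge i w k : w k - p i k <= trop i w.
Proof. by elim/I3P: k; rewrite /trop !le_max lexx ?orbT. Qed.

Lemma trop_le i w r : (forall k, w k - p i k <= r) -> trop i w <= r.
Proof. by move=> h; rewrite /trop !ge_max !h. Qed.

Lemma amaxP i w k : reflect (w k - p i k = trop i w) (amax i w k).
Proof.
apply: (iffP forallP) => [h|h l]; last by rewrite h trop_ge.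
by apply/le_anti; rewrite trop_ge trop_le.
Qed.

Lemma amax_ex i w : exists k, amax i w k.
Proof.
have [a [b [c [[ab ac bc] h1 h2]]]] := sort3 (fun k => w k - p i k).
exists a; apply/forallP => l; have [] := I3_three l ab ac bc => -> //; exact: le_trans h2 h1.
Qed.

(** With [hi], the extremes of the coordinate [k] on the Minkowski sum of the faces of all lines;
    [cell w] is the subdifferential of [tropsum] at [w]. *)
Definition lo w k : nat := \sum_i aonly i w k.
Definition hi w k : nat := \sum_i amax i w k.
Definition cell w : set plane := @hexagon R n (fun k => lo w k) (fun k => hi w k).
Definition arrangement_cells : set (set plane) := range cell.

Lemma cellP w P : cell w P <-> forall k, (lo w k)%:R <= bar n P k <= (hi w k)%:R.
Proof. by split=> h k; have := h k; rewrite -!pmulrn. Qed.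

Lemma sum1I : (\sum_(i : I) 1 = n)%N.
Proof. by rewrite sum1_card. Qed.

Lemma amax_bool i w : amax i w k0 || amax i w k1 || amax i w k2.
Proof. by have [k] := amax_ex i w; elim/I3P: k => ->; rewrite ?orbT. Qed.

Lemma lo_sum w : (lo w k0 + lo w k1 + lo w k2 + (\sum_i afull i w
  + \sum_i aco i w k0 + \sum_i aco i w k1 + \sum_i aco i w k2) = n)%N.
Proof.
rewrite /lo -!big_split /= -sum1I; apply: eq_bigr => i _.
rewrite /aonly /afull /aco !I3_all /=; have := amax_bool i w.
by case: (amax i w k0); case: (amax i w k1); case: (amax i w k2).
Qed.

Lemma hiE w k : (hi w k + \sum_i aco i w k = lo w k + (\sum_i afull i w
  + \sum_i aco i w k0 + \sum_i aco i w k1 + \sum_i aco i w k2))%N.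
Proof.
rewrite /lo /hi -!big_split /=; apply: eq_bigr => i _.
rewrite /aonly /afull /aco !I3_all /=; have := amax_bool i w.
by elim/I3P: k; case: (amax i w k0); case: (amax i w k1); case: (amax i w k2).
Qed.

Lemma cell_Pcell w : Pcell_translate (cell w).
Proof.
apply/(Pcell_translateP n); exists (fun k => (lo w k)%:Z), (\sum_i afull i w)%N.
exists (fun k => \sum_i aco i w k)%N; split; first by have := lo_sum w; lia.
rewrite /cell; congr hexagon; apply/funext => k.
by have := hiE w k; lia.
Qed.

(* A cell is described by the lattice points obtained by letting every line
   choose a corner of its face. *)
Lemma choice_in_cell w (kap : I -> 'I_3) : (forall i, amax i w (kap i)) ->
  forall k, (lo w k <= \sum_i (kap i == k) <= hi w k)%N.
Proof.
move=> h k; rewrite /lo /hi; apply/andP; split; apply: leq_sum => i _.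
  case: (boolP (aonly i w k)) => // /andP[_ /forallP/(_ (kap i))].
  by rewrite h implybF negbK => /eqP ->; rewrite eqxx.
by case: eqP => // <-; rewrite h.
Qed.

(** With the increments sorted as [d a >= d b >= d c], a line increases by at least [d a] if [a] is
    maximal for it, by [d c] if only [c] is, and by [d b] otherwise. Summed up, these counts are
    [hi w a] and [lo w c], which bound the coordinates of [P] on the favourable side. *)
Lemma dot_le_trop w P w' : cell w P ->
  tropsum w + dot n P (fun k => w' k - w k) <= tropsum w'.
Proof.
move=> /cellP hP; have [a [b [c [[ab ac bc] h1 h2]]]] := sort3 (fun k => w' k - w k).
pose d := fun k => w' k - w k; rewrite -/d.
have {}h1 : d b <= d a by [].
have {}h2 : d c <= d b by [].
have key i : (amax i w a)%:R * d a + (aonly i w c)%:R * d c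
    + (1 - (amax i w a)%:R - (aonly i w c)%:R) * d b <= trop i w' - trop i w.
  have ge k : amax i w k -> d k <= trop i w' - trop i w.
    by move=> /amaxP <-; have := trop_ge i w' k; rewrite /d; lra.
  have [Aa|nAa] := boolP (amax i w a).
    have -> : aonly i w c = false.
      by apply/negP => /andP[_ /forallP/(_ a)]; rewrite ac Aa.
    by have := ge a Aa; rewrite /=; lra.
  have [Oc|nOc] := boolP (aonly i w c).
    by have /andP[Ac _] := Oc; have := ge c Ac; rewrite /=; lra.
  suff Ab : amax i w b by have := ge b Ab; rewrite /=; lra.
  have three k := I3_three k ab ac bc.
  apply: contraR nOc => nAb.
  have [k Ak] := amax_ex i w; have [ka|kb|kc] := three k; subst k.
  - by rewrite Ak in nAa.
  - by rewrite Ak in nAb.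
  - rewrite /aonly Ak; apply/forallP => k; apply/implyP.
    by case: (three k) => ->; rewrite ?eqxx ?nAa ?nAb.
have : \sum_i ((amax i w a)%:R * d a + (aonly i w c)%:R * d c
    + (1 - (amax i w a)%:R - (aonly i w c)%:R) * d b) <= tropsum w' - tropsum w.
  by rewrite /tropsum -sumrB; apply: ler_sum => i _; exact: key.
rewrite !big_split /= -!mulr_suml !sumrB -!natr_sum sumr_const -/(hi w a) -/(lo w c).
have /andP[_ ha] := hP a; have /andP[hc _] := hP c.
have := bar_sum n P.
have -> : bar n P k0 + bar n P k1 + bar n P k2 = bar n P a + bar n P b + bar n P c.
  exact: sum_I3.
have -> : dot n P d = bar n P a * d a + bar n P b * d b + bar n P c * d c.
  exact: (sum_I3 (fun k => bar n P k * d k)).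
move: (bar n P a) (bar n P b) (bar n P c) ha hc => x y z ha hc <-.
move: (d a) (d b) (d c) h1 h2 => da db dc h1 h2 hs.
have m1 : 0 <= ((hi w a)%:R - x) * (da - db).
by apply: mulr_ge0; rewrite subr_ge0.
have m2 : 0 <= (z - (lo w c)%:R) * (db - dc).
  by apply: mulr_ge0; rewrite subr_ge0.
lra.
Qed.

(** A corner that is not maximal at [w] misses the maximum by a gap; half the least gap bounds the
    admissible move. *)
Lemma amax_near w : exists2 e, 0 < e & forall w', (forall k, `|w' k - w k| < e) ->
  forall i k, amax i w' k -> amax i w k.
Proof.
have [e e0 he] := @fin_pos_min R (I * ('I_3 * 'I_3))%type
  (fun t => w t.2.1 - p t.1 t.2.1 < w t.2.2 - p t.1 t.2.2)
  (fun t => w t.2.2 - p t.1 t.2.2 - (w t.2.1 - p t.1 t.2.1))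
  (fun t => ltac:(by rewrite subr_gt0)).
exists (e / 2); first by rewrite divr_gt0.
move=> w' hw i k /forallP hk; apply/forallP => l; rewrite leNgt; apply/negP => hl.
have /= := he (i, (k, l)) hl; have := hk l; have := hw k; have := hw l.
by rewrite !ltr_norml => /andP[? ?] /andP[? ?]; lra.
Qed.

Lemma amax_sub_cell w w' : (forall i k, amax i w' k -> amax i w k) -> cell w' `<=` cell w.
Proof.
move=> h P /cellP hP; apply/cellP => k; have /andP[h1 h2] := hP k; apply/andP; split.
  apply: le_trans h1; rewrite ler_nat; apply: leq_sum => i _.
  case: (boolP (aonly i w k)) => // /andP[_ /forallP hk].
  suff -> : aonly i w' k by [].
  have [l hl] := amax_ex i w'; have := hk l; rewrite (h _ _ hl) implybF negbK => /eqP lk.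
  rewrite /aonly -lk hl; apply/forallP => m; apply/implyP => ml.
  by apply/negP => /h hm; have := hk m; rewrite hm -lk ml.
apply: (le_trans h2); rewrite ler_nat; apply: leq_sum => i _.
by case: (boolP (amax i w' k)) => // /h ->.
Qed.

(** Moving only the coordinate [k] by a small [s] up or down raises [tropsum] by at most [s] times
    [hi w k], or lowers it by at least [s] times [lo w k]; the subgradient inequality turns this
    into the two bounds. *)
Lemma cell_of_subgradient w P :
  (forall w', tropsum w + dot n P (fun k => w' k - w k) <= tropsum w') -> cell w P.
Proof.
move=> h; apply/cellP => k.
have [e e0 he] := amax_near w.
pose s := e / 2; have s0 : 0 < s by rewrite divr_gt0.
pose w1 (t : R) l := w l + t * (l == k)%:R.
have dw1 t : dot n P (fun l => w1 t l - w l) = t * bar n P k.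
  by rewrite /dot /w1; elim/I3P: k {w1}; rewrite /=; ring.
have near t : `|t| = s -> forall i l, amax i (w1 t) l -> amax i w l.
  move=> ts; apply: he => l; rewrite /w1 addrAC subrr add0r normrM ts.
  by case: (l == k); rewrite ?normr1 ?normr0 /s; lra.
have up i : trop i (w1 s) <= trop i w + s * (amax i w k)%:R.
  have [l hl] := amax_ex i (w1 s); move: (hl) => /amaxP <-.
  have Al := near s (gtr0_norm s0) i l hl; move: (Al) => /amaxP <-; rewrite /w1.
  by case: eqP Al => [->|_] => [->|_]; rewrite /=; case: (amax i w k) => /=; lra.
have dn i : trop i (w1 (- s)) <= trop i w - s * (aonly i w k)%:R.
  have [l hl] := amax_ex i (w1 (- s)); move: (hl) => /amaxP <-.
  have Al := near (- s) (ltac:(by rewrite normrN gtr0_norm)) i l hl.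
  move: (Al) => /amaxP <-; rewrite /w1.
  have [Ok|] := boolP (aonly i w k); last by case: eqP => /= *; lra.
  have /andP[_ /forallP/(_ l)] := Ok; rewrite Al implybF negbK => ->; rewrite /=; lra.
have := h (w1 s); have := h (w1 (- s)); rewrite !dw1.
have : tropsum (w1 s) <= tropsum w + s * (hi w k)%:R.
  by rewrite /hi natr_sum mulr_sumr -big_split /=; apply: ler_sum => i _; exact: up.
have : tropsum (w1 (- s)) <= tropsum w - s * (lo w k)%:R.
  by rewrite /lo natr_sum mulr_sumr -sumrB; apply: ler_sum => i _; exact: dn.
move=> a1 a2 a3 a4; apply/andP; split; rewrite -(ler_pM2l s0); lra.
Qed.

Lemma cell_lattice w y : deg y = n -> (forall k, lo w k <= y k <= hi w k)%N -> cell w (vec y).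
Proof. by move=> dy hy; apply/cellP => k; rewrite bar_vec // !ler_nat. Qed.

Definition corner_count (kap : I -> 'I_3) : lat := [ffun k => \sum_i (kap i == k : nat)]%N.

Lemma deg_corner_count kap : deg (corner_count kap) = n.
Proof.
rewrite /deg !ffunE -!big_split /= -sum1I; apply: eq_bigr => i _.
by elim/I3P: (kap i).
Qed.

Lemma cell_corner_count w kap : (forall i, amax i w (kap i)) -> cell w (vec (corner_count kap)).
Proof.
move=> h; apply: cell_lattice; first exact: deg_corner_count.
by move=> k; rewrite ffunE; exact: choice_in_cell.
Qed.

Lemma amax_choice w : exists kap : I -> 'I_3, forall i, amax i w (kap i).
Proof. by have [kap hk] := choice (fun i => amax_ex i w); exists kap. Qed.

Lemma cell_nonempty w : cell w !=set0.
Proof. by have [kap hk] := amax_choice w; exists (vec (corner_count kap)); exact: cell_corner_count. Qed.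

Lemma dotB P (f g : 'I_3 -> R) : dot n P (fun k => f k - g k) = dot n P f - dot n P g.
Proof. by rewrite /dot; ring. Qed.

Lemma dot_eq_trop w w' P : cell w P ->
  (cell w' P <-> tropsum w' - tropsum w = dot n P (fun k => w' k - w k)).
Proof.
move=> hP; split => [hP'|h].
  by have := dot_le_trop w' hP; have := dot_le_trop w hP'; rewrite !dotB; lra.
apply: cell_of_subgradient => w2; have := dot_le_trop w2 hP.
by move: h; rewrite !dotB; lra.
Qed.

(** The face of a subdifferential in the direction [f] is the subdifferential at a point slightly
    displaced along [f]. *)
Lemma arrangement_faces C F : arrangement_cells C -> face C F -> arrangement_cells F.
Proof.
move=> [w _ <-] /(faceP n)[_ [f ->]].
have [e e0 he] := amax_near w.
have [M M0 hM] : exists2 M, 0 < M & forall k, `|f k| <= M.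
  exists (1 + `|f k0| + `|f k1| + `|f k2|); first by rewrite -!addrA ltr_wpDr ?addr_ge0.
  have := normr_ge0 (f k0); have := normr_ge0 (f k1); have := normr_ge0 (f k2).
  by move=> ? ? ?; elim/I3P; lra.
pose t := e / 2 / M.
have t0 : 0 < t by rewrite !divr_gt0.
pose w' k := w k + t * f k.
have sub : cell w' `<=` cell w.
  apply: amax_sub_cell; apply: he => k; rewrite /w' addrAC subrr add0r normrM gtr0_norm //.
  have : t * `|f k| <= t * M by rewrite ler_pM2l.
  by rewrite [t * M]divfK ?gt_eqF //; lra.
have dE P : dot n P (fun k => w' k - w k) = t * dot n P f by rewrite /dot /w'; ring.
exists w' => //; apply/seteqP; split => P.
  move=> hP'; have hP := sub _ hP'; split => // Q hQ.
  rewrite -(ler_pM2l t0) -!dE.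
  by rewrite -((dot_eq_trop w' hP).1 hP'); have := dot_le_trop w' hQ; lra.
move=> [hP hmax]; have [Q hQ'] := cell_nonempty w'; have hQ := sub _ hQ'.
apply/(dot_eq_trop w' hP)/le_anti.
have := hmax _ hQ; rewrite -(ler_pM2l t0) -!dE -((dot_eq_trop w' hQ).1 hQ') => ->.
by rewrite /=; have := dot_le_trop w' hP; lra.
Qed.

(** On [cell w] the functional [w' - w] is at most [tropsum w' - tropsum w], with equality precisely
    on [cell w']; it exhibits a nonempty intersection as a face. *)
Lemma arrangement_inter C C' : arrangement_cells C -> arrangement_cells C' ->
  C `&` C' = set0 \/ (face C (C `&` C') /\ face C' (C `&` C')).
Proof.
move=> [w _ <-] [w' _ <-].
have [->|/set0P[Q [hQ hQ']]] := eqVneq (cell w `&` cell w') set0; [by left|right].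
have half v v' : cell v Q -> cell v' Q -> face (cell v) (cell v `&` cell v').
  move=> h h'; apply/(faceP n); split; first by exists Q.
  exists (fun k => v' k - v k); apply/seteqP; split => P.
    move=> [hP hP']; split => // S hS; rewrite -((dot_eq_trop v' hP).1 hP').
    by have := dot_le_trop v' hS; lra.
  move=> [hP hmax]; split => //; apply/(dot_eq_trop v' hP)/le_anti.
  have := hmax _ h; rewrite -((dot_eq_trop v' h).1 h') => ->.
  by rewrite /=; have := dot_le_trop v' hP; lra.
split; first exact: half.
by rewrite setIC; exact: half.
Qed.

Lemma arrangement_finite : finite_set arrangement_cells.
Proof.
pose h (x : {ffun 'I_3 -> 'I_n.+1} * {ffun 'I_3 -> 'I_n.+1}) : set plane :=
  @hexagon R n (fun k => (x.1 k : nat)%:Z) (fun k => (x.2 k : nat)%:Z).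
apply: (@sub_finite_set _ _ (range h)); last exact/finite_image/finite_finset.
move=> C [w _ <-].
have hn k : (hi w k < n.+1)%N.
  by rewrite ltnS -sum1I; apply: leq_sum => i _; exact: leq_b1.
have ln k : (lo w k < n.+1)%N.
  by rewrite ltnS -sum1I; apply: leq_sum => i _; exact: leq_b1.
exists ([ffun k => Ordinal (ln k)], [ffun k => Ordinal (hn k)]) => //.
by rewrite /h /cell; congr hexagon; apply/funext => k; rewrite ffunE.
Qed.

End Arrangement.

(** * The cells of an arrangement cover the simplex *)

Section Cover.
Variable R : realType.
Local Notation plane := 'rV[R]_2.
Variables (I : finType) (p : I -> 'I_3 -> R).
Implicit Types (P Q : plane) (w : 'I_3 -> R) (i : I) (k : 'I_3).
Let n := #|I|.

Lemma spread_bound : exists2 M : R, 0 <= M & forall i k l, p i k - p i l <= M.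
Proof.
exists (\big[Order.max/0]_(t : I * ('I_3 * 'I_3)) (p t.1 t.2.1 - p t.1 t.2.2)).
  exact: bigmax_ge_id.
by move=> i k l; exact: (le_bigmax _ (fun t => p t.1 t.2.1 - p t.1 t.2.2) (i, (k, l))).
Qed.

(* Shrinking a gap larger than the spread of the centres moves along a ray on
   which [tropsum] has the maximal slope [n]. *)
Lemma clamp M P w : 0 <= M -> (forall i k l, p i k - p i l <= M) ->
  (forall k, 0 <= bar n P k) ->
  exists w', (forall k, 0 <= w' k <= M + M) /\
    tropsum p w' - dot n P w' <= tropsum p w - dot n P w.
Proof.
move=> M0 hM P0; have [a [b [c [[ab ac bc] h1 h2]]]] := sort3 w.
pose e1 := Num.max 0 (w b - w c - M); pose e2 := Num.max 0 (w a - w b - M).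
have e1E : (e1 = 0 /\ w b - w c <= M) \/ (e1 = w b - w c - M /\ M <= w b - w c).
  by rewrite /e1; case: (leP 0 (w b - w c - M)) => h; [right|left]; split=> //; lra.
have e2E : (e2 = 0 /\ w a - w b <= M) \/ (e2 = w a - w b - M /\ M <= w a - w b).
  by rewrite /e2; case: (leP 0 (w a - w b - M)) => h; [right|left]; split=> //; lra.
have e10 : 0 <= e1 by rewrite /e1 le_max lexx.
have e20 : 0 <= e2 by rewrite /e2 le_max lexx.
move: e1 e2 e1E e2E e10 e20 => e1 e2 e1E e2E e10 e20.
pose w' k := if k == c then 0 else if k == b then w b - w c - e1 else w a - w c - e1 - e2.
have wc : w' c = 0 by rewrite /w' eqxx.
have wb : w' b = w b - w c - e1 by rewrite /w' (negPf bc) eqxx.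
have wa : w' a = w a - w c - e1 - e2 by rewrite /w' (negPf ac) (negPf ab).
have three k := I3_three k ab ac bc.
exists w'; split.
  move=> k; case: (three k) => ->; rewrite ?wa ?wb ?wc; apply/andP; split; lra.
have key i : trop p i w' + (w c + e1 + e2) <= trop p i w.
  rewrite -lerBrDr; apply: trop_le => k.
  have ta := trop_ge p i w a; have tb := trop_ge p i w b; have tc := trop_ge p i w c.
  have ma := hM i a b; have mb := hM i a c; have mc := hM i b c.
  by case: (three k) => ->; rewrite ?wa ?wb ?wc; lra.
have : \sum_i (trop p i w' + (w c + e1 + e2)) <= tropsum p w.
  by apply: ler_sum => i _; exact: key.
rewrite big_split /= sumr_const -mulr_natl -/n -/(tropsum p w').
have pa := P0 a; have pb := P0 b; have pc := P0 c.
have hs : bar n P a + bar n P b + bar n P c = n%:R.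
  by rewrite -(bar_sum n P); exact/esym/sum_I3.
have dE (f : 'I_3 -> R) : dot n P f = bar n P a * f a + bar n P b * f b + bar n P c * f c.
  exact: (sum_I3 (fun k => bar n P k * f k)).
rewrite -hs !dE wa wb wc.
have m1 : 0 <= bar n P c * e1 by exact: mulr_ge0.
have m2 : 0 <= bar n P c * e2 by exact: mulr_ge0.
have m3 : 0 <= bar n P b * e2 by exact: mulr_ge0.
lra.
Qed.

Lemma trop_continuous i :
  continuous (fun v : 'rV[R]_3 => trop p i (fun k => v ord0 k) : R^o).
Proof.
have c k : continuous (fun v : 'rV[R]_3 => v ord0 k - p i k : R^o).
  move=> v; apply: (@continuousB _ R^o); last exact: cst_continuous.
  exact: coord_continuous.
move=> v.
have m12 := continuous_max (c k1 v) (c k2 v).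
exact: (continuous_max (c k0 v) m12).
Qed.

(** A point [P] is a subgradient wherever [tropsum] minus the pairing with [P] is minimal.
    Compactness gives a minimum on a cube, and [clamp] makes it global. *)
Lemma arrangement_cover : \bigcup_(C in arrangement_cells p) C = Delta n.
Proof.
apply/seteqP; split => [P [C [w _ <-]] /cellP hP|P].
  by rewrite DeltaE => k; have /andP[h _] := hP k; apply: le_trans h; exact: ler0n.
rewrite DeltaE => P0; have [M M0 hM] := spread_bound.
pose f (v : 'rV[R]_3) : R := tropsum p (fun k => v ord0 k) - dot n P (fun k => v ord0 k).
pose A := [set v : 'rV[R]_3 | forall k, `[0, M + M]%classic (v ord0 k)].
have [|||v _ hv] := @EVT_min_rV R 3 f A.
- by exists 0 => k; rewrite /= mxE in_itv /= lexx addr_ge0.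
- apply: (@rV_compact _ _ (fun=> `[0, M + M]%classic)) => k; exact: segment_compact.
- apply: continuous_subspaceT => v.
  have cs : continuous (fun v : 'rV[R]_3 => \sum_i trop p i (fun k => v ord0 k) : R^o).
    apply: (@continuous_big R^o _ (fun x y : R^o => x + y)); first exact: add_continuous.
    by move=> i _; exact: trop_continuous.
  have c k : continuous (fun v : 'rV[R]_3 => bar n P k * v ord0 k : R^o).
    move=> u; exact: (continuousM (@cst_continuous _ R^o (bar n P k) u) (@coord_continuous R 1 3 ord0 k u)).
  exact: (continuousB (cs v) (continuousD (continuousD (c k0 v) (c k1 v)) (c k2 v))).
exists (cell p (fun k => v ord0 k)); first by exists (fun k => v ord0 k).
apply: cell_of_subgradient => w.
have [w' [hw' le]] := clamp w M0 hM P0.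
have := hv (\row_k w' k).
have -> : (\row_k w' k) \in A.
  by apply: mem_set => k; rewrite /= mxE in_itv /= hw'.
move=> /(_ isT); rewrite /f dotB.
have -> : (fun k => (\row_k w' k) ord0 k) = w' by apply/funext => k; rewrite mxE.
lra.
Qed.

Lemma arrangement_lns : linear_newton_subdivision n (arrangement_cells p).
Proof.
split.
- exact: arrangement_finite.
- by move=> C [w _ <-]; exact: cell_Pcell.
- exact: arrangement_faces.
- exact: arrangement_inter.
- exact: arrangement_cover.
Qed.

End Cover.

(** * Exact metrics on the dual of an arrangement *)

Section Slopes.
Variable R : realType.
Local Notation plane := 'rV[R]_2.
Local Notation vec := (vec R).
Variables (I : finType) (p : I -> 'I_3 -> R).
Implicit Types (P : plane) (w : 'I_3 -> R) (i : I) (k : 'I_3) (y z : lat).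
Let n := #|I|.
Local Notation N := (arrangement_cells p).
Local Notation HN := (arrangement_lns p).
Local Notation edge := (inner_edges n N).
Local Notation cell := (cell p).
Local Notation amax := (amax p).

Lemma cell_latticeP w y : deg y = n ->
  cell w (vec y) <-> forall k, (lo p w k <= y k <= hi p w k)%N.
Proof.
move=> dy; split=> [/cellP h k|]; last exact: cell_lattice.
by have := h k; rewrite bar_vec // !ler_nat.
Qed.

Definition upd (kap : I -> 'I_3) i k : I -> 'I_3 := fun j => if j == i then k else kap j.
Definition count_but (kap : I -> 'I_3) i : lat :=
  [ffun k => \sum_(j | j != i) (kap j == k : nat)]%N.

Lemma count_upd kap i k : corner_count (upd kap i k) = count_but kap i + dl k.
Proof.
apply/ffunP => l; rewrite latDE dlE !ffunE (bigD1 i) //= /upd eqxx addnC eq_sym; congr (_ + _)%N.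
by apply: eq_bigr => j /negPf ->.
Qed.

Lemma deg_count_but kap i : (deg (count_but kap i) + 1)%N = n.
Proof. by have := deg_corner_count (upd kap i k0); rewrite count_upd degD deg_dl. Qed.

Lemma cell_count_but w kap i k : (forall j, amax j w (kap j)) -> amax i w k ->
  cell w (vec (count_but kap i + dl k)).
Proof.
move=> h hi; rewrite -count_upd; apply: cell_corner_count => j; rewrite /upd.
by case: eqP => [->|].
Qed.

(** [P] is the centroid of the unit triangle. As the bounds of a cell are integers, a cell through
    the centroid contains all three vertices. The constant [2 / 3] below does the same for the
    opposite orientation. *)
Lemma up_triangle_cell z : (deg z + 1)%N = n ->
  exists w, forall k, cell w (vec (z + dl k)).
Proof.
move=> dz; have nE : n%:R = (z k0)%:R + (z k1)%:R + (z k2)%:R + 1 :> R.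
  by rewrite -dz /deg !natrD.
have [P hP] : exists P, bar n P =1 (fun k => (z k)%:R + 3%:R^-1).
  by apply: bar_surj; rewrite nE; field.
have : Delta n P by rewrite DeltaE => k; rewrite hP addr_ge0 // invr_ge0.
rewrite -(arrangement_cover p) => -[_ [w _ <-]] /cellP h.
exists w => k; apply/cell_latticeP; first by rewrite degD deg_dl.
move=> l; have := h l; rewrite hP latDE dlE => /andP[h1 h2].
have : (lo p w l < (z l).+1)%N by rewrite -(ltr_nat R) -natr1; lra.
have : (z l < hi p w l)%N by rewrite -(ltr_nat R); lra.
by case: (l == k) => /=; lia.
Qed.

Lemma down_triangle_cell y : (deg y + 2)%N = n ->
  exists w, forall k l, k != l -> cell w (vec (y + dl k + dl l)).
Proof.
move=> dz; have nE : n%:R = (y k0)%:R + (y k1)%:R + (y k2)%:R + 2 :> R.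
  by rewrite -dz /deg !natrD.
have [P hP] : exists P, bar n P =1 (fun k => (y k)%:R + 2 / 3%:R).
  by apply: bar_surj; rewrite nE; field.
have : Delta n P by rewrite DeltaE => k; rewrite hP addr_ge0 // divr_ge0.
rewrite -(arrangement_cover p) => -[_ [w _ <-]] /cellP h.
exists w => k l kl; apply/cell_latticeP; first by rewrite !degD !deg_dl; lia.
move=> j; have := h j; rewrite hP !latDE !dlE => /andP[h1 h2].
have : (lo p w j < (y j).+1)%N by rewrite -(ltr_nat R) -natr1; lra.
have : (y j < hi p w j)%N by rewrite -(ltr_nat R); lra.
by case: (eqVneq j k) => [->|_]; [rewrite (negPf kl)|case: (j == l)] => /=; lia.
Qed.

Section Potential.
Variable psi : lat -> R.
Hypothesis psi_flat : forall y k l m, k != l -> k != m -> l != m ->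
  (deg y + 2)%N = n -> (forall e : edge, ~ unit_in e y k l m) -> rhombus psi y k l m = 0.

(** An exchange argument: [z] is moved towards [z'] by trading a unit of [b] for a unit of [a],
    which does not leave the bounds of the cell, and each trade keeps the slope by [flat4]. *)
Lemma slope_exchange w z z' k l : (deg z + 1)%N = n -> (deg z' + 1)%N = n ->
  cell w (vec (z + dl k)) -> cell w (vec (z + dl l)) ->
  cell w (vec (z' + dl k)) -> cell w (vec (z' + dl l)) ->
  psi (z + dl k) - psi (z + dl l) = psi (z' + dl k) - psi (z' + dl l).
Proof.
have [r] := ubnP ((z' k0 - z k0) + (z' k1 - z k1) + (z' k2 - z k2))%N.
elim: r z => // r ih z hr dz dz' h1 h2 h3 h4.
have [->//|zz'] := eqVneq z z'.
have [a za] : exists a, (z a < z' a)%N.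
  apply: contrapT => h; move/eqP: zz'; apply; apply/ffunP => j; change (z j = z' j :> nat).
  have le (i : 'I_3) : (z' i <= z i)%N by rewrite leqNgt; apply/negP => hi; apply: h; exists i.
  have := le k0; have := le k1; have := le k2; have := dz; rewrite -dz' /deg.
  by elim/I3P: j; lia.
have [b zb] : exists b, (z' b < z b)%N.
  apply: contrapT => h; move/eqP: zz'; apply; apply/ffunP => j; change (z j = z' j :> nat).
  have le (i : 'I_3) : (z i <= z' i)%N by rewrite leqNgt; apply/negP => hi; apply: h; exists i.
  have := le k0; have := le k1; have := le k2; have := dz; rewrite -dz' /deg.
  by elim/I3P: j; lia.
pose y : lat := [ffun j => z j - (j == b)]%N.
have zE : z = y + dl b.
  by apply/ffunP => j; rewrite latDE dlE /y ffunE; case: (eqVneq j b) => [->|_] /=; lia.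
have dy : (deg y + 2)%N = n by rewrite -dz zE degD deg_dl; lia.
have ab : a != b by apply/eqP => E; move: za zb; rewrite E; lia.
have dzc c x : (deg x + 1)%N = n -> deg (x + dl c) = n by rewrite degD deg_dl.
have dya : (deg (y + dl a)%R + 1)%N = n by rewrite degD deg_dl; lia.
have mem c : cell w (vec (z + dl c)) -> cell w (vec (z' + dl c)) ->
    cell w (vec (y + dl a + dl c)).
  move=> /(cell_latticeP w (dzc c z dz)) g1 /(cell_latticeP w (dzc c z' dz')) g2.
  apply/cell_latticeP; first exact: dzc.
  move=> j; have := g1 j; have := g2 j.
  rewrite /y !latDE !dlE ffunE; have [->|ja] := eqVneq j a.
    by rewrite (negPf ab); lia.
  by have [->|jb] := eqVneq j b; lia.
have h5 := mem _ h1 h3; have h6 := mem _ h2 h4.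
rewrite -(ih (y + dl a)) //; last first.
  have E (j : 'I_3) : ((y + dl a)%R : lat) j = (z j - (j == b) + (j == a))%N by rewrite latDE dlE ffunE.
  have D (j : 'I_3) : (z' j - ((y + dl a)%R : lat) j + (j == a) = z' j - z j)%N.
    rewrite E; have [->|ja] := eqVneq j a; first by rewrite (negPf ab); lia.
    by have [->|jb] := eqVneq j b; lia.
  have := D k0; have := D k1; have := D k2; clear -hr.
  have : ((k0 == a) + (k1 == a) + (k2 == a) = 1)%N by elim/I3P: a.
  lia.
rewrite zE in h1 h2 *.
have NC : N (cell w) by exists w.
have := flat4 HN psi_flat NC dy h1 h2 h5 h6; lra.
Qed.

(* The slope of [psi] along the direction dual to a ray of the [i]-th line does
   not change along that ray, because neighbouring cells share an edge. *)
Lemma slope_ray i w k l (kap kap0 : I -> 'I_3) :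
  (forall j, amax j w (kap j)) -> (forall j, amax j (p i) (kap0 j)) ->
  amax i w k -> amax i w l ->
  psi (count_but kap i + dl k) - psi (count_but kap i + dl l) =
  psi (count_but kap0 i + dl k) - psi (count_but kap0 i + dl l).
Proof.
move=> hkap hkap0 hk hl.
(* The absolute value keeps the path on the ray for all real [t], so that a locally constant slope
   has derivative zero on the whole line. *)
pose g (t : R) j := p i j + `|t| * (w j - p i j).
have gi t j : amax i w j -> amax i (g t) j.
  move=> /forallP h; apply/forallP => m; rewrite /g addrAC subrr add0r [leRHS]addrAC subrr add0r.
  by rewrite ler_wpM2l.
have [K hK] := choice (fun t => amax_choice p (g t)).
pose s t : R := psi (count_but (K t) i + dl k) - psi (count_but (K t) i + dl l).
have near t : \forall t' \near t, s t = s t'.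
  have [e e0 he] := amax_near p (g t).
  have [M M0 hM] : exists2 M, 0 < M & forall j, `|w j - p i j| <= M.
    exists (1 + `|w k0 - p i k0| + `|w k1 - p i k1| + `|w k2 - p i k2|).
      by rewrite -!addrA ltr_wpDr ?addr_ge0.
    have := normr_ge0 (w k0 - p i k0); have := normr_ge0 (w k1 - p i k1).
    by have := normr_ge0 (w k2 - p i k2); move=> ? ? ?; elim/I3P; lra.
  apply/nbhs_ballP; exists (e / M) => /=; first by rewrite divr_gt0.
  move=> t'; rewrite /ball /= => tt'.
  have sub : cell (g t') `<=` cell (g t).
    apply: amax_sub_cell; apply: he => j.
    rewrite /g opprD addrACA subrr add0r -mulrBl normrM.
    have d1 : `| `|t'| - `|t| | <= `|t - t'| by rewrite [leRHS]distrC ler_dist_dist.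
    have : `|t - t'| * M < e by rewrite -ltr_pdivlMr.
    apply: le_lt_trans; apply: ler_pM => //; exact: hM.
  apply: (@slope_exchange (g t)); try exact: deg_count_but.
  - by apply: cell_count_but; [exact: hK|exact: gi].
  - by apply: cell_count_but; [exact: hK|exact: gi].
  - by apply: sub; apply: cell_count_but; [exact: hK|exact: gi].
  - by apply: sub; apply: cell_count_but; [exact: hK|exact: gi].
have s01 : s 1 = s 0.
  apply: is_derive_0_is_cst => t.
  by apply: (@near_eq_is_derive _ _ _ (cst (s t))); exact: near.
have g1 : g 1 = w by apply/funext => j; rewrite /g normr1 mul1r addrC subrK.
have g0 : g 0 = p i by apply/funext => j; rewrite /g normr0 mul0r addr0.
transitivity (s 1).
  apply: (@slope_exchange w); try exact: deg_count_but; try exact: cell_count_but.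
    by apply: cell_count_but => //; rewrite -[in X in forall j, X j]g1; exact: hK.
  by apply: cell_count_but => //; rewrite -[in X in forall j, X j]g1; exact: hK.
rewrite s01; have ci c : amax i (p i) c by apply/forallP => m; rewrite !subrr.
apply: (@slope_exchange (p i)); try exact: deg_count_but; try exact: cell_count_but.
  by apply: cell_count_but => //; rewrite -[in X in forall j, X j]g0; exact: hK.
by apply: cell_count_but => //; rewrite -[in X in forall j, X j]g0; exact: hK.
Qed.

Lemma slopes : exists Q : I -> 'I_3 -> R, forall w i k l z, amax i w k -> amax i w l ->
  (deg z + 1)%N = n -> cell w (vec (z + dl k)) -> cell w (vec (z + dl l)) ->
  psi (z + dl k) - psi (z + dl l) = Q i k - Q i l.
Proof.
have [K hK] := choice (fun i => amax_choice p (p i)).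
exists (fun i k => psi (count_but (K i) i + dl k)) => w i k l z hk hl dz h1 h2.
have [kap hkap] := amax_choice p w.
rewrite -(slope_ray hkap (hK i) hk hl); apply: (@slope_exchange w) => //;
  [exact: deg_count_but|exact: cell_count_but|exact: cell_count_but].
Qed.

End Potential.

(** [Q i] acts as the new centre of the line [i]; as homogeneous coordinates, only its differences
    matter. *)
Definition slopes_of (psi : lat -> R) (Q : I -> 'I_3 -> R) : Prop :=
  forall w i k l z, amax i w k -> amax i w l ->
  (deg z + 1)%N = n -> cell w (vec (z + dl k)) -> cell w (vec (z + dl l)) ->
  psi (z + dl k) - psi (z + dl l) = Q i k - Q i l.

(** Such lines have a ray in common from some point on. The point [w] lies on it: its third
    coordinate is low enough for [k] and [l] to be maximal for both lines, so one difference of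
    [psi] computes both slopes. *)
Lemma slopes_incident psi Q i j k l : slopes_of psi Q ->
  p i k - p i l = p j k - p j l -> Q i k - Q i l = Q j k - Q j l.
Proof.
move=> hQ h; have [->|kl] := eqVneq k l; first by rewrite !subrr.
pose w m := if (m == k) || (m == l) then p i m
            else Num.min (p i m) (p j m + p i k - p j k).
have wk : w k = p i k by rewrite /w eqxx.
have wl : w l = p i l by rewrite /w eqxx orbT.
have wm m : m != k -> m != l -> w m <= p i m /\ w m <= p j m + p i k - p j k.
  by move=> mk ml; rewrite /w (negPf mk) (negPf ml) /= !ge_min !lexx orbT.
have ik : amax i w k.
  apply/forallP => m; rewrite wk subrr; have [->|mk] := eqVneq m k; first by rewrite wk subrr.
  have [->|ml] := eqVneq m l; first by rewrite wl subrr.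
  by have [? ?] := wm m mk ml; lra.
have il : amax i w l.
  by move: ik => /forallP ik; apply/forallP => m; have := ik m; rewrite wk wl !subrr.
have jk : amax j w k.
  apply/forallP => m; rewrite wk; have [->|mk] := eqVneq m k; first by rewrite wk.
  have [->|ml] := eqVneq m l; first by rewrite wl; lra.
  by have [? ?] := wm m mk ml; lra.
have jl : amax j w l.
  by move: jk => /forallP jk; apply/forallP => m; have := jk m; rewrite wk wl; lra.
have [kap hkap] := amax_choice p w.
have d := deg_count_but kap i.
have c1 := cell_count_but hkap ik; have c2 := cell_count_but hkap il.
by rewrite -(hQ w i k l _ ik il d c1 c2) (hQ w j k l _ jk jl d c1 c2).
Qed.

Lemma full_pair w k : (lo p w k < hi p w k)%N ->
  exists i l, [/\ l != k, amax i w k & amax i w l].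
Proof.
move=> h; apply: contrapT => nex; move: h; rewrite ltnNge => /negP; apply.
rewrite /lo /hi; apply: leq_sum => i _; case: (boolP (amax i w k)) => // ik.
suff -> : aonly p i w k by [].
rewrite /aonly ik; apply/forallP => l; apply/implyP => lk; apply/negP => il.
by apply: nex; exists i, l.
Qed.

Lemma full_triangle w z : (deg z + 1)%N = n -> (forall k, cell w (vec (z + dl k))) ->
  forall k, (lo p w k < hi p w k)%N.
Proof.
move=> dz h k.
have d c : deg (z + dl c) = n by rewrite degD deg_dl.
have [l lk] : exists l, k != l by elim/I3P: k; [exists k1|exists k0|exists k0].
have := (cell_latticeP w (d k)).1 (h k) k; have := (cell_latticeP w (d l)).1 (h l) k.
by rewrite !latDE !dlE eqxx (negPf lk) /=; lia.
Qed.

(** At a point dual to the triangle every corner is maximal for some line together with another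
    corner. A graph on three vertices without isolated vertex is connected, so all differences
    follow. *)
Lemma slopes_eq psi Q (f : 'I_3 -> R) : slopes_of psi Q ->
  (forall i k l, Q i k - Q i l = f k - f l) ->
  forall z k l, (deg z + 1)%N = n -> psi (z + dl k) - psi (z + dl l) = f k - f l.
Proof.
move=> hQ hf z k l dz; have [w hw] := up_triangle_cell dz.
have full := full_triangle dz hw.
have adj c : exists2 c', c' != c & psi (z + dl c) - psi (z + dl c') = f c - f c'.
  have [i [c' [cc' ic ic']]] := full_pair (full c); exists c' => //.
  by rewrite (hQ w i c c') //; exact: hf.
have [a ha ea] := adj k0; have [b hb eb] := adj k1; have [c hc ec] := adj k2.
move: ha hb hc ea eb ec; elim/I3P: a => //; elim/I3P: b => //; elim/I3P: c => // _ _ _;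
elim/I3P: k; elim/I3P: l; lra.
Qed.

Lemma slopes_rigid psi Q (f : 'I_3 -> R) : slopes_of psi Q ->
  (forall i k l, Q i k - Q i l = f k - f l) ->
  forall y k l m, (deg y + 2)%N = n -> rhombus psi y k l m = 0.
Proof.
move=> hQ hf y k l m dy; rewrite /rhombus.
have dk c : (deg (y + dl c)%R + 1)%N = n by rewrite degD deg_dl; lia.
have := slopes_eq hQ hf k l (dk k); have := slopes_eq hQ hf k l (dk m).
by rewrite (addrAC y (dl m) (dl k)) (addrAC y (dl m) (dl l)); lra.
Qed.

End Slopes.

(** * Detecting an edge between two cells *)

Section EdgeBetween.
Variable R : realType.
Local Notation plane := 'rV[R]_2.
Local Notation vec := (vec R).
Implicit Types (C : set plane) (P Q : plane) (w : 'I_3 -> R) (k : 'I_3) (y z : lat).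
Variables (n : nat) (N : set (set plane)) (HN : linear_newton_subdivision n N).
Local Notation edge := (inner_edges n N).

Definition pairing y w : R := (y k0)%:R * w k0 + (y k1)%:R * w k1 + (y k2)%:R * w k2.

Lemma dot_vec y w : deg y = n -> dot n (vec y) w = pairing y w.
Proof. by move=> dy; rewrite /dot !bar_vec. Qed.

Lemma pairingD y z w : pairing (y + z) w = pairing y w + pairing z w.
Proof. by rewrite /pairing !latDE !natrD; ring. Qed.

Lemma pairing_dl k w : pairing (dl k) w = w k.
Proof. by rewrite /pairing !dlE; elim/I3P: k => /=; ring. Qed.

Lemma dot_same A F P Q f : F = [set P | A P /\ forall Q : plane, A Q -> dot n Q f <= dot n P f] ->
  F P -> F Q -> dot n P f = dot n Q f.
Proof.
by move=> -> [AP hP] [AQ hQ]; apply/le_anti; rewrite hP // hQ.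
Qed.

(** A functional with equal values at the two points is affine in the coordinate [k] alone. *)
Lemma face_line A F y k l m : k != l -> k != m -> l != m -> (deg y + 2)%N = n ->
  face A F -> F (vec (y + dl k + dl l)) -> F (vec (y + dl k + dl m)) ->
  F = A \/ (forall P, F P -> bar n P k = (y k)%:R + 1).
Proof.
move=> kl km lm dy /(faceP n)[_ [f FE]] F1 F2.
have d c c' : deg (y + dl c + dl c') = n by rewrite !degD !deg_dl; lia.
have elm : f l = f m.
  have := dot_same FE F1 F2; rewrite !dot_vec // !pairingD !pairing_dl; lra.
have sums (g : 'I_3 -> R) := sum_I3 g kl km lm.
have dE P : dot n P f = bar n P k * (f k - f l) + n%:R * f l.
  rewrite -(bar_sum n P) (sums (bar n P)) /dot (sums (fun j => bar n P j * f j)) -elm; ring.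
have [ek|nk] := eqVneq (f k) (f l).
  left; rewrite FE; apply/seteqP; split => P /=; first by case.
  by move=> AP; split => // Q _; rewrite !dE ek; lra.
right => P FP; have := dot_same FE FP F1; rewrite !dE bar_vec // !latDE !dlE eqxx (negPf kl) /=.
rewrite addn0 natrD => h.
have : (bar n P k - ((y k)%:R + 1)) * (f k - f l) = 0 by lra.
move/eqP; rewrite mulf_eq0 => /orP[] /eqP; first lra.
by move=> fk; move/eqP: nk; lra.
Qed.

Lemma cell_mid C P Q : N C -> C P -> C Q -> C (mid P Q).
Proof.
move=> /(lns_cell HN)/(Pcell_translateP n)[b [c [w [_ ->]]]] hP hQ k.
rewrite /mid bar_conv.
by have /andP[? ?] := hP k; have /andP[? ?] := hQ k; apply/andP; split; lra.
Qed.

(** The two cells contain the unit triangles on either side of the unit edge. Their intersection is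
    a face of both; by [face_line] it lies on the line of the unit edge, since otherwise [C] and
    [C'] would coincide or [C] itself would lie on that line. *)
Lemma edge_between C C' y k l m : k != l -> k != m -> l != m -> (deg y + 2)%N = n ->
  N C -> N C' -> (forall c, C (vec (y + dl k + dl c))) ->
  (forall c c', c != c' -> C' (vec (y + dl c + dl c'))) ->
  ~ C (vec (y + dl l + dl m)) -> exists e : edge, unit_in e y k l m.
Proof.
move=> kl km lm dy Nw Nw' hw hw' nlm; apply: contrapT => ne.
pose F := C `&` C'.
have F1 : F (vec (y + dl k + dl l)) by split; [exact: hw|exact: hw'].
have F2 : F (vec (y + dl k + dl m)) by split; [exact: hw|exact: hw'].
have [F0|[f f']] := lns_inter HN Nw Nw'; first by rewrite /F F0 in F1.
have bk : forall P, F P -> bar n P k = (y k)%:R + 1.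
  have [FC|//] := face_line kl km lm dy f F1 F2.
  have [FC'|h] := face_line kl km lm dy f' F1 F2.
    by case: nlm; rewrite -FC FC'; apply: hw'.
  have := h (vec (y + dl k + dl k)); rewrite FC => /(_ (hw k)).
  rewrite bar_vec; last by rewrite !degD !deg_dl; lia.
  by rewrite !latDE !dlE eqxx /= !natrD; lra.
have NF : N F by exact: (lns_face HN Nw f).
have dF : has_dim F 1.
  apply: (has_dim1I F1 F2); first exact: vec_neq.
  move=> S FS; exists (bar n S m - (y m)%:R).
  have d c c' : deg (y + dl c + dl c') = n by rewrite !degD !deg_dl; lia.
  have mk : m != k by rewrite eq_sym.
  have ml : m != l by rewrite eq_sym.
  have -> : vec (y + dl k + dl m) - vec (y + dl k + dl l) = corner R m - corner R l.
    by rewrite !vecD !vec_dl opprD addrACA subrr add0r.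
  apply: (bar_inj2 (n := n) km); rewrite bar_move bar_vec // !latDE !dlE ?eqxx.
    by rewrite bk // (negPf kl) (negPf km) /= addn0 natrD; ring.
  by rewrite (negPf ml) (negPf mk) /= !addn0; ring.
have nb : ~ F `<=` boundary (Delta n).
  move=> /(_ (mid (vec (y + dl k + dl l)) (vec (y + dl k + dl m)))).
  have Fm : F (mid (vec (y + dl k + dl l)) (vec (y + dl k + dl m))).
    by case: F1 F2 => ? ? [? ?]; split; apply: cell_mid.
  move=> /(_ Fm) /boundary_Delta[]; first exact: (cell_Delta HN Nw Fm.1).
  move=> j; have d c c' : deg (y + dl c + dl c') = n by rewrite !degD !deg_dl; lia.
  rewrite /mid bar_conv !bar_vec // !latDE !dlE !natrD.
  have := ler0n R (y j).
  have := I3_three j kl km lm.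
  case=> ->; rewrite ?eqxx ?[l == k]eq_sym ?[m == k]eq_sym ?[m == l]eq_sym
    ?(negPf kl) ?(negPf km) ?(negPf lm) /=; lra.
by apply: ne; exists (exist _ F (mem_set (And3 NF dF nb))).
Qed.

End EdgeBetween.

(** * The Legendre conjugate and its bends *)

Section Conjugate.
Variable R : realType.
Local Notation plane := 'rV[R]_2.
Local Notation vec := (vec R).
Variables (I : finType) (p : I -> 'I_3 -> R).
Implicit Types (P : plane) (w : 'I_3 -> R) (i : I) (k : 'I_3) (y z : lat).
Let n := #|I|.
Local Notation N := (arrangement_cells p).
Local Notation HN := (arrangement_lns p).
Local Notation edge := (inner_edges n N).
Local Notation cell := (cell p).

Lemma vec_cell y : deg y = n -> exists w, cell w (vec y).
Proof.
move=> dy; have : Delta n (vec y) by rewrite DeltaE => k; rewrite bar_vec.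
by rewrite -(arrangement_cover p) => -[_ [w _ <-]] h; exists w.
Qed.

(* The Legendre conjugate of [tropsum], at lattice points. *)
Definition conjugate y : R :=
  let w := xget (fun=> 0) [set w | cell w (vec y)] in pairing y w - tropsum p w.

Lemma conjugateE y w : deg y = n -> cell w (vec y) -> conjugate y = pairing y w - tropsum p w.
Proof.
move=> dy hw; rewrite /conjugate; set w' := xget _ _.
have hw' : cell w' (vec y) by apply: (@xgetPex _ (fun=> 0) [set w | cell w (vec y)]); exists w.
have := (dot_eq_trop w' hw).1 hw'; rewrite dotB -/n !dot_vec //; lra.
Qed.

Lemma conjugate_ge y w : deg y = n -> pairing y w - tropsum p w <= conjugate y.
Proof.
move=> dy; have [w' hw'] := vec_cell dy; rewrite (conjugateE dy hw').
by have := dot_le_trop w hw'; rewrite dotB -/n !dot_vec //; lra.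
Qed.

Lemma conjugate_eq y w : deg y = n -> conjugate y = pairing y w - tropsum p w -> cell w (vec y).
Proof.
move=> dy h; have [w' hw'] := vec_cell dy; apply/(dot_eq_trop w hw').
by move: h; rewrite (conjugateE dy hw') dotB -/n !dot_vec //; lra.
Qed.

Lemma conjugate_slope w z k l : (deg z + 1)%N = n ->
  cell w (vec (z + dl k)) -> cell w (vec (z + dl l)) ->
  conjugate (z + dl k) - conjugate (z + dl l) = w k - w l.
Proof.
move=> dz h1 h2; rewrite (conjugateE _ h1) ?(conjugateE _ h2) ?degD ?deg_dl //.
by rewrite !pairingD !pairing_dl; ring.
Qed.

(** The conjugate is at least the affine function [pairing y w - tropsum p w], with equality exactly
    on [cell w]. Three points of the rhombus are in this cell, so the bend is the excess at the
    fourth. *)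
Lemma rhombus_conjugate w y k l m : (deg y + 2)%N = n ->
  cell w (vec (y + dl k + dl k)) -> cell w (vec (y + dl k + dl l)) ->
  cell w (vec (y + dl k + dl m)) ->
  0 <= rhombus conjugate y k l m /\
  (rhombus conjugate y k l m = 0 <-> cell w (vec (y + dl l + dl m))).
Proof.
move=> dy h1 h2 h3.
have d c c' : deg (y + dl c + dl c') = n by rewrite !degD !deg_dl; lia.
rewrite /rhombus (conjugateE _ h1) // (conjugateE _ h2) // (conjugateE _ h3) //.
rewrite !pairingD !pairing_dl; split.
  by have := conjugate_ge w (d l m); rewrite !pairingD !pairing_dl; lra.
split=> [h|h].
  by apply: conjugate_eq => //; rewrite !pairingD !pairing_dl; lra.
by rewrite (conjugateE _ h) // !pairingD !pairing_dl; ring.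
Qed.

Lemma no_edge_flat y k l m : k != l -> k != m -> l != m -> (deg y + 2)%N = n ->
  (forall e : edge, ~ unit_in e y k l m) -> exists w,
  [/\ forall c, cell w (vec (y + dl k + dl c)) & cell w (vec (y + dl l + dl m))].
Proof.
move=> kl km lm dy ne.
have dyk : (deg (y + dl k)%R + 1)%N = n by rewrite degD deg_dl; lia.
have [w hw] := up_triangle_cell p dyk.
have [w' hw'] := down_triangle_cell p dy.
exists w; split => //; apply: contrapT => nlm.
have Nc v : N (cell v) by exists v.
have [e] := edge_between HN kl km lm dy (Nc w) (Nc w') hw hw' nlm; exact: ne.
Qed.

End Conjugate.

(** * Arrangements of the same type have the same full cells *)

Section CombinatorialType.
Variable R : realType.
Local Notation vec := (vec R).
Variable I : finType.
Implicit Types (x y : I -> R) (w : 'I_3 -> R) (i j k : I).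

Definition lines x y i (c : 'I_3) : R := if c == k0 then 0 else if c == k1 then x i else y i.

(* Whether the vertical line through the [i]-th centre passes left of, through or
   right of the point where the diagonal ray of the [k]-th line reaches the height
   of the [j]-th centre. *)
Definition same_type x y x' y' : Prop := forall i j k, y k <= y j ->
  Num.sg (x i - x k - (y j - y k)) = Num.sg (x' i - x' k - (y' j - y' k)).

Lemma same_type_y x y x' y' j k : same_type x y x' y' ->
  Num.sg (y j - y k) = Num.sg (y' j - y' k).
Proof.
move=> h; have [kj|jk] := leP (y k) (y j).
  by have := h k j k kj; rewrite !subrr !sub0r !sgrN => /oppr_inj.
by have := h j k j (ltW jk); rewrite !subrr !sub0r !opprB.
Qed.

Lemma sgr_le (a b : R) : Num.sg a = Num.sg b -> (a <= 0) = (b <= 0).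
Proof. by move=> h; rewrite -sgr_le0 h sgr_le0. Qed.

Lemma sgr_ge (a b : R) : Num.sg a = Num.sg b -> (0 <= a) = (0 <= b).
Proof. by move=> h; rewrite -sgr_ge0 h sgr_ge0. Qed.

Lemma same_typeC x y x' y' : same_type x y x' y' -> same_type x' y' x y.
Proof.
move=> h i j k kj; rewrite -h // -subr_ge0.
by rewrite (sgr_ge (same_type_y j k h)) subr_ge0.
Qed.

Lemma same_type_x x y x' y' i j : same_type x y x' y' ->
  Num.sg (x i - x j) = Num.sg (x' i - x' j).
Proof. by move=> h; have := h i j j (lexx _); rewrite !subrr !subr0. Qed.

Lemma same_type_diag x y x' y' j k : same_type x y x' y' ->
  Num.sg (x j - y j - (x k - y k)) = Num.sg (x' j - y' j - (x' k - y' k)).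
Proof.
move=> h; have [kj|jk] := leP (y k) (y j).
  have := h j j k kj; rewrite (_ : x j - x k - _ = x j - y j - (x k - y k)); last by ring.
  by rewrite (_ : x' j - x' k - _ = x' j - y' j - (x' k - y' k)); last by ring.
have := h k k j (ltW jk); rewrite (_ : x k - x j - _ = - (x j - y j - (x k - y k))); last by ring.
rewrite (_ : x' k - x' j - _ = - (x' j - y' j - (x' k - y' k))); last by ring.
by rewrite !sgrN => /oppr_inj.
Qed.

Lemma amax_lines x y i w : let s := w k1 - w k0 - x i in let t := w k2 - w k0 - y i in
  [/\ amax (lines x y) i w k0 = (s <= 0) && (t <= 0),
      amax (lines x y) i w k1 = (0 <= s) && (0 <= s - t)
    & amax (lines x y) i w k2 = (0 <= t) && (s - t <= 0)].
Proof.
move=> s t; rewrite /amax !I3_all /lines /s /t /=; split.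
- by rewrite lexx /=; congr (_ && _); apply/idP/idP; lra.
- by rewrite lexx /=; congr (_ && _); apply/idP/idP; lra.
- by rewrite lexx andbT; congr (_ && _); apply/idP/idP; lra.
Qed.

Definition pos (X Y : R) (c : 'I_3) : R := if c == k0 then 0 else if c == k1 then X else Y.

Lemma amax_transfer x y x' y' i w X' Y' :
  let X := w k1 - w k0 in let Y := w k2 - w k0 in
  Num.sg (X - x i) = Num.sg (X' - x' i) -> Num.sg (Y - y i) = Num.sg (Y' - y' i) ->
  (y i <= Y -> Num.sg (X - x i - (Y - y i)) = Num.sg (X' - x' i - (Y' - y' i))) ->
  forall c, amax (lines x y) i w c = amax (lines x' y') i (pos X' Y') c.
Proof.
move=> X Y hs ht hst; have [a0 a1 a2] := amax_lines x y i w.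
have [b0 b1 b2] := amax_lines x' y' i (pos X' Y').
have E1 : pos X' Y' k1 - pos X' Y' k0 = X' by rewrite /pos /= subr0.
have E2 : pos X' Y' k2 - pos X' Y' k0 = Y' by rewrite /pos /= subr0.
rewrite -/X -/Y in a0 a1 a2; rewrite E1 E2 in b0 b1 b2.
have [iY|Yi] := leP (y i) Y.
  by elim/I3P; rewrite ?a0 ?a1 ?a2 ?b0 ?b1 ?b2 ?(sgr_le hs) ?(sgr_ge hs)
    ?(sgr_le ht) ?(sgr_ge ht) ?(sgr_le (hst iY)) ?(sgr_ge (hst iY)).
have t0 : Y - y i < 0 by rewrite subr_lt0.
have t0' : Y' - y' i < 0 by rewrite -sgr_lt0 -ht sgr_lt0.
elim/I3P; rewrite ?a0 ?a1 ?a2 ?b0 ?b1 ?b2.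
- by rewrite (sgr_le hs) (sgr_le ht).
- have := sgr_ge hs; case: (leP 0 (X - x i)) => h1; case: (leP 0 (X' - x' i)) => // h2 _.
  have -> : 0 <= X - x i - (Y - y i) by lra.
  by have -> : 0 <= X' - x' i - (Y' - y' i) by lra.
- by rewrite (leNgt 0) t0 (leNgt 0) t0'.
Qed.

(** If no coordinate is constant on the cell, then [w] lies on rays of two different directions and
    is the intersection of lines through one or two centres. The same intersection in the other
    arrangement serves as [w'], and the type decides its position relative to all centres. *)
Lemma full_transfer x y x' y' w : same_type x y x' y' ->
  (forall c, lo (lines x y) w c < hi (lines x y) w c)%N ->
  exists w', forall i c, amax (lines x y) i w c = amax (lines x' y') i w' c.
Proof.
move=> h full; pose X := w k1 - w k0; pose Y := w k2 - w k0.
have pair c := full_pair (full c).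
have V i : amax (lines x y) i w k0 -> amax (lines x y) i w k1 -> X = x i /\ Y <= y i.
  have [-> -> _] := amax_lines x y i w; rewrite -/X -/Y; by move=> *; split; lra.
have H i : amax (lines x y) i w k0 -> amax (lines x y) i w k2 -> Y = y i /\ X <= x i.
  have [-> _ ->] := amax_lines x y i w; rewrite -/X -/Y; by move=> *; split; lra.
have D i : amax (lines x y) i w k1 -> amax (lines x y) i w k2 -> X - x i = Y - y i /\ y i <= Y.
  have [_ -> ->] := amax_lines x y i w; rewrite -/X -/Y; by move=> *; split; lra.
have cases : [\/ (exists i j, X = x i /\ Y = y j),
    (exists i k, [/\ X = x i, X - x k = Y - y k & y k <= Y])
  | (exists j k, [/\ Y = y j, X - x k = Y - y k & y k <= Y])].
  have [i0 [l0 [n0 a0 b0]]] := pair k0; have [i1 [l1 [n1 a1 b1]]] := pair k1.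
  have [i2 [l2 [n2 a2 b2]]] := pair k2.
  elim/I3P: l0 n0 b0 => // _ b0.
    have [e0 _] := V _ a0 b0; elim/I3P: l2 n2 b2 => // _ b2.
      by have [e2 _] := H _ b2 a2; constructor 1; exists i0, i2.
    by have [e2 ?] := D _ b2 a2; constructor 2; exists i0, i2.
  have [e0 _] := H _ a0 b0; elim/I3P: l1 n1 b1 => // _ b1.
    by have [e1 _] := V _ b1 a1; constructor 1; exists i1, i0.
  by have [e1 ?] := D _ a1 b1; constructor 3; exists i0, i1.
case: cases => [[i [j [eX eY]]]|[i [k [eX eD kY]]]|[j [k [eY eD kY]]]].
- exists (pos (x' i) (y' j)) => m c; apply: amax_transfer; rewrite -/X -/Y ?eX ?eY.
  + exact: (same_type_x _ _ h).
  + exact: (same_type_y _ _ h).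
  + exact: h.
- have eY : Y = x i - x k + y k by rewrite -eX; lra.
  have eki : x k <= x i by rewrite -eX; lra.
  have eki' : x' k <= x' i.
    by rewrite -subr_ge0 -(sgr_ge (same_type_x i k h)) subr_ge0.
  exists (pos (x' i) (x' i - x' k + y' k)) => m c; apply: amax_transfer; rewrite -/X -/Y ?eX ?eY.
  + exact: (same_type_x _ _ h).
  + have [km|mk] := leP (y k) (y m).
      have := h i m k km.
      rewrite (_ : x i - x k + y k - y m = x i - x k - (y m - y k)); last by ring.
      by rewrite (_ : x' i - x' k + y' k - y' m = x' i - x' k - (y' m - y' k)); last by ring.
    have mk' : y' m < y' k.
      by rewrite -subr_gt0 -sgr_gt0 -(same_type_y k m h) sgr_gt0 subr_gt0.
    by rewrite !gtr0_sg //; lra.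
  + move=> _.
    rewrite (_ : x i - x m - _ = x k - y k - (x m - y m)); last by ring.
    rewrite (_ : x' i - x' m - _ = x' k - y' k - (x' m - y' m)); last by ring.
    exact: (same_type_diag _ _ h).
- have eX : X = x k + (y j - y k) by rewrite -eY; lra.
  exists (pos (x' k + (y' j - y' k)) (y' j)) => m c; apply: amax_transfer; rewrite -/X -/Y ?eX ?eY.
  + have := h m j k; rewrite -eY => /(_ kY); rewrite eY.
    rewrite (_ : x k + (y j - y k) - x m = - (x m - x k - (y j - y k))); last by ring.
    rewrite (_ : x' k + (y' j - y' k) - x' m = - (x' m - x' k - (y' j - y' k))); last by ring.
    by rewrite !sgrN => ->.
  + exact: (same_type_y _ _ h).
  + move=> _.
    rewrite (_ : x k + _ - x m - _ = x k - y k - (x m - y m)); last by ring.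
    rewrite (_ : x' k + _ - x' m - _ = x' k - y' k - (x' m - y' m)); last by ring.
    exact: (same_type_diag _ _ h).
Qed.

Lemma amax_eq_cell (p p' : I -> 'I_3 -> R) w w' : (forall i c, amax p i w c = amax p' i w' c) ->
  cell p w = cell p' w'.
Proof.
move=> h; rewrite /cell /lo /hi /aonly; congr hexagon; apply/funext => c; congr Posz;
apply: eq_bigr => i _; rewrite h //; congr (nat_of_bool (_ && _)).
by apply: eq_forallb => l; rewrite h.
Qed.

Lemma full_cell_transfer x y x' y' w : same_type x y x' y' ->
  (forall c, lo (lines x y) w c < hi (lines x y) w c)%N ->
  exists w', cell (lines x y) w = cell (lines x' y') w'.
Proof.
by move=> h full; have [w' hw'] := full_transfer h full; exists w'; exact: amax_eq_cell.
Qed.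

(** The conjugate of the second arrangement bends only across edges of the first subdivision, and
    strictly there: both facts concern cells containing a unit triangle, which the arrangements
    share. [potential_closed] turns the bends into a metric. *)
Lemma metric_transfer x y x' y' : same_type x y x' y' ->
  let n := #|I| in let N := arrangement_cells (lines x y) in
  exists d : inner_edges n N -> R^o, exact_metric d /\
    forall (e : inner_edges n N) z (k l m : 'I_3), k != l -> k != m -> l != m ->
      (deg z + 2)%N = n -> unit_in e z k l m ->
      d e = rhombus (conjugate (lines x' y')) z k l m.
Proof.
move=> h n N; have HN : linear_newton_subdivision n N := arrangement_lns (lines x y).
have degs z (k l : 'I_3) : (deg z + 2)%N = n -> deg (z + dl k + dl l) = n.
  by rewrite !degD !deg_dl; lia.
have flat z (k l m : 'I_3) : k != l -> k != m -> l != m -> (deg z + 2)%N = n ->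
    (forall e : inner_edges n N, ~ unit_in e z k l m) ->
    rhombus (conjugate (lines x' y')) z k l m = 0.
  move=> kl km lm dz ne; have [w [hw hlm]] := no_edge_flat kl km lm dz ne.
  have dzk : (deg (z + dl k)%R + 1)%N = n by rewrite degD deg_dl; lia.
  have [w' ww'] := full_cell_transfer h (full_triangle dzk hw).
  rewrite ww' in hw hlm.
  by apply: (rhombus_conjugate dz (hw k) (hw l) (hw m)).2.2.
have [d [cd hd]] := potential_closed HN flat.
exists d; split => //; split => // e.
have [u [a [b [c [len [[ab ac bc] du h1 _]]]]]] := edge_lattice HN e.
have he := h1 0%N len (add0n _).
set z := u + dl a *+ 0 + dl b *+ len in he.
have dz : (deg z + 2)%N = n.
  by rewrite -du /z mulr0n addr0 degD /deg !mulE; elim/I3P: (b) => /=; lia.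
have ca : c != a by rewrite eq_sym.
have cb : c != b by rewrite eq_sym.
rewrite (hd e z c a b) //.
have dzc : (deg (z + dl c)%R + 1)%N = n by rewrite degD deg_dl; lia.
have [w' hw'] := up_triangle_cell (lines x' y') dzc.
have [ge0 eq0] := rhombus_conjugate dz (hw' c) (hw' a) (hw' b).
rewrite lt_neqAle ge0 andbT eq_sym; apply/eqP => /eq0 hab.
have [w ww'] := full_cell_transfer (same_typeC h) (full_triangle dzc hw').
rewrite ww' in hw' hab.
have NC : N (cell (lines x y) w) by exists w.
exact: (flat_rhombus HN ca cb ab NC (hw' c) hab he).
Qed.

End CombinatorialType.

(** * Linear isomorphisms *)

Section LinearIsomorphism.
Variable R : realType.

Section Combination.
Variables (U : lmodType R) (m k : nat) (X : k.-tuple 'rV[R]_m) (a : 'I_k -> U).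

Definition combination (v : 'rV[R]_m) : U := \sum_i coord X i v *: a i.

Fact combination_is_linear : linear combination.
Proof.
move=> c u v; rewrite /combination scaler_sumr -big_split /=; apply: eq_bigr => i _.
by rewrite linearP scalerDl scalerA.
Qed.
HB.instance Definition _ :=
  GRing.isLinear.Build R 'rV[R]_m U _ combination combination_is_linear.
End Combination.

Section Evaluation.
Variables (T : Type) (m : nat) (x : 'I_m -> T).

Definition evaluation (d : T -> R^o) : 'rV[R]_m := \row_j d (x j).

Fact evaluation_is_linear : linear evaluation.
Proof. by move=> c u v; apply/rowP => j; rewrite !mxE. Qed.
HB.instance Definition _ :=
  GRing.isLinear.Build R (T -> R^o) 'rV[R]_m _ evaluation evaluation_is_linear.
End Evaluation.

Lemma maximal_free m (B : set 'rV[R]_m) : exists k (X : k.-tuple 'rV[R]_m),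
  [/\ free X, forall i, B (tnth X i) & forall b, B b -> b \in <<X>>%VS].
Proof.
pose P k := `[< exists X : k.-tuple 'rV[R]_m, free X /\ forall i, B (tnth X i) >].
have exP : exists k, P k.
  exists 0%N; apply/asboolP; exists [tuple]; split; first by rewrite nil_free.
  by case.
have ubP k : P k -> (k <= m)%N.
  move=> /asboolP[X [fX _]]; move: fX; rewrite /free size_tuple => /eqP <-.
  by apply: leq_trans (dimvS (subvf _)) _; rewrite dimvf dim_matrix [(1 * m)%R]mul1r.
case: (ex_maxnP exP ubP) => k /asboolP[X [fX BX]] kmax.
exists k, X; split => // b Bb; apply: contrapT => /negP bX.
have /kmax : P k.+1.
  apply/asboolP; exists [tuple of b :: X]; split; first by rewrite free_cons bX.
  by move=> i; case: (unliftP ord0 i) => [j|] ->; rewrite ?tnthS ?tnth0.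
by rewrite ltnn.
Qed.

Lemma linearly_isomorphic_image (U : lmodType R) m (f : {linear U -> 'rV[R]_m})
    (Z : set U) (A : set U) : Z 0 -> (forall c u v, Z u -> Z v -> Z (c *: u + v)) ->
  A `<=` Z -> (forall u, Z u -> f u = 0 -> u = 0) ->
  linearly_isomorphic A (f @` A).
Proof.
move=> Z0 ZP AZ inj; have [k [X [fX BX spanX]]] := maximal_free (f @` A).
have [a ha] := choice (fun i => let: ex_intro2 u Au e := BX i in
  ex_intro (fun u => A u /\ f u = tnth X i) u (conj Au e)).
have ZB u v : Z u -> Z v -> Z (u - v).
  by move=> Zu Zv; rewrite addrC -scaleN1r; exact: ZP.
have Zc v : Z (combination X a v).
  apply: (big_ind Z) => //; first by move=> u w Zu Zw; have := ZP 1 u w Zu Zw; rewrite scale1r.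
  move=> i _; have := ZP (coord X i v) (a i) 0 (AZ _ (ha i).1) Z0; by rewrite addr0.
have fc v : v \in <<X>>%VS -> f (combination X a v) = v.
  move=> vX; rewrite [RHS](coord_span vX) linear_sum; apply: eq_bigr => i _.
  by rewrite linearZ (ha i).2 (tnth_nth 0).
have gK u : A u -> combination X a (f u) = u.
  move=> Au; apply/eqP; rewrite -subr_eq0; apply/eqP; apply: inj.
    by apply: ZB; [exact: Zc|exact: AZ].
  by rewrite linearB fc ?subrr //; apply: spanX; exists u.
exists f, (combination X a); split; last by move=> u /set_mem /gK.
split; first by move=> u Au; exists u.
  by move=> u v /set_mem Au /set_mem Av e; rewrite -(gK u Au) -(gK v Av) e.
by [].
Qed.

Lemma linearly_isomorphic_trans (U V W : lmodType R) (A : set U) (B : set V) (C : set W) :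
  linearly_isomorphic A B -> linearly_isomorphic B C -> linearly_isomorphic A C.
Proof.
move=> [f [g [bf fg]]] [f' [g' [bf' fg']]].
exists (f' \o f), (g \o g'); split; first exact: set_bij_comp bf bf'.
move=> u /[dup] uA /set_mem Au /=; rewrite fg' ?fg //.
by apply: mem_set; have [h _ _] := bf; apply: h.
Qed.

Lemma linearly_isomorphic0 (U V : lmodType R) :
  linearly_isomorphic (set0 : set U) (set0 : set V).
Proof.
exists \0, \0; split; last by move=> u /set_mem.
split => //; first by move=> u v /set_mem.
Qed.

End LinearIsomorphism.

(** * Arrangements with prescribed relations *)

Section Configuration.
Variable R : realType.
Variables (L G : nat) (ga gb gc gd : nat -> nat).
Hypothesis gad : forall g, (g < G)%N ->
  [/\ (ga g < gb g)%N, (ga g < gc g)%N, (gc g < gd g)%N, (gb g <= L)%N & (gd g <= L)%N].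
Implicit Types (s : nat -> R).

Definition valid s : Prop :=
  (forall i, (i < L)%N -> s i < s i.+1) /\
  forall g, (g < G)%N -> s (gb g) - s (ga g) = s (gd g) - s (gc g).

(** The strip of a gadget is as high as the distance from the column [ga] to the last column, so the
    diagonal from its centre in that column meets the floor above exactly on the last vertical
    line. *)
Fixpoint floor_height s g : R :=
  if g is g'.+1 then floor_height s g' - (s L - s (ga g')) else 0.

(* Row [2g] is the floor of the gadget [g - 1], row [2g + 1] the horizontal ray
   inside the gadget [g]; rows are numbered from the top. *)
Definition row_height s r : R :=
  if odd r then floor_height s (r./2).+1 + (s (gd r./2) - s (gc r./2))
  else floor_height s r./2.

(* The line [t] has its centre in the column [t] of the top row.  The gadget [g]
   has the centres [(a, 2g+2)], [(c, 2g+2)], [(d, 2g+1)], [(b, 2g+1)] and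
   [(L, 2g+2)], as (column, row): the diagonals through the first and the fourth
   and through the second and the third force [b - a = d - c]. *)
Definition centre : finType := ('I_L.+1 + 'I_G * 'I_5)%type.
Implicit Types (i k : centre).

Definition col i : nat := match i with
  | inl t => t
  | inr (g, r) => nth L [:: ga g; gc g; gd g; gb g] r
  end.

Definition row i : nat := match i with
  | inl _ => 0
  | inr (g, r) => if (r == 2 :> nat) || (r == 3 :> nat) then g.*2.+1 else g.*2.+2
  end.

Definition cx s i : R := s (col i).
Definition cy s i : R := row_height s (row i).

Lemma row_even s g : row_height s g.*2 = floor_height s g.
Proof. by rewrite /row_height odd_double doubleK. Qed.

Lemma row_odd s g : row_height s g.*2.+1 = floor_height s g.+1 + (s (gd g) - s (gc g)).
Proof. by rewrite /row_height /= odd_double /= uphalf_double. Qed.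

Lemma col_le i : (col i <= L)%N.
Proof.
case: i => [t|[g [[|[|[|[|[|//]]]]] ri]]]; first by rewrite /= -ltnS.
all: by have := gad (ltn_ord g); rewrite /= => -[? ? ? ? ?]; lia.
Qed.

Lemma row_le i : (row i <= G.*2)%N.
Proof. by case: i => [t|[g r]] //=; have := ltn_ord g; case: ifP => _; lia. Qed.

Section Valid.
Variable s : nat -> R.
Hypothesis hs : valid s.

Lemma valid_lt (i j : nat) : (i < j)%N -> (j <= L)%N -> s i < s j.
Proof.
elim: j => // j ih; rewrite ltnS leq_eqVlt => /orP[/eqP ->|ij] jL; first exact: hs.1.
by apply: lt_trans (ih ij (ltnW jL)) _; exact: hs.1.
Qed.

Lemma valid_le (i j : nat) : (i <= j)%N -> (j <= L)%N -> s i <= s j.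
Proof.
by rewrite leq_eqVlt => /orP[/eqP -> //|ij] jL; apply/ltW/valid_lt.
Qed.

Lemma row_step r : (r < G.*2)%N -> row_height s r.+1 < row_height s r.
Proof.
rewrite -[r]odd_double_half; case: (odd r); rewrite /= ?add0n ?add1n => rG.
  have gG : (r./2 < G)%N by lia.
  have [? ? cd ? dL] := gad gG; have -> : r./2.*2.+2 = (r./2.+1).*2 by [].
  by rewrite row_even row_odd ltrDl subr_gt0 valid_lt.
have gG : (r./2 < G)%N by lia.
have [ab ac cd bL dL] := gad gG; rewrite row_odd row_even /=.
have e := hs.2 _ gG; have h1 := valid_lt ac (leq_trans (ltnW cd) dL).
have h2 := valid_le dL (leqnn L); lra.
Qed.

Lemma row_lt r r' : (r < r')%N -> (r' <= G.*2)%N -> row_height s r' < row_height s r.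
Proof.
elim: r' => // r' ih; rewrite ltnS leq_eqVlt => /orP[/eqP <-|rr] rG; first exact: row_step.
by apply: lt_trans (ih rr (ltnW rG)); exact: row_step.
Qed.

Lemma row_leE i (j : centre) : (cy s i <= cy s j) = (row j <= row i)%N.
Proof.
rewrite /cy; have [h|h] := leqP (row j) (row i).
  move: h; rewrite leq_eqVlt => /orP[/eqP ->|h]; first by rewrite lexx.
  by apply/ltW/row_lt => //; exact: row_le.
by apply/negbTE; rewrite -ltNge; apply: row_lt => //; exact: row_le.
Qed.

(* The diagonal ray of a centre of the gadget [g] leaves the strip of the gadget
   on the last vertical line or to its right. *)
Definition diag_gap g k : R := cx s k - cy s k - (s L - floor_height s g).

Lemma far_diag i (j : centre) k g : cx s i - cx s k - (cy s j - cy s k) =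
  - (s L - cx s i) - (cy s j - floor_height s g) - diag_gap g k.
Proof. by rewrite /diag_gap; ring. Qed.

Lemma diag_gapE (g : 'I_G) (r : 'I_5) : diag_gap g (inr (g, r)) =
  nth (s L - s (ga g)) [:: 0; s (gc g) - s (ga g); s (gc g) - s (ga g); 0] r.
Proof.
have e := hs.2 _ (ltn_ord g); have floorE := row_even s g.+1; rewrite doubleS in floorE.
rewrite /diag_gap /cx /cy; case: r => -[|[|[|[|[|//]]]]] ri /=;
  rewrite ?floorE ?row_odd /=; lra.
Qed.

End Valid.

Definition determined (f : (nat -> R) -> R) : Prop :=
  exists v, forall s, valid s -> Num.sg (f s) = v.

Lemma determined_ext (f g : (nat -> R) -> R) : (forall s, valid s -> f s = g s) ->
  determined g -> determined f.
Proof. by move=> fg [v hv]; exists v => s hs; rewrite fg ?hv. Qed.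

Lemma determined_sub (i j : nat) : (i <= L)%N -> (j <= L)%N -> determined (fun s => s i - s j).
Proof.
move=> iL jL; have [ij|ji|->] := ltngtP i j.
- by exists (-1) => s hs; rewrite ltr0_sg // subr_lt0 valid_lt.
- by exists 1 => s hs; rewrite gtr0_sg // subr_gt0 valid_lt.
- by exists 0 => s hs; rewrite subrr sgr0.
Qed.

Lemma determined_opp3 (f g h : (nat -> R) -> R) :
  determined f -> determined g -> determined h ->
  (forall s, valid s -> 0 <= f s) -> (forall s, valid s -> 0 <= g s) ->
  (forall s, valid s -> 0 <= h s) -> determined (fun s => - f s - g s - h s).
Proof.
move=> [a ha] [b hb] [c hc] f0 g0 h0; exists (- Num.max a (Num.max b c)) => s hs.
have := f0 s hs; have := g0 s hs; have := h0 s hs.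
rewrite -(ha s hs) -(hb s hs) -(hc s hs).
have sgE (x : R) : 0 <= x -> Num.sg x = if (0 < x)%R then 1 else 0.
  by rewrite le_eqVlt => /orP[/eqP <-|x0]; rewrite ?sgr0 ?ltxx ?gtr0_sg ?x0.
move=> h' g' f'; rewrite (sgE _ h') (sgE _ g') (sgE _ f').
have [fp|fn] := ltP 0 (f s); have [gp|gn] := ltP 0 (g s); have [hp|hn] := ltP 0 (h s);
  rewrite /= ?maxxx ?(max_l ler01) ?(max_r ler01) ?maxxx;
  try (by rewrite ltr0_sg //; lra).
by rewrite (_ : - f s - g s - h s = 0) ?sgr0 ?oppr0 //; lra.
Qed.

(** If [j] is on or above the ceiling of the strip of [k], [far_diag] writes the quantity as minus a
    sum of three nonnegative terms of fixed sign. Otherwise, unless the rows agree, [j] is on the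
    inner row and [k] on the floor of one gadget; the diagonal of [k] meets that row in column [gb]
    or [gd], or beyond the last one. *)
Lemma centre_sign i (j : centre) k : (row j <= row k)%N ->
  determined (fun s => cx s i - cx s k - (cy s j - cy s k)).
Proof.
rewrite leq_eqVlt => /orP[/eqP jk|jk].
  apply: (@determined_ext _ (fun s => s (col i) - s (col k))).
    by move=> s _; rewrite /cy jk subrr subr0.
  by apply: determined_sub; exact: col_le.
case: k jk => [t|[g r]]; first by rewrite ltn0.
move=> jk; have [ab ac cd bL dL] := gad (ltn_ord g).
have [far|near] := leqP (row j) g.*2.
  apply: (determined_ext (fun s _ => far_diag s i j (inr (g, r)) g)).
  apply: determined_opp3.
  - by apply: determined_sub => //; exact: col_le.
  - have [jg|jg] := eqVneq (row j) g.*2.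
      by exists 0 => s hs; rewrite /cy jg row_even subrr sgr0.
    exists 1 => s hs; rewrite gtr0_sg // subr_gt0 -row_even; apply: row_lt => //.
      by rewrite ltn_neqAle jg.
    by have := ltn_ord g; lia.
  - apply: (determined_ext (fun s hs => diag_gapE hs g r)).
    case: r jk => -[|[|[|[|[|//]]]]] ri jk /=; try (by exists 0 => s _; rewrite sgr0);
    by apply: determined_sub; lia.
  - by move=> s hs; rewrite subr_ge0; apply: valid_le => //; exact: col_le.
  - move=> s hs; rewrite subr_ge0 -row_even /cy; move: far; rewrite leq_eqVlt => /orP[/eqP ->//|jg].
    by apply/ltW/row_lt => //; have := ltn_ord g; lia.
  - move=> s hs; rewrite diag_gapE //.
    by case: r {jk} => -[|[|[|[|[|//]]]]] ri /=; rewrite ?lexx // subr_ge0; apply: valid_le => //; lia.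
have jr : row j = g.*2.+1 by move: jk near; rewrite /=; case: ifP => _; lia.
have yj s : cy s j = floor_height s g.+1 + (s (gd g) - s (gc g)) by rewrite /cy jr row_odd.
have yk s : cy s (inr (g, r)) = floor_height s g.+1.
  by move: jk; rewrite /cy jr /=; case: ifP => _; [lia|move=> _; exact: (row_even s g.+1)].
have low : determined (fun s => s (col i) - s L - (s (gd g) - s (gc g))).
  exists (-1) => s hs; rewrite ltr0_sg //.
  by have := valid_le hs (col_le i) (leqnn _); have := valid_lt hs cd dL; lra.
case: r jk yk => -[|[|[|[|[|//]]]]] ri /= jk yk; try (by move: jk; rewrite jr; lia).
- apply: (@determined_ext _ (fun s => s (col i) - s (gb g))).
    by move=> s hs; rewrite yj yk /cx /=; have := hs.2 _ (ltn_ord g); lra.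
  by apply: determined_sub => //; exact: col_le.
- apply: (@determined_ext _ (fun s => s (col i) - s (gd g))).
    by move=> s hs; rewrite yj yk /cx /=; lra.
  by apply: determined_sub => //; exact: col_le.
- by apply: determined_ext low => s hs; rewrite yj yk /cx /=; ring.
Qed.

Lemma valid_same_type s s' : valid s -> valid s' -> same_type (cx s) (cy s) (cx s') (cy s').
Proof.
move=> hs hs' i j k; rewrite row_leE // => /(centre_sign i)[v hv].
by rewrite !hv.
Qed.

(** Diagonals of gadgets reach the top row at the last column or to its right; at the centres of the
    top row all gadget lines therefore have [k2] maximal. *)
Lemma low_diag s i (t : 'I_L.+1) g r : valid s ->
  cx s i - cx s (inr (g, r)) - (cy s (inl t) - cy s (inr (g, r))) <= 0.
Proof.
move=> hs; rewrite (far_diag s i _ _ g) diag_gapE //.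
have [ab ac cd bL dL] := gad (ltn_ord g).
have h1 := valid_le hs (col_le i) (leqnn _).
have h2 : floor_height s g <= cy s (inl t).
  rewrite -row_even /cy /=; case: (posnP g) => [-> //|g0].
  by apply/ltW/row_lt => //; have := ltn_ord g; lia.
have h3 : 0 <= nth (s L - s (ga g)) [:: 0; s (gc g) - s (ga g); s (gc g) - s (ga g); 0] r.
  by case: r => -[|[|[|[|[|//]]]]] ri /=; rewrite ?lexx // subr_ge0; apply: valid_le => //; lia.
by rewrite /cx in h1 *; lra.
Qed.

Local Notation vec := (vec R).
Local Notation p s := (lines (cx s) (cy s)).
Let n := #|centre|.

Definition top (t : nat) : centre := inl (inord t).

Lemma col_top t : (t <= L)%N -> col (top t) = t.
Proof. by move=> tL; rewrite /= inordK. Qed.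

Lemma cy_top s t : cy s (inl t) = 0.
Proof. by []. Qed.

Lemma cy_gadget s g r : valid s -> cy s (inr (g, r)) < 0.
Proof.
move=> hs; rewrite -(cy_top s ord0); apply: row_lt => //; last exact: row_le.
by rewrite /=; case: ifP => _; lia.
Qed.

Lemma amax_self s i c : amax (p s) i (p s i) c.
Proof. by apply/forallP => m; rewrite !subrr. Qed.

Lemma amax_at_top s i (t : 'I_L.+1) : let d := cx s (inl t) - cx s i in
  [/\ amax (p s) i (p s (inl t)) k0 = (d <= 0) && (0 <= cy s i),
     amax (p s) i (p s (inl t)) k1 = (0 <= d) && (0 <= d + cy s i)
   & amax (p s) i (p s (inl t)) k2 = (cy s i <= 0) && (d + cy s i <= 0)].
Proof.
have [-> -> ->] := amax_lines (cx s) (cy s) i (p s (inl t)).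
rewrite /lines /= cy_top !subr0 !sub0r.
by rewrite oppr_le0 oppr_ge0 opprK.
Qed.

(* The corners chosen by the lines along the segment of the top horizontal line
   between the columns [j] and [j + 1]. *)
Definition top_choice (j : nat) (i : centre) : 'I_3 := match i with
  | inl t => if (t <= j)%N then k1 else k0
  | inr _ => k2
  end.

(** Base point of the unit rhombus across the edge dual to that segment: the two lines centred at
    the ends of the segment are left out. *)
Definition top_base (j : nat) : lat :=
  [ffun c => \sum_(i | (i != top j) && (i != top j.+1)) (top_choice j i == c : nat)]%N.

Lemma top_neq j : (j < L)%N -> top j.+1 != top j.
Proof.
by move=> jL; apply/eqP => -[] /(congr1 val) /=; rewrite !inordK //; lia.
Qed.

Lemma top_base_right j : (j < L)%N -> count_but (top_choice j) (top j.+1) = top_base j + dl k1.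
Proof.
move=> jL; apply/ffunP => c; rewrite latDE dlE !ffunE.
rewrite (bigD1 (top j)) /=; last by rewrite eq_sym top_neq.
rewrite inordK ?leqnn; last by lia.
rewrite addnC [k1 == c]eq_sym; congr (_ + _)%N.
by apply: eq_bigl => i; rewrite andbC.
Qed.

Lemma top_base_left j : (j < L)%N ->
  count_but (upd (top_choice j) (top j.+1) k2) (top j) = top_base j + dl k2.
Proof.
move=> jL; apply/ffunP => c; rewrite latDE dlE !ffunE.
rewrite (bigD1 (top j.+1)) /=; last exact: top_neq.
rewrite /upd eqxx addnC [k2 == c]eq_sym; congr (_ + _)%N.
by apply: eq_bigr => i /andP[_ /negPf ->].
Qed.

Lemma deg_top_base j : (j < L)%N -> (deg (top_base j) + 2)%N = n.
Proof.
move=> jL; have := deg_count_but (top_choice j) (top j.+1).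
by rewrite top_base_right // degD deg_dl -/n; lia.
Qed.

Lemma top_choice_right s j i : valid s -> (j < L)%N ->
  amax (p s) i (p s (top j.+1)) (top_choice j i).
Proof.
move=> hs jL; have [a0 a1 a2] := amax_at_top s i (inord j.+1).
have cj : cx s (top j.+1) = s j.+1 by rewrite /cx col_top.
case: i a0 a1 a2 => [t|[g r]] a0 a1 a2 /=.
  case: leqP => tj.
    by rewrite a1 cy_top addr0 andbb cj /cx /= subr_ge0 valid_le //; lia.
  rewrite a0 cy_top lexx andbT cj /cx /=.
  by rewrite subr_le0 valid_le //; rewrite -ltnS.
rewrite a2 (ltW (cy_gadget g r hs)) /=.
by have := low_diag (top j.+1) (inord j.+1) g r hs; rewrite cy_top sub0r opprK.
Qed.

Lemma top_choice_left s j i : valid s -> (j < L)%N ->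
  amax (p s) i (p s (top j)) (upd (top_choice j) (top j.+1) k2 i).
Proof.
move=> hs jL; have [a0 a1 a2] := amax_at_top s i (inord j).
have cj : cx s (top j) = s j by rewrite /cx col_top // ltnW.
rewrite /upd; case: eqP => [ei|_].
  rewrite ei in a2 *; rewrite a2 cy_top addr0 cj /cx col_top // lexx /=.
  by rewrite subr_le0 valid_le.
case: i a0 a1 a2 => [t|[g r]] a0 a1 a2 /=.
  case: leqP => tj.
    by rewrite a1 cy_top addr0 andbb cj /cx /= subr_ge0 valid_le //; lia.
  rewrite a0 cy_top lexx andbT cj /cx /=.
  by rewrite subr_le0 valid_le //; [lia|rewrite -ltnS].
rewrite a2 (ltW (cy_gadget g r hs)) /=.
by have := low_diag (top j) (inord j) g r hs; rewrite cy_top sub0r opprK.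
Qed.

(** Each of the two slopes is read off in the cell at the corresponding end of the segment, and the
    bend is their difference. *)
Lemma top_rhombus s psi Q j : valid s -> (j < L)%N -> slopes_of (p s) psi Q ->
  rhombus psi (top_base j) k1 k0 k2 =
  Q (top j.+1) k1 - Q (top j.+1) k0 - (Q (top j) k1 - Q (top j) k0).
Proof.
move=> hs jL hQ; have dn := deg_top_base jL.
have mem1 c : cell (p s) (p s (top j.+1)) (vec (top_base j + dl k1 + dl c)).
  rewrite -top_base_right //; apply: cell_count_but; last exact: amax_self.
  by move=> i; exact: top_choice_right.
have mem2 c : cell (p s) (p s (top j)) (vec (top_base j + dl k2 + dl c)).
  rewrite -top_base_left //; apply: cell_count_but; last exact: amax_self.
  by move=> i; exact: top_choice_left.
have d c : (deg (top_base j + dl c)%R + 1)%N = n by rewrite degD deg_dl; lia.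
have S := amax_self s.
rewrite -(hQ _ _ _ _ _ (S _ k1) (S _ k0) (d k1) (mem1 k1) (mem1 k0)).
rewrite -(hQ _ _ _ _ _ (S _ k1) (S _ k0) (d k2) (mem2 k1) (mem2 k0)) /rhombus.
rewrite (addrAC _ (dl k2) (dl k1)) (addrAC _ (dl k2) (dl k0)); ring.
Qed.

Lemma conjugate_slopes s : slopes_of (p s) (conjugate (p s)) (p s).
Proof.
move=> w i k l z hk hl dz h1 h2; rewrite (conjugate_slope dz h1 h2).
by move/amaxP: hk; move/amaxP: hl; lra.
Qed.

Lemma top_rhombus_conjugate s j : valid s -> (j < L)%N ->
  rhombus (conjugate (p s)) (top_base j) k1 k0 k2 = s j.+1 - s j.
Proof.
move=> hs jL; rewrite (top_rhombus hs jL (@conjugate_slopes s)) /lines /=.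
by rewrite !subr0 /cx !col_top // ltnW.
Qed.

Section Base.
Variable s0 : nat -> R.
Hypothesis hs0 : valid s0.
Local Notation N := (arrangement_cells (p s0)).
Local Notation edge := (inner_edges n N).
Implicit Types (d : edge -> R^o) (e : edge).
Let HN : linear_newton_subdivision n N := arrangement_lns (p s0).

(** Without an edge the conjugate would be flat there, but its bend is the positive length of the
    segment. *)
Lemma top_edge j : (j < L)%N -> exists e : edge, unit_in e (top_base j) k1 k0 k2.
Proof.
move=> jL; apply: contrapT => ne.
have dn := deg_top_base jL.
have [w [hw h]] := @no_edge_flat R centre (p s0) (top_base j) k1 k0 k2 isT isT isT dn
  (fun e he => ne (ex_intro _ e he)).
have [_ [_ /(_ h)]] := rhombus_conjugate dn (hw k1) (hw k0) (hw k2).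
by rewrite top_rhombus_conjugate //; have := hs0.1 j jL; lra.
Qed.

(** Below the top row, this is what the fifth centre of the preceding gadget is for: the incidence
    that ties the heights of consecutive floors. *)
Lemma row_point g (gG : (g < G)%N) : exists i, col i = L /\ row i = g.*2.
Proof.
case: g gG => [|g] gG; first by exists (top L); rewrite col_top.
exists (inr (Ordinal (ltnW gG), @Ordinal 5 4 isT)) => //=.
Qed.

Section Slopes.
Variables (psi : lat -> R) (Q : centre -> 'I_3 -> R).
Hypothesis hQ : slopes_of (p s0) psi Q.
Let X i := Q i k1 - Q i k0.
Let Y i := Q i k2 - Q i k0.

Lemma slope_col (i j : centre) : col i = col j -> X i = X j.
Proof.
by move=> e; apply: (slopes_incident hQ); rewrite /lines /= /cx e.
Qed.

Lemma slope_row (i j : centre) : row i = row j -> Y i = Y j.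
Proof.
by move=> e; apply: (slopes_incident hQ); rewrite /lines /= /cy e.
Qed.

Lemma slope_diag (i j : centre) : cx s0 i - cy s0 i = cx s0 j - cy s0 j -> X i - Y i = X j - Y j.
Proof.
move=> e; have : Q i k1 - Q i k2 = Q j k1 - Q j k2.
  by apply: (slopes_incident hQ); rewrite /lines.
by rewrite /X /Y; lra.
Qed.

Lemma slope_top i : X i = X (top (col i)).
Proof. by apply: slope_col; rewrite col_top // col_le. Qed.

Definition gadget_point (g : 'I_G) (r : nat) : centre := inr (g, inord r).

(** Equal rows, columns and diagonals of the original centres give equal slopes. The diagonals of
    the points 0 and 3 and of 1 and 2 yield the first two relations; the diagonal from 0 to the last
    column on the floor above yields the third. *)
Lemma slope_gadget (g : 'I_G) :
  [/\ X (top (gb g)) - X (top (ga g)) = X (top (gd g)) - X (top (gc g)),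
      Y (gadget_point g 0) = Y (gadget_point g 2) + (X (top (ga g)) - X (top (gb g)))
    & forall i, col i = L -> row i = g.*2 ->
      X (top (ga g)) - Y (gadget_point g 0) = X (top L) - Y i].
Proof.
have e := hs0.2 _ (ltn_ord g); have fE := row_even s0 g.+1; rewrite doubleS in fE.
have c0 : col (gadget_point g 0) = ga g by rewrite /= inordK.
have c1 : col (gadget_point g 1) = gc g by rewrite /= inordK.
have c2 : col (gadget_point g 2) = gd g by rewrite /= inordK.
have c3 : col (gadget_point g 3) = gb g by rewrite /= inordK.
have r0 : row (gadget_point g 0) = g.*2.+2 by rewrite /= inordK.
have r1 : row (gadget_point g 1) = g.*2.+2 by rewrite /= inordK.
have r2 : row (gadget_point g 2) = g.*2.+1 by rewrite /= inordK.
have r3 : row (gadget_point g 3) = g.*2.+1 by rewrite /= inordK.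
have d03 : X (gadget_point g 0) - Y (gadget_point g 0) = X (gadget_point g 3) - Y (gadget_point g 3).
  by apply: slope_diag; rewrite /cx /cy c0 c3 r0 r3 fE row_odd; lra.
have d12 : X (gadget_point g 1) - Y (gadget_point g 1) = X (gadget_point g 2) - Y (gadget_point g 2).
  by apply: slope_diag; rewrite /cx /cy c1 c2 r1 r2 fE row_odd; lra.
have y01 : Y (gadget_point g 0) = Y (gadget_point g 1) by apply: slope_row; rewrite r0 r1.
have y23 : Y (gadget_point g 2) = Y (gadget_point g 3) by apply: slope_row; rewrite r2 r3.
have x0 := slope_top (gadget_point g 0); have x1 := slope_top (gadget_point g 1).
have x2 := slope_top (gadget_point g 2); have x3 := slope_top (gadget_point g 3).
rewrite c0 in x0; rewrite c1 in x1; rewrite c2 in x2; rewrite c3 in x3.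
split; first lra; first lra.
move=> i ci ri; rewrite -x0 -ci -slope_top; apply: slope_diag.
rewrite /cx /cy c0 r0 fE ci ri row_even /=; lra.
Qed.

Lemma slopes_valid : (forall j, (j < L)%N -> X (top j) < X (top j.+1)) ->
  valid (fun t => X (top t)).
Proof. by move=> h; split=> [|g gG]; [exact: h|have [] := slope_gadget (Ordinal gG)]. Qed.

(** If all columns coincide, the third relation of [slope_gadget] makes all floors coincide, by
    induction from the top row, and the second one the inner rows. *)
Lemma slopes_constant : (forall j, (j < L)%N -> X (top j) = X (top j.+1)) ->
  forall i (k l : 'I_3), Q i k - Q i l = pos (X (top 0)) (Y (top 0)) k - pos (X (top 0)) (Y (top 0)) l.
Proof.
move=> h.
have Xt t : (t <= L)%N -> X (top t) = X (top 0).
  by elim: t => // t ih tL; rewrite -h // ih // ltnW.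
have Xi i : X i = X (top 0) by rewrite slope_top Xt // col_le.
have Yg g : (g <= G)%N -> forall i, row i = g.*2 -> Y i = Y (top 0).
  elim: g => [|g ih] gG i ri; first exact: slope_row.
  have [_ _ hg] := slope_gadget (Ordinal gG).
  have [j [cj rj]] := row_point gG.
  have := hg j cj rj; rewrite (ih (ltnW gG) j rj).
  have [ab ac cd bL dL] := gad gG.
  rewrite /= !Xt //; last by lia.
  rewrite (slope_row (j := i)) => [|]; last by rewrite /= inordK.
  by move/addrI/oppr_inj.
have Yi i : Y i = Y (top 0).
  have [r0|r0] := eqVneq (odd (row i)) false.
    apply: (Yg (row i)./2); first by have := row_le i; lia.
    by rewrite -[LHS]odd_double_half r0.
  case: i r0 => [t|[g r]] //= r0.
  have [_ hy _] := slope_gadget g; have [ab ac cd bL dL] := gad (ltn_ord g).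
  have y0 : Y (gadget_point g 0) = Y (top 0) by apply: (Yg g.+1) => //; rewrite /= inordK.
  have y2 : Y (gadget_point g 2) = Y (inr (g, r)).
    apply: slope_row; rewrite /= inordK //=; move: r0; case: ifP => //= _.
    by rewrite odd_double.
  by move: hy; rewrite y0 y2 (Xt _ bL) (Xt (ga g)); [lra|lia].
move=> i k l; have := Xi i; have := Yi i.
by rewrite /pos; elim/I3P: k; elim/I3P: l => /=; rewrite /X /Y; lra.
Qed.

End Slopes.

Lemma vertex_sumP (c : R) d d' v :
  vertex_sum (c *: d + d') v = c *: vertex_sum d v + vertex_sum d' v.
Proof.
rewrite /vertex_sum !(fsumE HN) scaler_sumr -big_split /=; apply: eq_bigr => e _.
by case: ifP => _; rewrite ?scaler0 ?addr0 // scalerDl scalerA.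
Qed.

Lemma closed_metric0 : @closed_metric R n N 0.
Proof.
move=> v hv; rewrite /vertex_sum (fsumE HN) big1 // => e _.
by case: ifP => _ //; rewrite scale0r.
Qed.

Lemma closed_metricP (c : R) d d' :
  closed_metric d -> closed_metric d' -> closed_metric (c *: d + d').
Proof. by move=> h h' v hv; rewrite vertex_sumP h // h' // scaler0 addr0. Qed.

Lemma closed_metric_slopes d : closed_metric d -> exists psi Q,
  [/\ slopes_of (p s0) psi Q,
      forall y (k l m : 'I_3), k != l -> k != m -> l != m -> (deg y + 2)%N = n ->
        rhombus psi y k l m = edge_weight d y k l m
    & forall j e, (j < L)%N -> unit_in e (top_base j) k1 k0 k2 ->
        Q (top j.+1) k1 - Q (top j.+1) k0 - (Q (top j) k1 - Q (top j) k0) = d e].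
Proof.
move=> cd; have [psi hpsi] := closed_potential HN cd.
have flat y (k l m : 'I_3) : k != l -> k != m -> l != m -> (deg y + 2)%N = n ->
    (forall e : edge, ~ unit_in e y k l m) -> rhombus psi y k l m = 0.
  by move=> kl km lm dy ne; rewrite hpsi // edge_weight_out.
have [Q hQ] := slopes flat; exists psi, Q; split => // j e jL he.
rewrite -(top_rhombus hs0 jL hQ) hpsi //; last exact: deg_top_base.
exact: edge_weight_in.
Qed.

Lemma edge_unit e : exists y (k l m : 'I_3),
  [/\ [/\ k != l, k != m & l != m], (deg y + 2)%N = n & unit_in e y k l m].
Proof.
have [u [a [b [c [len [[ab ac bc] du h1 _]]]]]] := edge_lattice HN e.
exists (u + dl a *+ 0 + dl b *+ len), c, a, b; split.
- by split=> //; rewrite eq_sym.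
- by rewrite -du mulr0n addr0 degD /deg !mulE; elim/I3P: (b) => /=; lia.
- exact: (h1 0%N len (add0n _)).
Qed.

End Base.

Definition partial_sum (u : 'rV[R]_L) (t : nat) : R := \sum_(i < L | (i < t)%N) u 0 i.

Lemma partial_sumS u (j : 'I_L) : partial_sum u j.+1 = partial_sum u j + u 0 j.
Proof.
rewrite /partial_sum (bigD1 j) //= addrC; congr (_ + _).
apply: eq_bigl => i; rewrite ltnS leq_eqVlt -val_eqE.
by case: (ltngtP i j).
Qed.

Lemma valid_shift s s' (c : R) : (forall t, (t <= L)%N -> s' t = s t - c) -> valid s -> valid s'.
Proof.
move=> h [h1 h2]; split=> [i iL|g gG].
  by rewrite !h ?(ltnW iL) // ltrD2r; exact: h1.
have [ab ac cd bL dL] := gad gG; have := h2 g gG.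
by rewrite !h //; [lra|lia..].
Qed.

(** The isomorphism evaluates a metric on the [L] edges dual to the top segments. [metric_transfer]
    shows that every valid vector occurs, [slopes_valid] that no other does, and [slopes_constant]
    with [slopes_rigid] that a closed metric vanishing there is zero. *)
Lemma block_realization (u0 : 'rV[R]_L) : valid (partial_sum u0) ->
  exists (m : nat) (N : set (set 'rV[R]_2)),
    [/\ (0 < m)%N, linear_newton_subdivision m N
      & linearly_isomorphic (@realization_space R m N)
          [set u : 'rV[R]_L | valid (partial_sum u)]].
Proof.
set s0 := partial_sum u0 => hs0.
pose N := arrangement_cells (p s0); exists n, N.
have HN : linear_newton_subdivision n N := arrangement_lns (p s0).
split => //; first by rewrite /n; apply/card_gt0P; exists (top 0).
have [E hE] := choice (fun j : 'I_L => top_edge hs0 (ltn_ord j)).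
pose f := @evaluation R (inner_edges n N) L E.
have -> : [set u : 'rV[R]_L | valid (partial_sum u)] = f @` (@realization_space R n N).
  apply/seteqP; split => u.
    move=> hu; have [d [ed hd]] := metric_transfer (valid_same_type hs0 hu).
    exists d => //; apply/rowP => j; rewrite mxE.
    rewrite (hd _ _ k1 k0 k2 isT isT isT (deg_top_base (ltn_ord j)) (hE j)).
    by rewrite top_rhombus_conjugate // partial_sumS addrC addKr.
  move=> [d [d0 cd] <-]; have [psi [Q [hQ _ hX]]] := closed_metric_slopes hs0 cd.
  pose X i := Q i k1 - Q i k0.
  have hXf (j : 'I_L) : X (top j.+1) - X (top j) = f d 0 j.
    by rewrite mxE; apply: hX => //; exact: hE.
  (* The slopes determine the abscissae only up to translation, whereas partial sums start at
     zero. *)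
  apply: (@valid_shift (fun t => X (top t)) _ (X (top 0))).
    elim=> [|t ih] tL; first by rewrite subrr /partial_sum big1.
    rewrite (partial_sumS (f d) (Ordinal tL)) /= ih ?(ltnW tL) // -hXf /=; ring.
  apply: (slopes_valid hs0 hQ) => j jL; have := hXf (Ordinal jL); rewrite mxE /=.
  by have := d0 (E (Ordinal jL)); rewrite -/(X _) -/(X _) => h1 h2; rewrite -subr_gt0 h2.
apply: (@linearly_isomorphic_image R _ L f (@closed_metric R n N)).
- exact: closed_metric0.
- by move=> c u v; exact: closed_metricP.
- by move=> d [].
move=> d cd fd; have [psi [Q [hQ hpsi hX]]] := closed_metric_slopes hs0 cd.
have hc : forall j, (j < L)%N -> Q (top j) k1 - Q (top j) k0 = Q (top j.+1) k1 - Q (top j.+1) k0.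
  move=> j jL; have := hX j (E (Ordinal jL)) jL (hE (Ordinal jL)).
  have := congr1 (fun u : 'rV[R]_L => u 0 (Ordinal jL)) fd; rewrite !mxE => ->; lra.
have Qc := slopes_constant hs0 hQ hc.
apply/funext => e; have [y [k [l [m [[kl km lm] dy he]]]]] := edge_unit e.
by rewrite -(edge_weight_in HN d lm he) -hpsi // (slopes_rigid hQ Qc).
Qed.

End Configuration.

(** * Linear equations as words *)

Section Equations.
Variable R : realType.

Section Word.
Variables (M : nat) (eqs : seq (seq 'I_M * seq 'I_M)).
Hypothesis eqs_neq0 : forall e, e \in eqs -> (0 < size e.1)%N && (0 < size e.2)%N.

Definition solutions : set 'rV[R]_M :=
  [set z | (forall j, 0 < z 0 j) /\
     forall e, e \in eqs -> \sum_(j <- e.1) z 0 j = \sum_(j <- e.2) z 0 j].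

(* Every variable is listed once, and then both sides of every equation are
   spelled out with fresh copies of the variables. *)
Definition word : seq 'I_M := enum 'I_M ++ flatten [seq e.1 ++ e.2 | e <- eqs].
Definition prefix_len (r : nat) : nat :=
  size (enum 'I_M ++ flatten (take r [seq e.1 ++ e.2 | e <- eqs])).
Definition eqn (r : nat) : seq 'I_M * seq 'I_M := nth ([::], [::]) eqs r.
Local Notation L := (size word).

Definition letter (t : 'I_L) : 'I_M := tnth (in_tuple word) t.
(** Extends [letter] to all numbers so that the gadgets can be listed over [iota]; the default is
    not reached for positions inside the word. *)
Definition letter_nat (t : nat) : nat :=
  if insub t is Some t' then letter t' else 0.

(** The first family equates the gap at each later position with the gap of its variable in the
    initial list, where a variable stands at its own index. The second equates the total lengths of
    the two adjacent blocks of an equation; there the second and third columns coincide. *)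
Definition gadgets : seq (nat * nat * nat * nat) :=
  [seq (letter_nat t, (letter_nat t).+1, t, t.+1) | t <- iota M (L - M)] ++
  [seq (prefix_len r, prefix_len r + size (eqn r).1, prefix_len r + size (eqn r).1,
        prefix_len r + size (eqn r).1 + size (eqn r).2)%N | r <- iota 0 (size eqs)].
Local Notation gadget g := (nth (0, 0, 0, 0)%N gadgets g).
Let ga g := (gadget g).1.1.1.
Let gb g := (gadget g).1.1.2.
Let gc g := (gadget g).1.2.
Let gd g := (gadget g).2.

Lemma letter_natE (t : 'I_L) : letter_nat t = letter t.
Proof. by rewrite /letter_nat valK. Qed.

Lemma word_split r : (r < size eqs)%N -> exists pre post,
  word = pre ++ (eqn r).1 ++ (eqn r).2 ++ post /\ size pre = prefix_len r.
Proof.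
move=> rs; pose ws := [seq e.1 ++ e.2 | e <- eqs].
exists (enum 'I_M ++ flatten (take r ws)), (flatten (drop r.+1 ws)); split => //.
rewrite /word -/ws -[in LHS](cat_take_drop r ws) (drop_nth [::]) ?size_map //.
by rewrite (nth_map ([::], [::])) // flatten_cat /= -!catA.
Qed.

Lemma M_le_L : (M <= L)%N.
Proof. by rewrite /word size_cat size_enum_ord leq_addr. Qed.

Lemma gadget_cases (P : nat * nat * nat * nat -> Prop) :
  (forall t : 'I_L, (M <= t)%N -> P (letter t : nat, (letter t).+1, t : nat, t.+1)) ->
  (forall r, (r < size eqs)%N -> P (prefix_len r, prefix_len r + size (eqn r).1,
     prefix_len r + size (eqn r).1, prefix_len r + size (eqn r).1 + size (eqn r).2)%N) ->
  forall x, x \in gadgets -> P x.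
Proof.
move=> h1 h2 x; rewrite mem_cat => /orP[] /mapP[t]; rewrite mem_iota.
  move=> /andP[Mt tL] ->; have tL' : (t < L)%N by have := M_le_L; lia.
  by have := h1 (Ordinal tL') Mt; rewrite -letter_natE.
by rewrite add0n => /h2 h ->.
Qed.

(** A copy stands to the right of the initial list, hence of its variable; for an equation the
    strict inequalities are the nonemptiness of its two sides. *)
Lemma gadgets_ok g : (g < size gadgets)%N ->
  [/\ (ga g < gb g)%N, (ga g < gc g)%N, (gc g < gd g)%N, (gb g <= L)%N & (gd g <= L)%N].
Proof.
move=> /(mem_nth (0, 0, 0, 0)%N); rewrite /ga /gb /gc /gd; move: (gadget g).
apply: gadget_cases => [t Mt|r rs] /=.
  have := ltn_ord (letter t); have := ltn_ord t; have := M_le_L.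
  by split; lia.
have [pre [post [we sp]]] := word_split rs.
have : eqn r \in eqs by exact: mem_nth.
move=> /eqs_neq0 /andP[]; move: we; move: (eqn r).1 (eqn r).2 => u v we u0 v0.
have : L = (prefix_len r + (size u + (size v + size post)))%N.
  by rewrite [in LHS]we !size_cat sp.
have {}u0 : (0 < size u)%N := u0; have {}v0 : (0 < size v)%N := v0.
move=> sL; split; rewrite ?sL; move: u0 v0; move: (size u) (size v) (size post); lia.
Qed.

Definition spell (z : 'rV[R]_M) : 'rV[R]_L := colsub letter z.
Definition head_vars (u : 'rV[R]_L) : 'rV[R]_M := colsub (widen_ord M_le_L) u.

Fact spell_is_linear : linear spell.
Proof. by move=> c u v; apply/rowP => j; rewrite !mxE. Qed.
HB.instance Definition _ :=
  GRing.isLinear.Build R 'rV[R]_M 'rV[R]_L _ spell spell_is_linear.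
Fact head_vars_is_linear : linear head_vars.
Proof. by move=> c u v; apply/rowP => j; rewrite !mxE. Qed.
HB.instance Definition _ :=
  GRing.isLinear.Build R 'rV[R]_L 'rV[R]_M _ head_vars head_vars_is_linear.

Lemma letter_head (j : 'I_M) : letter (widen_ord M_le_L j) = j.
Proof.
rewrite /letter (tnth_nth j) /= /word nth_cat size_enum_ord ltn_ord.
by rewrite nth_ord_enum.
Qed.

Lemma spellK : cancel spell head_vars.
Proof. by move=> z; apply/rowP => j; rewrite !mxE letter_head. Qed.

Lemma spellE z t : spell z 0 t = z 0 (letter t).
Proof. by rewrite mxE. Qed.

Lemma partial_sum_spell z t : (t <= L)%N ->
  partial_sum (spell z) t = \sum_(j <- take t word) z 0 j.
Proof.
elim: t => [|t ih] tL; first by rewrite take0 big_nil /partial_sum big1.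
have := partial_sumS (spell z) (Ordinal tL); rewrite [nat_of_ord _]/= => ->.
rewrite (ih (ltnW tL)) spellE (take_nth (letter (Ordinal tL)) tL) -cats1 big_cat big_seq1.
congr (_ + z 0 _); exact: tnth_nth.
Qed.

Let valid := (@valid R L (size gadgets) ga gb gc gd).

(** A spelled vector satisfies the copying gadgets by construction, and the remaining gadgets are
    the equations. *)
Lemma valid_spell z : solutions z <-> valid (partial_sum (spell z)).
Proof.
have inc (t : 'I_L) : partial_sum (spell z) t.+1 = partial_sum (spell z) t + z 0 (letter t).
  by rewrite partial_sumS spellE.
have blk r : (r < size eqs)%N -> let s := partial_sum (spell z) in let o := prefix_len r in
    s (o + size (eqn r).1)%N - s o = \sum_(j <- (eqn r).1) z 0 j /\
    s (o + size (eqn r).1 + size (eqn r).2)%N - s (o + size (eqn r).1)%N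
    = \sum_(j <- (eqn r).2) z 0 j.
  move=> rs s o; have [pre [post [we sp]]] := word_split rs.
  have sz : (o + size (eqn r).1 + size (eqn r).2 <= L)%N.
    by rewrite we !size_cat sp; lia.
  rewrite /s !partial_sum_spell; try lia.
  have tk x y k : word = x ++ y -> size x = k -> take k word = x.
    by move=> -> <-; rewrite take_size_cat.
  rewrite (tk _ _ o we sp) (tk (pre ++ (eqn r).1) ((eqn r).2 ++ post)); last 2 first.
  - by rewrite we !catA.
  - by rewrite size_cat sp.
  rewrite (tk (pre ++ (eqn r).1 ++ (eqn r).2) post); last 2 first.
  - by rewrite we !catA.
  - by rewrite !size_cat sp addnA.
  by rewrite !big_cat /=; split; ring.
split=> [[z0 ze]|[h1 h2]].
  split=> [t tL|g gG]; first by rewrite (inc (Ordinal tL)) ltrDl.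
  have := mem_nth (0, 0, 0, 0)%N gG; rewrite /ga /gb /gc /gd; move: (gadget g).
  apply: gadget_cases => [t Mt|r rs] /=.
    have := inc (widen_ord M_le_L (letter t)); rewrite /= letter_head => ->.
    by rewrite inc; ring.
  have [-> ->] := blk r rs; apply: ze; exact: mem_nth.
split=> [j|e /(nthP ([::], [::]))[r rs er]].
  have := h1 (widen_ord M_le_L j) (ltn_ord _).
  by rewrite (inc (widen_ord M_le_L j)) letter_head ltrDl.
have [b1 b2] := blk r rs; rewrite -er -/(eqn r) -b1 -b2.
pose g := (L - M + r)%N; have gE : gadget g = (prefix_len r, prefix_len r + size (eqn r).1,
     prefix_len r + size (eqn r).1, prefix_len r + size (eqn r).1 + size (eqn r).2)%N.
  rewrite nth_cat size_map size_iota /g ltnNge leq_addr /= addKn.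
  by rewrite (nth_map 0%N) ?size_iota // nth_iota.
have gG : (g < size gadgets)%N by rewrite size_cat !size_map !size_iota /g ltn_add2l.
by have := h2 g gG; rewrite /ga /gb /gc /gd gE.
Qed.

(** The copying gadgets force every position to repeat the value of its variable. *)
Lemma spell_head u : valid (partial_sum u) -> spell (head_vars u) = u.
Proof.
move=> [h1 h2]; apply/rowP => t; rewrite !mxE.
have [tM|Mt] := ltnP t M.
  congr (u 0 _); apply: val_inj => /=.
  have <- : widen_ord M_le_L (Ordinal tM) = t by apply: val_inj.
  by rewrite letter_head.
pose g := (t - M)%N; have gE : gadget g = (letter t : nat, (letter t).+1, t : nat, t.+1).
  rewrite nth_cat size_map size_iota /g ltn_sub2r //; last by have := ltn_ord t; lia.
  rewrite (nth_map 0%N) ?size_iota ?ltn_sub2r //; last by have := ltn_ord t; lia.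
  rewrite nth_iota ?ltn_sub2r //; last by have := ltn_ord t; lia.
  by rewrite subnKC // letter_natE.
have gG : (g < size gadgets)%N.
  by rewrite size_cat !size_map !size_iota /g; have := ltn_ord t; lia.
have := h2 g gG; rewrite /ga /gb /gc /gd gE /=.
by rewrite (partial_sumS u t) (partial_sumS u (widen_ord M_le_L (letter t))) /=; lra.
Qed.

Lemma equations_realization z0 : solutions z0 ->
  exists (n : nat) (N : set (set 'rV[R]_2)),
    [/\ (0 < n)%N, linear_newton_subdivision n N
      & linearly_isomorphic (@realization_space R n N) solutions].
Proof.
move=> /valid_spell hz0.
have [n [N [n0 HN iso]]] := block_realization gadgets_ok hz0.
exists n, N; split => //; apply: linearly_isomorphic_trans iso _.
exists head_vars, spell; split; last by move=> u /set_mem; exact: spell_head.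
split.
- by move=> u hu; apply/valid_spell; rewrite spell_head.
- by move=> u v /set_mem hu /set_mem hv e; rewrite -(spell_head hu) -(spell_head hv) e.
- by move=> z /valid_spell hz; exists (spell z) => //; exact: spellK.
Qed.

End Word.

End Equations.

(** * Integer matrices and slack variables *)

Section Polyhedral.
Variable R : realType.

Section Homogeneous.
Variables (k M : nat) (E : 'M[int]_(k, M)).
Implicit Types (i : 'I_k) (z : 'rV[R]_M).

Definition kernel : set 'rV[R]_M :=
  [set z | (forall j, 0 < z 0 j) /\ forall i, \sum_j (E i j)%:~R * z 0 j = 0].

(** The positive part of a linear form, in unary; applied to the opposite form it lists the negative
    part. *)
Definition side (e : 'I_M -> int) : seq 'I_M :=
  flatten [seq nseq (if 0 <= e j then `|e j|%N else 0) j | j <- enum 'I_M].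

Definition equations : seq (seq 'I_M * seq 'I_M) :=
  [seq e <- [seq (side (E i), side (fun j => - E i j)) | i <- enum 'I_k]
    | (0 < size e.1)%N && (0 < size e.2)%N].

Lemma sum_side e z :
  \sum_(j <- side e) z 0 j = \sum_j (if 0 <= e j then (e j)%:~R else 0) * z 0 j.
Proof.
rewrite big_flatten big_map big_enum /=; apply: eq_bigr => j _.
rewrite big_nseq iter_addr_0; case: ifP => [e0|_]; last by rewrite mulr0n mul0r.
by rewrite -mulr_natl -{2}(gez0_abs e0).
Qed.

Lemma sum_sides i z : \sum_j (E i j)%:~R * z 0 j =
  \sum_(j <- side (E i)) z 0 j - \sum_(j <- side (fun j => - E i j)) z 0 j.
Proof.
rewrite !sum_side -sumrB; apply: eq_bigr => j _; rewrite oppr_ge0 mulrNz -mulrBl.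
congr (_ * _); case: (ltgtP (E i j) 0) => [_|_|->]; rewrite ?sub0r ?opprK ?subr0 //.
Qed.

(** The filter in [equations] drops equations with an empty side. Given a positive solution, the
    other side is empty too, as a nonempty sum of positive numbers is not zero; the dropped
    equations read [0 = 0]. *)
Lemma kernel_solutions z0 : kernel z0 -> kernel = solutions equations.
Proof.
have pos z s : (forall j, 0 < z 0 j) -> 0 = \sum_(j <- s) z 0 j -> size s = 0%N.
  move=> z0' ; case: s => // j s; rewrite big_cons => e.
  have : 0 < z 0 j + \sum_(i <- s) z 0 i by rewrite ltr_pwDl // sumr_ge0 // => i _; exact/ltW.
  by rewrite -e ltxx.
move=> [p0 e0]; apply/seteqP; split=> z [zp ze]; split => //.
  move=> e; rewrite mem_filter => /andP[_ /mapP[i _ ->]] /=.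
  by apply/eqP; rewrite -subr_eq0 -sum_sides ze.
move=> i; rewrite sum_sides; apply/eqP; rewrite subr_eq0; apply/eqP.
have := e0 i; rewrite sum_sides => /eqP; rewrite subr_eq0 => /eqP h.
have [nz|] := boolP ((0 < size (side (E i)))%N && (0 < size (side (fun j => - E i j)))%N).
  apply: (ze (side (E i), side (fun j => - E i j))); rewrite mem_filter nz /=.
  by apply: map_f; rewrite mem_enum.
have nil (s : seq 'I_M) : size s = 0%N -> s = [::] by exact: size0nil.
rewrite negb_and -!eqn0Ngt => /orP[] /eqP/nil s0; rewrite s0 big_nil in h *.
  by rewrite (nil _ (pos _ _ p0 h)) big_nil.
by rewrite (nil _ (pos _ _ p0 (esym h))) big_nil.
Qed.

Lemma kernel_realization z0 : kernel z0 ->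
  exists (n : nat) (N : set (set 'rV[R]_2)),
    [/\ (0 < n)%N, linear_newton_subdivision n N
      & linearly_isomorphic (@realization_space R n N) kernel].
Proof.
move=> kz0; have kE := kernel_solutions kz0; rewrite kE.
apply: (@equations_realization _ _ _ _ z0); last by rewrite -kE.
by move=> e; rewrite mem_filter => /andP[].
Qed.

End Homogeneous.

Section Slack.
Variables (m p q : nat) (A : 'M[int]_(p, m)) (B : 'M[int]_(q, m)).

Definition polyhedron : set 'rV[R]_m :=
  [set x | [/\ forall j, 0 < x 0 j,
               forall i, \sum_j (A i j)%:~R * x 0 j = 0
             & forall i, 0 < \sum_j (B i j)%:~R * x 0 j]].

(** Encodes [A x = 0] and [B x = y]; the positivity built into [kernel] makes the slack [y]
    positive. *)
Definition slack_matrix : 'M[int]_(p + q, m + q) := block_mx A 0 B (- 1%:M).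

Definition with_slack (x : 'rV[R]_m) : 'rV[R]_(m + q) :=
  row_mx x (\row_i \sum_j (B i j)%:~R * x 0 j).
Definition forget_slack (z : 'rV[R]_(m + q)) : 'rV[R]_m := lsubmx z.

Fact forget_slack_is_linear : linear forget_slack.
Proof. by move=> c u v; rewrite /forget_slack linearP. Qed.
HB.instance Definition _ := GRing.isLinear.Build R 'rV[R]_(m + q) 'rV[R]_m _
  forget_slack forget_slack_is_linear.
Fact with_slack_is_linear : linear with_slack.
Proof.
move=> c u v; rewrite /with_slack scale_row_mx add_row_mx; congr row_mx.
apply/rowP => i; rewrite !mxE mulr_sumr -big_split /=; apply: eq_bigr => j _.
by rewrite !mxE; ring.
Qed.
HB.instance Definition _ := GRing.isLinear.Build R 'rV[R]_m 'rV[R]_(m + q) _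
  with_slack with_slack_is_linear.

Lemma kernel_slack (x : 'rV[R]_m) (y : 'rV[R]_q) : kernel slack_matrix (row_mx x y) <->
  polyhedron x /\ y = \row_i \sum_j (B i j)%:~R * x 0 j.
Proof.
have up i : \sum_j (slack_matrix (lshift q i) j)%:~R * row_mx x y 0 j =
    \sum_j (A i j)%:~R * x 0 j.
  rewrite big_split_ord /= [X in _ + X]big1 ?addr0 => [|j _].
    by apply: eq_bigr => j _; rewrite /slack_matrix block_mxEul row_mxEl.
  by rewrite /slack_matrix block_mxEur mxE mul0r.
have dn i : \sum_j (slack_matrix (rshift p i) j)%:~R * row_mx x y 0 j =
    \sum_j (B i j)%:~R * x 0 j - y 0 i.
  rewrite big_split_ord /=; congr (_ + _).
    by apply: eq_bigr => j _; rewrite /slack_matrix block_mxEdl row_mxEl.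
  rewrite (bigD1 i) //= big1 ?addr0 => [|j /negPf ji].
    by rewrite /slack_matrix block_mxEdr row_mxEr !mxE eqxx mulr1n mulN1r.
  by rewrite /slack_matrix block_mxEdr !mxE eq_sym ji mulr0n oppr0 mul0r.
split=> [[pos eq0]|[[xp xA xB] yE]].
  have yE : y = \row_i \sum_j (B i j)%:~R * x 0 j.
    apply/rowP => i; rewrite mxE; apply/eqP; rewrite eq_sym -subr_eq0 -dn.
    by rewrite eq0.
  split => //; split => [j|i|i].
  - by have := pos (lshift q j); rewrite row_mxEl.
  - by rewrite -up eq0.
  - by have := pos (rshift m i); rewrite row_mxEr yE mxE.
split => [j|i].
  by case: (split_ordP j) => i ->; rewrite ?row_mxEl ?row_mxEr // yE mxE.
case: (split_ordP i) => r ->; first by rewrite up.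
by rewrite dn yE mxE subrr.
Qed.

Lemma polyhedron_realization x0 : polyhedron x0 ->
  exists (n : nat) (N : set (set 'rV[R]_2)),
    [/\ (0 < n)%N, linear_newton_subdivision n N
      & linearly_isomorphic (@realization_space R n N) polyhedron].
Proof.
move=> hx0; have : kernel slack_matrix (with_slack x0) by apply/kernel_slack.
move=> /kernel_realization[n [N [n0 HN iso]]]; exists n, N; split => //.
apply: linearly_isomorphic_trans iso _; exists forget_slack, with_slack.
have K z : kernel slack_matrix z -> with_slack (forget_slack z) = z /\ polyhedron (forget_slack z).
  rewrite -{1}[z]hsubmxK => /kernel_slack[h1 h2]; split => //.
  by rewrite /with_slack -h2 hsubmxK.
split; last by move=> z /set_mem/K[].
split; first by move=> z /K[].
  by move=> u v /set_mem/K[hu _] /set_mem/K[hv _] e; rewrite -hu -hv e.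
move=> x hx; exists (with_slack x); first by apply/kernel_slack.
exact: row_mxKl.
Qed.

End Slack.

End Polyhedral.

(** * A tiling without exact metrics *)

(** Lower and upper bounds of a hexagon as plain integer tuples, so that the subdivision can be
    checked by computation. *)
Definition box := ((int * int * int) * (int * int * int))%type.
Definition coor (x : int * int * int) (k : 'I_3) : int :=
  if k == k0 then x.1.1 else if k == k1 then x.1.2 else x.2.
Notation lower t := (coor t.1).
Notation upper t := (coor t.2).
Definition box_of (l u : 'I_3 -> int) : box := ((l k0, l k1, l k2), (u k0, u k1, u k2)).
Definition total (x : int * int * int) : int := coor x k0 + coor x k1 + coor x k2.

Lemma lower_box l u k : lower (box_of l u) k = l k.
Proof. by elim/I3P: k. Qed.
Lemma upper_box l u k : upper (box_of l u) k = u k.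
Proof. by elim/I3P: k. Qed.

Section Tiling.
Variable n : nat.
Implicit Types (s t : box) (T : seq box) (a b c k : 'I_3).

(* All six inequalities defining the hexagon are attained, and it is the
   Minkowski sum of a triangle and segments. *)
Definition tight t : bool :=
  [&& total t.1 <= n%:Z, 2 * n%:Z <= total t.1 + total t.2
    & all (fun k => upper t k + (total t.1 - lower t k) <= n%:Z) [:: k0; k1; k2]].

(** Fixing one coordinate restricts the others through the sum [n]; the bounds are recomputed so
    that the face is [tight] again. *)
Definition face_max a t : box := box_of
  (fun k => if k == a then upper t a else lower t k)
  (fun k => if k == a then upper t a
            else n%:Z - (total t.1 - lower t a - lower t k) - upper t a).
Definition face_min a t : box := box_of
  (fun k => if k == a then lower t a
            else n%:Z - (total t.2 - upper t a - upper t k) - lower t a)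
  (fun k => if k == a then lower t a else upper t k).

(** The face maximising [f], sorted as [f a >= f b >= f c], depends only on which inequalities are
    strict: it is the hexagon, one of six sides, or one of six vertices. *)
Definition faces t : seq box :=
  t :: [seq face_max a t | a <- [:: k0; k1; k2]] ++ [seq face_min a t | a <- [:: k0; k1; k2]]
    ++ [seq face_min ac.2 (face_max ac.1 t) |
        ac <- [:: (k0, k1); (k0, k2); (k1, k0); (k1, k2); (k2, k0); (k2, k1)]].

Definition overlap s t : box :=
  box_of (fun k => Num.max (lower s k) (lower t k)) (fun k => Num.min (upper s k) (upper t k)).
Definition hollow t : bool :=
  [|| n%:Z < total t.1, total t.2 < n%:Z
    | has (fun k => upper t k < lower t k) [:: k0; k1; k2]].
(** One round of bound propagation through the sum [n], after which an intersection can be looked up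
    among the listed faces. *)
Definition tighten t : box := box_of
  (fun k => Num.max (lower t k) (n%:Z - (total t.2 - upper t k)))
  (fun k => Num.min (upper t k) (n%:Z - (total t.1 - lower t k))).
Definition compatible (sf tf : box * seq box) : bool :=
  let m := overlap sf.1 tf.1 in
  hollow m || (let f := tighten m in (f \in sf.2) && (f \in tf.2)).

(** [z] holds the integer parts of the coordinates of a point; each coordinate is then below
    [z k + 1] and below what the other two integer parts leave of [n]. *)
Definition covers t (z : nat * nat * nat) : bool :=
  let x : int * int * int := (z.1.1%:Z, z.1.2%:Z, z.2%:Z) in
  all (fun k => (lower t k <= coor x k) &&
                (Num.min (coor x k + 1) (n%:Z - (total x - coor x k)) <= upper t k))
      [:: k0; k1; k2].

(** In the last clause, the integer parts of three numbers with sum [n] add up to [n], [n - 1] or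
    [n - 2]. *)
Definition tiling T : bool :=
  let TF := [seq (t, faces t) | t <- T] in
  [&& all tight T, all (fun tf => all (mem T) tf.2) TF,
      all (fun sf => all (compatible sf) TF) TF,
      all (fun t => all (fun k => 0 <= lower t k) [:: k0; k1; k2]) T
    & all (fun i => all (fun j => all (fun h =>
        ((n <= i + j + h + 2) && (i + j + h <= n))%N ==> has (covers^~ (i, j, h)) T)
        (iota 0 n.+1)) (iota 0 n.+1)) (iota 0 n.+1)].

Lemma all3P (P : pred 'I_3) : reflect (forall k, P k) (all P [:: k0; k1; k2]).
Proof.
apply: (iffP and4P) => [[h0 h1 h2 _]|h]; first by elim/I3P.
by split.
Qed.

Lemma tight_face_max a t : tight t -> tight (face_max a t).
Proof.
move=> /and3P[t1 t2 /all3P t3]; have := t3 k0; have := t3 k1; have := t3 k2.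
case: t t1 t2 {t3} => [[[l0 l1] l2] [[u0 u1] u2]]; rewrite /total /coor /=.
move=> ? ? ? ? ?; elim/I3P: a; apply/and3P; split; [| |apply/all3P; elim/I3P
  | | |apply/all3P; elim/I3P| | |apply/all3P; elim/I3P]; rewrite /= /total /coor /=; lia.
Qed.

Section Hexagons.
Variable R : realType.
Local Notation plane := 'rV[R]_2.
Implicit Types (P Q : plane) (f : 'I_3 -> R).

Definition box_hexagon t : set plane := @hexagon R n (coor t.1) (coor t.2).
Local Notation H := box_hexagon.

Lemma tight_real t : let l k := (lower t k)%:~R : R in let u k := (upper t k)%:~R in
  tight t -> [/\ l k0 + l k1 + l k2 <= n%:R,
    2 * n%:R <= l k0 + l k1 + l k2 + (u k0 + u k1 + u k2),
    u k0 + l k1 + l k2 <= n%:R, l k0 + u k1 + l k2 <= n%:R & l k0 + l k1 + u k2 <= n%:R].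
Proof.
move=> l u /and3P[t1 t2 /all3P t3]; have := t3 k0; have := t3 k1; have := t3 k2.
case: t @l @u t1 t2 {t3} => [[[l0 l1] l2] [[u0 u1] u2]]; rewrite /total /coor /= => h1 h2 h3 h4 h5.
have nE : n%:R = (n%:Z)%:~R :> R by [].
have nE2 : 2 * n%:R = (2 * n%:Z)%:~R :> R by rewrite intrM.
by rewrite nE2 nE -!intrD !ler_int; split; lia.
Qed.

Lemma face_max_hexagon a t : tight t ->
  H (face_max a t) = [set P | H t P /\ bar n P a = (upper t a)%:~R].
Proof.
move=> /tight_real[]; rewrite /H /hexagon /total; case: t => [[[l0 l1] l2] [[u0 u1] u2]] /= h1 h2 h3 h4 h5.
have nE : (n%:Z)%:~R = n%:R :> R by [].
apply/seteqP; split=> P /=; have := bar_sum n P.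
  move=> hs h; have := h k0; have := h k1; have := h k2; clear h; move: hs h1 h2 h3 h4 h5.
  elim/I3P: a; rewrite /= /total /coor /= !(intrD, intrN) !nE => hs h1 h2 h3 h4 h5
    /andP[? ?] /andP[? ?] /andP[? ?]; (split; [by elim/I3P; rewrite /=; lra|lra]).
move=> hs [h]; have := h k0; have := h k1; have := h k2; clear h; move: hs h1 h2 h3 h4 h5.
elim/I3P: a; rewrite /coor /= => hs h1 h2 h3 h4 h5 /andP[? ?] /andP[? ?] /andP[? ?] e.
all: elim/I3P; rewrite /= /total /= ?(intrD, intrN) ?nE; lra.
Qed.

Lemma face_min_hexagon a t : tight t ->
  H (face_min a t) = [set P | H t P /\ bar n P a = (lower t a)%:~R].
Proof.
move=> /tight_real[]; rewrite /H /hexagon /total; case: t => [[[l0 l1] l2] [[u0 u1] u2]] /= h1 h2 h3 h4 h5.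
have nE : (n%:Z)%:~R = n%:R :> R by [].
apply/seteqP; split=> P /=; have := bar_sum n P.
  move=> hs h; have := h k0; have := h k1; have := h k2; clear h; move: hs h1 h2 h3 h4 h5.
  elim/I3P: a; rewrite /= /total /coor /= !(intrD, intrN) !nE => hs h1 h2 h3 h4 h5
    /andP[? ?] /andP[? ?] /andP[? ?]; (split; [by elim/I3P; rewrite /=; lra|lra]).
move=> hs [h]; have := h k0; have := h k1; have := h k2; clear h; move: hs h1 h2 h3 h4 h5.
elim/I3P: a; rewrite /coor /= => hs h1 h2 h3 h4 h5 /andP[? ?] /andP[? ?] /andP[? ?] e.
all: elim/I3P; rewrite /= /total /= ?(intrD, intrN) ?nE; lra.
Qed.

(** Summation by parts leaves only the coordinates [a] and [c], with weights [f a - f b] and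
    [f c - f b]. Tightness provides a point [Q] attaining the upper bound of one and the lower bound
    of the other. *)
Lemma maximizers t f a b c : tight t -> a != b -> a != c -> b != c -> f b <= f a -> f c <= f b ->
  let F := [set P | H t P /\ forall Q, H t Q -> dot n Q f <= dot n P f] in
  F !=set0 /\ F = [set P | [/\ H t P, f b < f a -> bar n P a = (upper t a)%:~R
                           & f c < f b -> bar n P c = (lower t c)%:~R]].
Proof.
move=> /tight_real[h1 h2 h3 h4 h5] ab ac bc fba fcb F.
have sums (g : 'I_3 -> R) := sum_I3 g ab ac bc.
pose y k : R := if k == a then (upper t a)%:~R else if k == c then (lower t c)%:~R
  else n%:R - (upper t a)%:~R - (lower t c)%:~R.
have ya : y a = (upper t a)%:~R by rewrite /y eqxx.
have yc : y c = (lower t c)%:~R by rewrite /y eqxx eq_sym (negPf ac).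
have yb : y b = n%:R - (upper t a)%:~R - (lower t c)%:~R.
  by rewrite /y eq_sym (negPf ab) (negPf bc).
have [Q hQ] : exists Q : plane, bar n Q =1 y.
  by apply: bar_surj; rewrite sums ya yb yc; ring.
have HQ : H t Q.
  move=> k; rewrite hQ; have [] := I3_three k ab ac bc => ->; rewrite ?ya ?yb ?yc;
    move: ab ac bc h1 h2 h3 h4 h5; clear; elim/I3P: a; elim/I3P: b => //;
    elim/I3P: c => // _ _ _ *; lra.
have dE P : dot n P f = f b * n%:R + (f a - f b) * bar n P a - (f b - f c) * bar n P c.
  by rewrite -(bar_sum n P) /dot (sums (fun k => bar n P k * f k)) (sums (bar n P)); ring.
have g P : H t P -> 0 <= (f a - f b) * ((upper t a)%:~R - bar n P a) /\
    0 <= (f b - f c) * (bar n P c - (lower t c)%:~R).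
  move=> hP; have /andP[_ h] := hP a; have /andP[h' _] := hP c.
  by split; apply: mulr_ge0; rewrite subr_ge0.
have FE : F = [set P | [/\ H t P, f b < f a -> bar n P a = (upper t a)%:~R
                           & f c < f b -> bar n P c = (lower t c)%:~R]].
  apply/seteqP; split=> P.
    move=> [hP /(_ Q HQ)]; rewrite !dE !hQ ya yc => h; have [g1 g2] := g _ hP.
    have e1 : (f a - f b) * ((upper t a)%:~R - bar n P a) = 0 by lra.
    have e2 : (f b - f c) * (bar n P c - (lower t c)%:~R) = 0 by lra.
    split=> // lt.
      by move/eqP: e1; rewrite mulf_eq0 => /orP[] /eqP; lra.
    by move/eqP: e2; rewrite mulf_eq0 => /orP[] /eqP; lra.
  move=> [hP e1 e2]; split=> // S hS; have [g1 g2] := g _ hS; rewrite !dE.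
  have {}e1 : (f a - f b) * ((upper t a)%:~R - bar n P a) = 0.
    by have := fba; rewrite le_eqVlt => /orP[/eqP ->|/e1 ->]; rewrite subrr ?mul0r ?mulr0.
  have {}e2 : (f b - f c) * (bar n P c - (lower t c)%:~R) = 0.
    by have := fcb; rewrite le_eqVlt => /orP[/eqP ->|/e2 ->]; rewrite subrr ?mul0r ?mulr0.
  lra.
by split=> //; exists Q; rewrite FE; split=> // _; rewrite hQ.
Qed.

Lemma face_min_max_hexagon a c t : tight t -> a != c ->
  H (face_min c (face_max a t)) = [set P | [/\ H t P, bar n P a = (upper t a)%:~R
                                             & bar n P c = (lower t c)%:~R]].
Proof.
move=> tt ac; rewrite face_min_hexagon ?tight_face_max // face_max_hexagon //.
rewrite lower_box eq_sym (negPf ac); apply/seteqP; split=> P /=; first by case=> -[].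
by case.
Qed.

Lemma mem_I3 k : k \in [:: k0; k1; k2].
Proof. by elim/I3P: k. Qed.

(** For the converse, the zero functional, [e a], [- e c] and [e a - e c] exhibit the hexagon, its
    sides and its vertices. *)
Lemma box_faces t F : tight t -> face (H t) F <-> exists2 t', t' \in faces t & F = H t'.
Proof.
move=> tt; split.
  move=> /(faceP n)[_ [f ->]]; have [a [b [c [[ab ac bc] h1 h2]]]] := sort3 f.
  have [_ ->] := maximizers tt ab ac bc h1 h2.
  have [e1|e1] := eqVneq (f b) (f a); have [e2|e2] := eqVneq (f c) (f b).
  - exists t; first exact: mem_head.
    by apply/seteqP; split=> P; [case|split=> //; rewrite ?e2 -?e1 ltxx].
  - exists (face_min c t).
      by rewrite inE !mem_cat (map_f (face_min^~ t) (mem_I3 c)) !orbT.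
    rewrite face_min_hexagon // -e1 ltxx lt_neqAle e2 h2.
    by apply/seteqP; split=> P /=; [case=> ? _ /(_ isT)|case].
  - exists (face_max a t).
      by rewrite inE !mem_cat (map_f (face_max^~ t) (mem_I3 a)) !orbT.
    rewrite face_max_hexagon // e2 ltxx lt_neqAle e1 h1.
    by apply/seteqP; split=> P /=; [case=> ? /(_ isT)|case].
  - exists (face_min c (face_max a t)).
      rewrite inE !mem_cat; apply/orP; right; apply/orP; right; apply/orP; right.
      apply: (map_f (fun ac => face_min ac.2 (face_max ac.1 t)) (x := (a, c))).
      by clear -ac; elim/I3P: a ac; elim/I3P: c.
    rewrite face_min_max_hexagon // !lt_neqAle e1 e2 h1 h2.
    by apply/seteqP; split=> P /=; [case=> ? /(_ isT) ? /(_ isT)|case].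
have mx f a b c : a != b -> a != c -> b != c -> f b <= f a -> f c <= f b ->
    face (H t) [set P | [/\ H t P, f b < f a -> bar n P a = (upper t a)%:~R
                          & f c < f b -> bar n P c = (lower t c)%:~R]].
  move=> ab ac bc h1 h2; have [ne <-] := maximizers tt ab ac bc h1 h2.
  by apply/(faceP n); split=> //; exists f.
have other a c : a != c -> exists b, a != b /\ b != c.
  by elim/I3P: a; elim/I3P: c => // _; [exists k2|exists k1|exists k2|exists k0|exists k1|exists k0].
pose e a k : R := (k == a)%:R.
have next a : exists c, a != c by elim/I3P: a; [exists k1|exists k0|exists k0].
case=> t'; rewrite inE !mem_cat => /or4P[/eqP ->|/mapP[a _ ->]|/mapP[c _ ->]|/mapP[[a c] h ->]] ->.
- have := mx (fun=> 0) k0 k1 k2 isT isT isT (lexx _) (lexx _); congr face.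
  by apply/seteqP; split=> P /=; [case|split=> //; rewrite ltxx].
- have [c ac] := next a; have [b [ab bc]] := other a c ac.
  have ca : (c == a) = false by rewrite eq_sym (negPf ac).
  have ba : (b == a) = false by rewrite eq_sym (negPf ab).
  have := mx (e a) a b c ab ac bc; rewrite /e eqxx ca ba ler01 lexx ltr01 ltxx => /(_ isT isT).
  by rewrite face_max_hexagon //; congr face; apply/seteqP; split=> P /=; [case=> ? /(_ isT)|case].
- have [a ca] := next c; have ac : a != c by rewrite eq_sym.
  have [b [ab /negPf bc]] := other a c ac; have := mx (fun k => - e c k) a b c ab ac (negbT bc).
  rewrite /e eqxx bc (negPf ac) oppr0 oppr_le0 ler01 lexx oppr_lt0 ltr01 ltxx => /(_ isT isT).
  by rewrite face_min_hexagon //; congr face; apply/seteqP; split=> P /=; [case=> ? _ /(_ isT)|case].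
have ac : a != c by move: h; clear; elim/I3P: a; elim/I3P: c.
have [b [/negPf ab /negPf bc]] := other a c ac.
have ca : (c == a) = false by rewrite eq_sym (negPf ac).
have := mx (fun k => e a k - e c k) a b c (negbT ab) ac (negbT bc).
rewrite /e !eqxx bc ca (negPf ac) eq_sym ab !subr0 sub0r oppr_le0 ler01 oppr_lt0 ltr01.
move=> /(_ isT isT); rewrite face_min_max_hexagon //; congr face.
by apply/seteqP; split=> P /=; [case=> ? /(_ isT) ? /(_ isT)|case].
Qed.

Lemma box_Pcell t : tight t -> Pcell_translate (H t).
Proof.
move=> /and3P[t1 t2 /all3P t3]; apply/(Pcell_translateP n).
pose D : int := n%:Z - total t.1; pose w k := absz (lower t k + D - upper t k)%R.
have wE k : (w k)%:Z = lower t k + D - upper t k.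
  by rewrite /w gez0_abs // /D; have := t3 k; lia.
exists (coor t.1), (absz (D - (w k0)%:Z - (w k1)%:Z - (w k2)%:Z)%R), w.
have cE : (absz (D - (w k0)%:Z - (w k1)%:Z - (w k2)%:Z)%R)%:Z = D - (w k0)%:Z - (w k1)%:Z - (w k2)%:Z.
  by rewrite gez0_abs // !wE; move: t1 t2; rewrite /D /total; lia.
split; first by rewrite !PoszD cE !wE /D /total; lia.
rewrite /H /box_hexagon; congr hexagon; apply/funext => k.
by rewrite cE (wE k) /D; lia.
Qed.

Lemma hexagonI s t : H s `&` H t = H (overlap s t).
Proof.
apply/seteqP; split=> P.
  move=> [hs ht] k; have /andP[? ?] := hs k; have /andP[? ?] := ht k.
  rewrite lower_box upper_box maxEle minEle; apply/andP; split; case: ifP => //.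
move=> h; split=> k; have /andP[] := h k; rewrite lower_box upper_box => h1 h2;
  apply/andP; split.
- by apply: le_trans h1; rewrite ler_int le_max lexx.
- by apply: (le_trans h2); rewrite ler_int ge_min lexx.
- by apply: le_trans h1; rewrite ler_int le_max lexx orbT.
- by apply: (le_trans h2); rewrite ler_int ge_min lexx orbT.
Qed.

Lemma hexagon_hollow t : hollow t -> H t = set0.
Proof.
move=> h; rewrite -subset0 => P hP.
have hs := bar_sum n P; have nE : (n%:Z)%:~R = n%:R :> R by [].
have := hP k0; have := hP k1; have := hP k2; move=> /andP[? ?] /andP[? ?] /andP[? ?].
have /orP[|/orP[|/hasP[k _]]] := h; rewrite -(ltr_int R) /total ?intrD ?nE; try lra.
by have /andP[a b] := hP k; lra.
Qed.

Lemma hexagon_tighten t : H (tighten t) = H t.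
Proof.
have nE : (n%:Z)%:~R = n%:R :> R by [].
apply/seteqP; split=> P h k; have := h k; rewrite /tighten lower_box upper_box => /andP[h1 h2];
  apply/andP; split.
- by apply: le_trans h1; rewrite ler_int le_max lexx.
- by apply: (le_trans h2); rewrite ler_int ge_min lexx.
- rewrite maxEle; case: ifP => // _; rewrite /total !(intrD, intrN) nE -(bar_sum n P).
  have := h k0; have := h k1; have := h k2; clear; elim/I3P: k =>
    /andP[? ?] /andP[? ?] /andP[? ?]; lra.
- rewrite minEle; case: ifP => // _; rewrite /total !(intrD, intrN) nE -(bar_sum n P).
  have := h k0; have := h k1; have := h k2; clear; elim/I3P: k =>
    /andP[? ?] /andP[? ?] /andP[? ?]; lra.
Qed.

Definition box_cells T : set (set plane) := [set H t | t in [set` T]].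

Lemma tiling_lns T : tiling T -> linear_newton_subdivision n (box_cells T).
Proof.
move=> /and5P[/allP Tt TF TC T0 Tc].
have Tf t t' : t \in T -> t' \in faces t -> t' \in T.
  move=> hT ht'; have /allP/(_ t' ht') := allP TF (t, faces t) (map_f _ hT); exact.
split.
- exact/finite_image/finite_seq.
- by move=> _ [t hT <-]; exact/box_Pcell/Tt.
- move=> _ F [t hT <-] /(box_faces _ (Tt t hT))[t' ht' ->].
  by exists t' => //; exact: Tf ht'.
- move=> _ _ [s hs <-] [t ht <-].
  have := allP (allP TC (s, faces s) (map_f _ hs)) (t, faces t) (map_f _ ht).
  rewrite /compatible /= hexagonI -(hexagon_tighten (overlap s t)).
  case/orP => [h|/andP[h1 h2]]; first by left; rewrite hexagon_tighten hexagon_hollow.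
  right; split; apply/box_faces; try exact: Tt.
    by exists (tighten (overlap s t)).
  by exists (tighten (overlap s t)).
apply/seteqP; split=> P.
  move=> [_ [t hT <-] hP]; rewrite DeltaE => k; have /andP[h _] := hP k.
  by apply: le_trans h; rewrite ler0z; apply: (all3P _ (allP T0 t hT)).
rewrite DeltaE => P0.
pose z k := Num.truncn (bar n P k).
have zP k : (z k)%:R <= bar n P k < (z k)%:R + 1 by have := truncn_itv (P0 k); rewrite -natr1.
have hs := bar_sum n P.
have z1 : (z k0 + z k1 + z k2 <= n)%N.
  rewrite -(ler_nat R) !natrD; have /andP[? _] := zP k0; have /andP[? _] := zP k1.
  by have /andP[? _] := zP k2; lra.
have z2 : (n <= z k0 + z k1 + z k2 + 2)%N.
  rewrite -ltnS -(ltr_nat R) -natr1 !natrD; have /andP[_ ?] := zP k0; have /andP[_ ?] := zP k1.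
  by have /andP[_ ?] := zP k2; lra.
have iz k : z k \in iota 0 n.+1.
  by rewrite mem_iota /= add0n ltnS; apply: leq_trans z1; elim/I3P: k; lia.
have := allP (allP (allP Tc _ (iz k0)) _ (iz k1)) _ (iz k2).
rewrite z1 z2 /= => /hasP[t hT /all3P ht].
exists (H t); first by exists t.
move=> k; have /andP[h1 h2] := ht k; have /andP[q1 q2] := zP k; apply/andP; split.
  apply: le_trans q1; rewrite pmulrn ler_int; apply: le_trans h1 _.
  by elim/I3P: k {h2 q2}.
apply: le_trans (_ : _ <= (Num.min ((z k)%:Z + 1)
  (n%:Z - (z k0)%:Z - (z k1)%:Z - (z k2)%:Z + (z k)%:Z))%:~R) _.
  rewrite minEle; case: ifP => _; first by rewrite intrD -pmulrn ltW.
  rewrite !(intrD, intrN) -!pmulrn -hs; have /andP[? _] := zP k0; have /andP[? _] := zP k1.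
  by have /andP[? _] := zP k2; elim/I3P: k {h1 h2 q1 q2}; lra.
rewrite ler_int; move: h2; rewrite (_ : coor _ k = z k); last by elim/I3P: k {q1 q2 h1}.
by congr (Num.min _ _ <= _); rewrite /total /coor /=; ring.
Qed.

End Hexagons.
End Tiling.
(* The two-dimensional cells of a nonregular subdivision of [Delta 6]: fifteen
   unit rhombi and six unit triangles. *)
Definition tiles : seq box := [::
  ((4, 0, 0), (5, 2, 1)); ((3, 0, 1), (5, 1, 2)); ((2, 0, 2), (4, 1, 3)); ((1, 0, 3), (2, 2, 4));
  ((0, 0, 4), (1, 1, 6)); ((3, 1, 0), (4, 2, 2)); ((2, 1, 1), (3, 3, 2)); ((1, 1, 2), (3, 2, 3));
  ((0, 1, 3), (1, 2, 5)); ((2, 2, 0), (3, 4, 1)); ((1, 2, 1), (2, 3, 3)); ((0, 2, 2), (1, 3, 4));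
  ((1, 3, 0), (2, 5, 1)); ((0, 3, 1), (2, 4, 2)); ((0, 4, 0), (1, 5, 2)); ((0, 3, 2), (1, 4, 3));
  ((0, 5, 0), (1, 6, 1)); ((1, 0, 4), (2, 1, 5)); ((2, 0, 3), (3, 1, 4)); ((3, 2, 0), (4, 3, 1));
  ((5, 0, 0), (6, 1, 1))].

Definition tile_faces : seq box := undup (flatten [seq faces 6 t | t <- tiles]).

Lemma tiling_tiles : tiling 6 tile_faces.
Proof. by vm_compute. Qed.

Section Unrealizable.
Variable R : realType.
Local Notation N := (@box_cells 6 R tile_faces).
Local Notation HN := (@tiling_lns 6 R _ tiling_tiles).
Local Notation vec := (vec R).
Local Notation triple := (nat * nat * nat)%type.
Implicit Types (x : triple) (k : 'I_3) (t : box).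

Definition lattice_of x : lat := tri_pt x.1.1 x.1.2 x.2.
Definition raise k x : triple :=
  if k == k0 then (x.1.1.+1, x.1.2, x.2) else if k == k1 then (x.1.1, x.1.2.+1, x.2)
  else (x.1.1, x.1.2, x.2.+1).
Definition after k : 'I_3 := if k == k0 then k1 else if k == k1 then k2 else k0.
Definition inside t x : bool :=
  all (fun k => lower t k <= coor (x.1.1%:Z, x.1.2%:Z, x.2%:Z) k <= upper t k) [:: k0; k1; k2].

Lemma lattice_raise k x : lattice_of (raise k x) = lattice_of x + dl k.
Proof. by elim/I3P: k; apply/ffunP; elim/I3P; rewrite latDE dlE !ffunE /=; lia. Qed.

Lemma inside_hexagon t x : deg (lattice_of x) = 6%N -> inside t x ->
  @box_hexagon 6 R t (vec (lattice_of x)).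
Proof.
move=> dx /all3P h k; have := h k; rewrite bar_vec // !pmulrn !ler_int.
by elim/I3P: k; rewrite /lattice_of !ffunE.
Qed.

(** A cell contains both ends of the other diagonal of the unit rhombus, so that [flat_rhombus]
    forbids an edge there. *)
Definition flat_pair k x : bool :=
  has (fun t => inside t (raise k (raise k x)) && inside t (raise (after k) (raise (after (after k)) x)))
    tile_faces.

(** A metric would give a function whose bends are nonnegative, vanish inside cells and are positive
    across edges, that is, a convex function inducing the tiling; the linear system for its values
    is infeasible. *)
Lemma unrealizable : @realization_space R 6 N = set0.
Proof.
rewrite -subset0 => d [dpos dbal].
have [psi hpsi] := closed_potential HN dbal.
pose g x := psi (lattice_of x).
pose D k x := g (raise k (raise k x)) + g (raise (after (after k)) (raise (after k) x))
  - g (raise (after k) (raise k x)) - g (raise (after (after k)) (raise k x)).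
have three k : [/\ k != after k, k != after (after k) & after k != after (after k)].
  by elim/I3P: k.
have DE k x : (deg (lattice_of x) + 2)%N = 6%N ->
    D k x = edge_weight d (lattice_of x) k (after k) (after (after k)).
  move=> dx; have [h1 h2 h3] := three k; rewrite -hpsi // /D /g !lattice_raise //.
have ge0 x k : (x.1.1 + x.1.2 + x.2 == 4)%N -> 0 <= D k x.
  move=> /eqP dx; have {}dx : (deg (lattice_of x) + 2)%N = 6%N by rewrite /deg !ffunE /= dx.
  rewrite DE //; have [h1 h2 h3] := three k.
  have [[e he]|ne] := pselect (exists e : inner_edges 6 N,
    unit_in e (lattice_of x) k (after k) (after (after k))).
    by rewrite (edge_weight_in HN d h3 he) ltW.
  by rewrite edge_weight_out // => e he; apply: ne; exists e.
have zero x k : (x.1.1 + x.1.2 + x.2 == 4)%N -> flat_pair k x -> D k x = 0.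
  move=> /eqP dx; have {}dx : (deg (lattice_of x) + 2)%N = 6%N by rewrite /deg !ffunE /= dx.
  have d6 a b : deg (lattice_of (raise a (raise b x))) = 6%N.
    by rewrite !lattice_raise !degD !deg_dl; move: dx; rewrite -addnA.
  move=> /hasP[t tT /andP[i1 i2]]; rewrite DE //; have [h1 h2 h3] := three k.
  apply: edge_weight_out => e.
  apply: (@flat_rhombus R 6 N HN (@box_hexagon 6 R t)) => //; first by exists t.
    by rewrite -!lattice_raise; exact: inside_hexagon.
  by rewrite addrAC -!lattice_raise; exact: inside_hexagon.
have dy : (deg (lattice_of (2, 0, 2)%N) + 2)%N = 6%N by rewrite /deg !ffunE.
have NT t : t \in tile_faces -> N (@box_hexagon 6 R t) by move=> tT; exists t.
have r2 a b x : lattice_of x + dl a + dl b = lattice_of (raise b (raise a x)).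
  by rewrite !lattice_raise.
have d6 a b : deg (lattice_of (raise b (raise a (2, 0, 2)%N))) = 6%N.
  by rewrite -r2 !degD !deg_dl /deg !ffunE.
(* A unit triangle and an adjacent rhombus of the tiling; their common edge supplies the one strict
   inequality. *)
pose up : box := ((2, 0, 3), (3, 1, 4)); pose down : box := ((2, 0, 2), (4, 1, 3)).
have upT : up \in tile_faces by vm_compute.
have downT : down \in tile_faces by vm_compute.
have [|||e he] := @edge_between R 6 N HN (@box_hexagon 6 R up) (@box_hexagon 6 R down)
  (lattice_of (2, 0, 2)%N) k2 k0 k1 isT isT isT dy (NT _ upT) (NT _ downT).
- move=> c; rewrite r2; apply: (inside_hexagon (d6 _ _)).
  by elim/I3P: c; vm_compute.
- move=> c c' cc; rewrite r2; apply: (inside_hexagon (d6 _ _)).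
  by elim/I3P: c cc; elim/I3P: c'; vm_compute.
- rewrite r2 => /(_ k2) /andP[+ _]; rewrite (bar_vec _ _ (d6 _ _)) ffunE.
  by rewrite [_%:R]pmulrn ler_int.
(* Farkas certificate: these seven bends add up to a combination of the eight
   bends that vanish. *)
have : 0 < D k2 (2, 0, 2)%N.
  rewrite (DE k2 _ dy : _ = edge_weight d (lattice_of (2, 0, 2)%N) k2 k0 k1).
  rewrite (edge_weight_in HN d _ he) //; exact: dpos.
have := ge0 (4, 0, 0)%N k2 isT.
have := ge0 (1, 0, 3)%N k2 isT.
have := ge0 (0, 0, 4)%N k0 isT.
have := ge0 (2, 2, 0)%N k0 isT.
have := ge0 (0, 2, 2)%N k1 isT.
have := ge0 (1, 3, 0)%N k2 isT.
have := zero (4, 0, 0)%N k1 isT isT.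
have := zero (2, 0, 2)%N k0 isT isT.
have := zero (1, 0, 3)%N k1 isT isT.
have := zero (3, 1, 0)%N k2 isT isT.
have := zero (0, 1, 3)%N k2 isT isT.
have := zero (2, 2, 0)%N k1 isT isT.
have := zero (0, 2, 2)%N k2 isT isT.
have := zero (0, 3, 1)%N k0 isT isT.
rewrite /D /raise /after /=; lra.
Qed.
End Unrealizable.

Theorem theoremC (R : realType) (m : nat) (m_gt0 : (0 < m)%N)
    (S : set 'rV[R]_m) (S_poly : integral_polyhedral S) :
  exists (n : nat) (N : set (set 'rV[R]_2)),
    [/\ (0 < n)%N, linear_newton_subdivision n N
      & linearly_isomorphic (@realization_space R n N) S].
Proof.
case: S_poly => p [q [A [B SE]]]; have {}SE : S = polyhedron A B by exact: SE.
have [S0|/set0P[x]] := eqVneq S set0; last first.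
  by rewrite SE => /polyhedron_realization.
exists 6%N, (@box_cells 6 R tile_faces); split => //; first exact: tiling_lns tiling_tiles.
by rewrite S0 unrealizable; exact: linearly_isomorphic0.
Qed.
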